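(* Let $X,U$ be Hilbert spaces, let $A:D(A)\to X$ generate a $C_0$-semigroup $(S(t))_{t\ge 0}$ on $X$, and let $B\in L(U,X)$. If the control system $\dot y(t)=Ay(t)+Bu(t)$ is exactly null controllable in some time $T>0$, then it is completely stabilizable.
   Context: For $y_0\in X$ and $u\in L^2(0,T;U)$, the solution of $\dot y=Ay+Bu$, $y(0)=y_0$, is the mild solution $y(T;y_0,u)=S(T)y_0+\int_0^TS(T-t)Bu(t)\,dt$. The system is exactly null controllable in time $T$ if for every $y_0\in X$ there exists $u\in L^2(0,T;U)$ such that $y(T;y_0,u)=0$. For $K\in L(X,U)$, $(S_K(t))_{t\ge0}$ denotes the $C_0$-semigroup generated by $A+BK$, and $\omega_K$ its growth bound: the infimum (in $[-\infty,+\infty)$) of all $\omega\in\mathbb{R}$ for which there is $M\ge1$ with $\Vert S_K(t)\Vert_{L(X)}\le Me^{\omega t}$ for all $t\ge0$. The system is completely stabilizable if $\inf\{\omega_K\mid K\in L(X,U)\}=-\infty$, i.e. for every $\omega\in\mathbb{R}$ there exists $K\in L(X,U)$ with $\omega_K<\omega$. *)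

(* Defs.v *)
(* MathComp / MathComp-Analysis. *)
From HB Require Import structures.
From mathcomp Require Import all_boot all_order all_algebra.
From mathcomp Require Import all_classical all_reals all_analysis.
From mathcomp Require Import complex.

Set Implicit Arguments.
Unset Strict Implicit.
Unset Printing Implicit Defensive.

Import Order.TTheory GRing.Theory Num.Theory.
Import numFieldNormedType.Exports.

Local Open Scope classical_set_scope.
Local Open Scope ring_scope.

(* Hilbert spaces may be real or complex; X and U share the same scalars. *)
Variant scalar_kind : Set := RealScalars | ComplexScalars.

Definition scalar_field (R : realType) (c : scalar_kind) : numFieldType :=
  match c with
  | RealScalars => R
  | ComplexScalars => R[i]
  end.

Definition scalar_of_real (R : realType) (c : scalar_kind) :
    R -> scalar_field R c :=
  match c return R -> scalar_field R c with
  | RealScalars => fun a => a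
  | ComplexScalars => fun a => Complex a 0
  end.

Definition scalar_re (R : realType) (c : scalar_kind) : scalar_field R c -> R :=
  match c return scalar_field R c -> R with
  | RealScalars => fun a => a
  | ComplexScalars => @complex.Re R
  end.

Definition scalar_conj (R : realType) (c : scalar_kind) :
    scalar_field R c -> scalar_field R c :=
  match c return scalar_field R c -> scalar_field R c with
  | RealScalars => fun a => a
  | ComplexScalars => @conjc R
  end.

(* The norm of a normedModType over K takes its values in K; it is a
   nonnegative real scalar, and rnorm is that number as an element of R. *)
Definition rnorm (R : realType) (c : scalar_kind)
    (X : normedModType (scalar_field R c)) (x : X) : R :=
  scalar_re `|x|.

Definition hilbert (R : realType) (c : scalar_kind)
    (X : completeNormedModType (scalar_field R c)) : Prop :=
  exists dot : {dot X for @scalar_conj R c},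
    forall x : X, `|x| ^+ 2 = dot x x.

Definition opnorm (R : realType) (c : scalar_kind)
    (X Y : normedModType (scalar_field R c)) (f : X -> Y) : R :=
  sup [set rnorm (f x) | x in [set x : X | rnorm x <= 1]].

(* Only the values S t with 0 <= t matter. *)
Definition c0_semigroup (R : realType) (c : scalar_kind)
    (X : normedModType (scalar_field R c)) (S : R -> {linear X -> X}) : Prop :=
  [/\ forall t, 0 <= t -> continuous (S t),
      forall x, S 0 x = x,
      forall s t, 0 <= s -> 0 <= t -> forall x, S (s + t) x = S s (S t x)
    & forall x, S t x @[t --> 0^'+] --> x].

Definition difference_quotient (R : realType) (c : scalar_kind)
    (X : normedModType (scalar_field R c)) (S : R -> {linear X -> X})
    (x : X) (h : R) : X :=
  (scalar_of_real c h)^-1 *: (S h x - x).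

(* An unbounded operator is given by its domain D and a map A : X -> X whose
   values outside D are irrelevant. *)
Definition generates (R : realType) (c : scalar_kind)
    (X : normedModType (scalar_field R c)) (D : set X) (A : X -> X)
    (S : R -> {linear X -> X}) : Prop :=
  [/\ c0_semigroup S,
      D = [set x | cvg (difference_quotient S x h @[h --> 0^'+])]
    & forall x, D x -> difference_quotient S x h @[h --> 0^'+] --> A x].

Definition simple_function (R : realType) (X : Type) (s : R -> X) : Prop :=
  finite_set (range s) /\
  forall x, measurable (s @^-1` [set x]).

Definition simple_integral (R : realType) (c : scalar_kind)
    (X : normedModType (scalar_field R c)) (T : R) (s : R -> X) : X :=
  \sum_(x \in range s)
    scalar_of_real c
      (fine (lebesgue_measure (`]0, T[%classic `&` s @^-1` [set x]))) *: x.

Definition strongly_measurable (R : realType) (c : scalar_kind)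
    (X : normedModType (scalar_field R c)) (T : R) (f : R -> X) : Prop :=
  exists s : nat -> R -> X,
    (forall n, simple_function (s n)) /\
    {ae @lebesgue_measure R,
      forall t, `]0, T[%classic t -> s n t @[n --> \oo] --> f t}.

(* v is the Bochner integral of f over (0, T). The real integral is the lower
   Lebesgue integral with respect to Borel sets; as f is strongly measurable,
   its integrand agrees almost everywhere with a Borel function. *)
Definition is_bochner_integral (R : realType) (c : scalar_kind)
    (X : normedModType (scalar_field R c)) (T : R) (f : R -> X) (v : X) : Prop :=
  strongly_measurable T f /\
  exists s : nat -> R -> X,
    [/\ forall n, simple_function (s n),
        (\int[@lebesgue_measure R]_(t in `]0%R, T[%classic)
           (rnorm (f t - s n t))%:E)%E @[n --> \oo] --> 0%E
      & simple_integral T (s n) @[n --> \oo] --> v].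

Definition square_integrable (R : realType) (c : scalar_kind)
    (X : normedModType (scalar_field R c)) (T : R) (u : R -> X) : Prop :=
  strongly_measurable T u /\
  (\int[@lebesgue_measure R]_(t in `]0%R, T[%classic)
     (rnorm (u t) ^+ 2)%:E < +oo)%E.

(* y = y(T; y0, u). *)
Definition is_mild_solution (R : realType) (c : scalar_kind)
    (X U : normedModType (scalar_field R c)) (S : R -> {linear X -> X})
    (B : {linear U -> X}) (T : R) (y0 : X) (u : R -> U) (y : X) : Prop :=
  exists2 v, is_bochner_integral T (fun t => S (T - t) (B (u t))) v
           & y = S T y0 + v.

Definition exactly_null_controllable (R : realType) (c : scalar_kind)
    (X U : normedModType (scalar_field R c)) (S : R -> {linear X -> X})
    (B : {linear U -> X}) (T : R) : Prop :=
  forall y0 : X, exists2 u : R -> U,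
    square_integrable T u & is_mild_solution S B T y0 u 0.

Definition growth_bound (R : realType) (c : scalar_kind)
    (X : normedModType (scalar_field R c)) (S : R -> {linear X -> X}) : \bar R :=
  ereal_inf [set w%:E | w in [set w : R | exists2 M : R, 1 <= M &
    forall t, 0 <= t -> opnorm (S t) <= M * expR (w * t)]].

(* The semigroup S_K generated by A + BK exists and is unique (its values at
   negative times aside), so the set below is {omega_K | K in L(X,U)}. *)
Definition completely_stabilizable (R : realType) (c : scalar_kind)
    (X U : normedModType (scalar_field R c)) (D : set X) (A : X -> X)
    (B : {linear U -> X}) : Prop :=
  ereal_inf [set w : \bar R |
    exists (K : {linear X -> U}) (SK : R -> {linear X -> X}),
      [/\ continuous K,
          generates D (fun x => A x + B (K x)) SK
        & w = growth_bound SK]] = -oo%E.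

(* Main.v *)
(* For null controllable systems the linear-quadratic problem of minimizing the
   integral of |y|^2 + |u|^2 has finite value, bounded by k |x|^2; the value is
   a quadratic form, and near-optimal trajectories converge to trajectories of a
   semigroup that is bounded in time.  Comparing costs on short intervals shows
   that, up to o(h), an optimal control on [0, h] is a constant K x with K linear
   and bounded, so that this semigroup is S h x + h B (K x) + o(h) and has the
   generator A + B K, with the domain of A.  Applied to e^(w t) S(t), which is
   null controllable as well, this gives growth bound at most - w.  Everything is
   done over the underlying real Hilbert spaces; complex linearity of K follows as
   the problem is invariant under multiplication by scalars of modulus 1. *)
Require Import Defs.
From HB Require Import structures.
From mathcomp Require Import all_boot all_order all_algebra.
From mathcomp Require Import complex finmap.
From mathcomp Require Import all_classical all_reals all_analysis.
From mathcomp Require Import measurable_realfun.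
From mathcomp Require Import ring lra.
Import Order.TTheory GRing.Theory Num.Theory.
Import numFieldNormedType.Exports.
Set Implicit Arguments.
Unset Strict Implicit.
Unset Printing Implicit Defensive.
Local Open Scope classical_set_scope.
Local Open Scope ring_scope.

(** * Integrals of locally bounded Borel functions *)

(** No minimizer of the quadratic cost is constructed, and no space of square-integrable controls is
    completed. Controls range over Borel selections from finitely many continuous functions, so that
    real integrands are Borel and locally bounded, and vector integrals are weak ones. The
    parallelogram law replaces compactness: the difference of two near-optimal controls for the same
    state is nearly free, hence has small energy, so the states converge without any limit of the
    controls. Infinite horizons are avoided by infima over finite ones with a terminal penalty
    [k * nm y ^+ 2]; as some control on every long horizon keeps the penalized cost below
    [k * nm x ^+ 2], any control can be prolonged without raising its penalized cost. For this it
    suffices to steer close to zero, and so the given square-integrable controls can be replaced by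
    simple ones; Baire's theorem makes the energy bound that survives uniform in the state. *)

Section RealIntegral.
Variable R : realType.
Implicit Types (f g : R -> R) (a b c : R).

Notation mu := (@lebesgue_measure R).

(** Half-open intervals make [ri_split] exact and match the concatenation of controls, where the
    switching time belongs to the first control. *)
Definition ri a b f : R := \int[mu]_(x in `]a, b]%classic) f x.

Lemma riE a b f : ri a b f = \int[mu]_(x in `]a, b]%classic) f x.
Proof. by []. Qed.

(** A class stable under sums, products and shifts whose members are integrable on bounded
    intervals, so that the calculus of [ri] carries no integrability conditions. *)
Definition bm f : Prop := measurable_fun setT f /\
  forall a b, exists C, forall s, a <= s <= b -> `|f s| <= C.

Lemma bm_cst c : bm (fun=> c).
Proof. by split=> // a b; exists `|c|. Qed.

Lemma bmD f g : bm f -> bm g -> bm (fun s => f s + g s).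
Proof.
move=> [mf bf] [mg bg]; split; first exact: measurable_funD.
move=> a b; have [C hC] := bf a b; have [C' hC'] := bg a b.
exists (C + C') => s sab; apply: le_trans (ler_normD _ _) _.
by apply: lerD; [exact: hC|exact: hC'].
Qed.

Lemma bmM f g : bm f -> bm g -> bm (fun s => f s * g s).
Proof.
move=> [mf bf] [mg bg]; split; first exact: measurable_funM.
move=> a b; have [C hC] := bf a b; have [C' hC'] := bg a b.
exists (C * C') => s sab; rewrite normrM.
by apply: ler_pM => //; [exact: hC|exact: hC'].
Qed.

Lemma bmZ k f : bm f -> bm (fun s => k * f s).
Proof. exact/bmM/bm_cst. Qed.

Lemma bmN f : bm f -> bm (fun s => - f s).
Proof.
by move=> bf; under eq_fun do rewrite -mulN1r; exact: bmZ.
Qed.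

Lemma bmB f g : bm f -> bm g -> bm (fun s => f s - g s).
Proof. by move=> bf bg; apply: bmD => //; exact: bmN. Qed.

Lemma bm_norm f : bm f -> bm (fun s => `|f s|).
Proof.
move=> [mf bf]; split; first exact: measurableT_comp.
by move=> a b; have [C hC] := bf a b; exists C => s /hC; rewrite normr_id.
Qed.

Lemma bmX f n : bm f -> bm (fun s => f s ^+ n).
Proof.
move=> bf; elim: n => [|n ih]; first exact: bm_cst.
by under eq_fun do rewrite exprS; exact: bmM.
Qed.

Lemma bm_shift h f : bm f -> bm (fun s => f (s + h)).
Proof.
move=> [mf bf]; split.
  apply: measurableT_comp => //.
  by apply: measurable_funD => //; exact: measurable_cst.
move=> a b; have [C hC] := bf (a + h) (b + h); exists C => s /andP[sa sb].
by apply: hC; rewrite !lerD2r sa.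
Qed.

Lemma bm_continuous f : continuous f -> bm f.
Proof.
move=> cf; split; first exact: continuous_measurable_fun.
move=> a b.
have [ab|ba] := leP a b; last first.
  by exists 0 => s /andP[h1 h2]; move: ba; rewrite ltNge (le_trans h1 h2).
have [c cab hc] := @EVT_max _ (fun s => `|f s|) _ _ ab (continuous_subspaceT
  (fun x => continuous_comp (cf x) (@norm_continuous _ _ _))).
by exists `|f c| => s sab; apply: hc; rewrite in_itv.
Qed.

Lemma bm_integrable a b f : bm f -> mu.-integrable `]a, b] (EFin \o f).
Proof.
move=> [mf bf]; apply: measurable_bounded_integrable => //.
- rewrite /= lebesgue_measure_itv/=; case: ifPn => // _.
  by rewrite -EFinB ltry.
- exact: measurable_funTS.
- have [C hC] := bf a b; exists C; split; first exact: num_real.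
  move=> M CM x /=; rewrite in_itv/= => /andP[ax xb].
  by apply: le_trans (ltW CM); apply: hC; rewrite (ltW ax).
Qed.

Lemma ri_ext a b f g : (forall s, a < s -> s <= b -> f s = g s) ->
  ri a b f = ri a b g.
Proof.
move=> fg; apply: eq_Rintegral => x; rewrite inE/= in_itv/= => /andP[h1 h2].
exact: fg.
Qed.

Lemma riD a b f g : bm f -> bm g ->
  ri a b (fun s => f s + g s) = ri a b f + ri a b g.
Proof. by move=> bf bg; apply: RintegralD => //; exact: bm_integrable. Qed.

Lemma riB a b f g : bm f -> bm g ->
  ri a b (fun s => f s - g s) = ri a b f - ri a b g.
Proof. by move=> bf bg; apply: RintegralB => //; exact: bm_integrable. Qed.

Lemma riZ a b k f : bm f -> ri a b (fun s => k * f s) = k * ri a b f.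
Proof. by move=> bf; apply: RintegralZl => //; exact: bm_integrable. Qed.

Lemma ri_le a b f g : bm f -> bm g ->
  (forall s, a < s -> s <= b -> f s <= g s) -> ri a b f <= ri a b g.
Proof.
move=> bf bg fg; apply: le_Rintegral => //; try exact: bm_integrable.
by move=> x /=; rewrite in_itv/= => /andP[h1 h2]; exact: fg.
Qed.

Lemma ri_ge0 a b f : (forall s, a < s -> s <= b -> 0 <= f s) -> 0 <= ri a b f.
Proof.
move=> f0; apply: Rintegral_ge0 => x /=.
by rewrite in_itv/= => /andP[]; exact: f0.
Qed.

Lemma ri_cst a b k : a <= b -> ri a b (fun=> k) = k * (b - a).
Proof.
move=> ab; rewrite /ri Rintegral_cst//= lebesgue_measure_itv/=.
rewrite lte_fin; case: ltP => //= ba.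
by rewrite (@le_anti _ _ a b) ?ab// subrr.
Qed.

Lemma ri_nil a b f : b <= a -> ri a b f = 0.
Proof.
by move=> ba; rewrite /ri set_itv_ge ?Rintegral_set0// bnd_simp -leNgt.
Qed.

Lemma ri_split a b c f : bm f -> a <= b -> b <= c ->
  ri a c f = ri a b f + ri b c f.
Proof.
move=> bf ab bc; rewrite /ri.
have E : `]a, c]%classic = `]a, b] `|` `]b, c].
  apply/seteqP; split=> x /=; rewrite !in_itv/=.
    by move=> /andP[h1 h2]; case: (leP x b) => h; [left|right]; rewrite ?h1 ?h2.
  case=> /andP[h1 h2]; first by rewrite h1 (le_trans h2).
  by rewrite h2 (le_lt_trans ab).
rewrite E Rintegral_setU//; first by rewrite -E; exact: bm_integrable.
apply/disj_set2P; rewrite -subset0 => x /= []; rewrite !in_itv/=.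
by move=> /andP[_ h1] /andP[h2 _]; move: h2; rewrite ltNge h1.
Qed.

Lemma ri_norm a b f : bm f -> `|ri a b f| <= ri a b (fun s => `|f s|).
Proof. by move=> bf; apply: le_normr_Rintegral => //; exact: bm_integrable. Qed.

Let shiftR (h s : R) : R := s + h.

Let measurable_shiftR h :
  measurable_fun [set: measurableTypeR R] (shiftR h : _ -> measurableTypeR R).
Proof. by apply: measurable_funD => //; exact: measurable_cst. Qed.

(** The image of the measure under the shift gives every bounded interval its length, and this
    determines Lebesgue measure. *)
Lemma lebesgue_measure_shift (h : R) (A : set (measurableTypeR R)) :
  measurable A -> mu A = mu [set s | A (s + h)].
Proof.
move=> mA.
pose nu := measure_function_pushforward__canonical__measure_function_Measure
  mu (measurable_shiftR h).
apply: (@lebesgue_measure_unique R nu) => // X [[x y] /= xy <-].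
rewrite /nu/= /pushforward (_ : _ @^-1` _ = `]x - h, y - h]%classic); last first.
  apply/seteqP; split=> s /=; rewrite !in_itv/= /shiftR => /andP[? ?];
  apply/andP; split; lra.
rewrite !lebesgue_measure_itv/= !lte_fin ltrD2r; case: ifP => // _.
by rewrite -!EFinB; congr (_%:E); ring.
Qed.

Lemma ri_shift a b h f : bm f ->
  ri (a + h) (b + h) f = ri a b (fun s => f (s + h)).
Proof.
move=> bf; rewrite /ri /Rintegral; congr fine.
have E : shiftR h @^-1` `](a + h), (b + h)] = `]a, b]%classic.
  by apply/seteqP; split=> s /=; rewrite !in_itv/= /shiftR ltrD2r lerD2r.
have := @integral_pushforward _ _ (measurableTypeR R) (measurableTypeR R) R (shiftR h) (measurable_shiftR h) mu
  `](a + h), (b + h)] (EFin \o f).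
rewrite E => <- //=.
- apply: eq_measure_integral => //= A mA _.
  exact: lebesgue_measure_shift.
- by apply/measurable_EFinP; case: bf.
- by have := bm_integrable a b (bm_shift h bf).
Qed.

(** Meant for trajectories, whose increments to the right are given by the flow property. The
    function is the pointwise limit of its values at the next grid point to the right, and these
    approximations are constant on countably many intervals. *)
Lemma right_continuous_measurable f :
  (forall t e, 0 < e -> exists2 d, 0 < d &
     forall h, 0 <= h <= d -> `|f (t + h) - f t| <= e) ->
  measurable_fun setT f.
Proof.
move=> rc.
pose p (n : nat) (t : R) : R := ((Num.floor (t * n.+1%:R))%:~R + 1) / n.+1%:R.
have pP n t : t <= p n t <= t + n.+1%:R^-1.
  rewrite /p; have n0 : 0 < n.+1%:R :> R by [].
  have := floor_le (t * n.+1%:R); have := floorD1_gt (t * n.+1%:R).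
  rewrite intrD/= => h1 h2; rewrite ler_pdivlMr// ler_pdivrMr// mulrDl mulVf ?gt_eqF//.
  by rewrite (ltW h1) lerD2r.
apply: (@measurable_fun_cvg _ _ _ setT (fun n t => f (p n t)) f).
  move=> n _ Y mY; rewrite setTI.
  have -> : (fun t => f (p n t)) @^-1` Y = \bigcup_(k in [set k : int |
       Y (f ((k%:~R + 1) / n.+1%:R))])
       [set t | k%:~R <= t * n.+1%:R < k%:~R + 1].
    apply/seteqP; split=> t /=.
      move=> h; exists (Num.floor (t * n.+1%:R)) => //=.
      have := floor_le (t * n.+1%:R); have := floorD1_gt (t * n.+1%:R).
      by rewrite intrD/= => -> ->.
    move=> [k /= hk /andP[h1 h2]].
    rewrite /p (_ : Num.floor _ = k)//; apply/eqP.
    by rewrite floor_eq h1 intrD h2.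
  rewrite bigcup_mkcond; apply: countable_bigcupT_measurable => // k.
  case: ifP => // _.
  rewrite (_ : [set t | _] = `[k%:~R / n.+1%:R, (k%:~R + 1) / n.+1%:R[%classic) //.
  by apply/seteqP; split=> t /=; rewrite in_itv/= ler_pdivrMr// ltr_pdivlMr.
move=> t _; apply/cvgrPdist_le => e e0.
have [d d0 hd] := rc t e e0.
near=> n.
have /andP[h1 h2] := pP n t.
rewrite distrC (_ : p n t = t + (p n t - t)); last by rewrite addrC subrK.
apply: hd; rewrite subr_ge0 h1/= lerBlDl (le_trans h2)// lerD2l.
apply/ltW; near: n.
exact: near_infty_natSinv_lt (PosNum d0).
Unshelve. all: by end_near. Qed.

End RealIntegral.

Global Opaque ri.

(** * Real Hilbert spaces *)

Record hilb (R : realType) := Hilb {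
  hsort :> lmodType R;
  ip : hsort -> hsort -> R;
  ipDl : forall x y z, ip (x + y) z = ip x z + ip y z;
  ipZl : forall a x z, ip (a *: x) z = a * ip x z;
  ipC : forall x y, ip x y = ip y x;
  ip_ge0 : forall x, 0 <= ip x x;
  ip_eq0 : forall x, ip x x = 0 -> x = 0;
  hilb_complete : forall u : nat -> hsort,
    (forall e, 0 < e -> exists N, forall m n, (N <= m)%N -> (N <= n)%N ->
       ip (u m - u n) (u m - u n) <= e) ->
    exists l, forall e, 0 < e -> exists N, forall n, (N <= n)%N ->
       ip (u n - l) (u n - l) <= e }.

Section HilbertSpace.
Variables (R : realType) (X : hilb R).
Implicit Types (x y z : X) (a b c e : R).

Definition nm x : R := Num.sqrt (ip x x).

Lemma ipDr x y z : ip x (y + z) = ip x y + ip x z.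
Proof. by rewrite ipC ipDl !(ipC x). Qed.

Lemma ipZr a x y : ip x (a *: y) = a * ip x y.
Proof. by rewrite ipC ipZl (ipC x). Qed.

Lemma ipNl x y : ip (- x) y = - ip x y.
Proof. by rewrite -scaleN1r ipZl mulN1r. Qed.

Lemma ipNr x y : ip x (- y) = - ip x y.
Proof. by rewrite ipC ipNl ipC. Qed.

Lemma ip0l x : ip 0 x = 0.
Proof. by rewrite -(scale0r 0) ipZl mul0r. Qed.

Definition ipE := (ipDl, ipDr, ipNl, ipNr, ipZl, ipZr).

Lemma ip_inj x y : (forall z, ip x z = ip y z) -> x = y.
Proof.
move=> h; apply/eqP; rewrite -subr_eq0; apply/eqP/ip_eq0.
by rewrite ipDl ipNl h subrr.
Qed.

Lemma nm_ge0 x : 0 <= nm x. Proof. exact: sqrtr_ge0. Qed.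

Lemma nm_sq x : nm x ^+ 2 = ip x x. Proof. exact/sqr_sqrtr/ip_ge0. Qed.

Lemma nm_le x c : 0 <= c -> (nm x <= c) = (ip x x <= c ^+ 2).
Proof. by move=> c0; rewrite -nm_sq ler_sqr// nnegrE// nm_ge0. Qed.

Lemma nm0 : nm 0 = 0. Proof. by rewrite /nm ip0l sqrtr0. Qed.

Lemma nm_eq0 x : nm x = 0 -> x = 0.
Proof. by move=> x0; apply: ip_eq0; rewrite -nm_sq x0 expr0n. Qed.

Lemma nmN x : nm (- x) = nm x. Proof. by rewrite /nm ipNl ipNr opprK. Qed.

Lemma nm_distC x y : nm (x - y) = nm (y - x).
Proof. by rewrite -nmN opprB. Qed.

Lemma nmZ a x : nm (a *: x) = `|a| * nm x.
Proof. by rewrite /nm ipZl ipZr mulrA -expr2 sqrtrM ?sqr_ge0// sqrtr_sqr. Qed.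

Lemma ip_sq x y : ip x y ^+ 2 <= ip x x * ip y y.
Proof.
have := ip_ge0 (ip y y *: x - ip x y *: y); rewrite !ipE (ipC y x) => h.
have := ip_ge0 y; rewrite le_eqVlt => /orP[/eqP y0|y0].
  by rewrite (ip_eq0 (esym y0)) -(scale0r 0) ipZr mul0r expr0n mulr_ge0 ?ip_ge0// -(scale0r 0) ipZl mul0r.
rewrite -subr_ge0 -(pmulr_rge0 _ y0); lra.
Qed.

Lemma ip_nm x y : `|ip x y| <= nm x * nm y.
Proof.
rewrite -ler_sqr ?nnegrE ?mulr_ge0 ?nm_ge0// exprMn !nm_sq real_normK ?num_real//.
exact: ip_sq.
Qed.

Lemma ip_le x y : ip x y <= nm x * nm y.
Proof. exact: le_trans (ler_norm _) (ip_nm x y). Qed.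

Lemma nmD x y : nm (x + y) <= nm x + nm y.
Proof.
rewrite nm_le ?addr_ge0 ?nm_ge0// !ipE (ipC y x) sqrrD !nm_sq.
by have := ip_le x y; lra.
Qed.

Lemma nmB x y : nm (x - y) <= nm x + nm y.
Proof. by rewrite -(nmN y) nmD. Qed.

Lemma nm_trans y x z : nm (x - z) <= nm (x - y) + nm (y - z).
Proof. by rewrite -[x in x - z](subrK y) -addrA nmD. Qed.

Lemma nm_subl x y : nm x <= nm y + nm (x - y).
Proof. by rewrite -{1}(subrK y x) addrC nmD. Qed.

Lemma nm_dist x y : `|nm x - nm y| <= nm (x - y).
Proof.
by rewrite ler_norml; have := nm_subl x y; have := nm_subl y x;
  rewrite (nm_distC y); lra.
Qed.

Lemma nm_test x c : 0 <= c -> (forall z, ip x z <= c * nm z) -> nm x <= c.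
Proof.
move=> c0 /(_ x); rewrite -nm_sq expr2.
have := nm_ge0 x; rewrite le_eqVlt => /orP[/eqP<- //|x0].
by rewrite ler_pM2r.
Qed.

Lemma sq_nmD x y : nm (x + y) ^+ 2 <= 2 * nm x ^+ 2 + 2 * nm y ^+ 2.
Proof.
have := ip_ge0 (x - y); rewrite !nm_sq !ipE (ipC y x); lra.
Qed.

Lemma nm_par x y :
  nm (x + y) ^+ 2 + nm (x - y) ^+ 2 = 2 * nm x ^+ 2 + 2 * nm y ^+ 2.
Proof. by rewrite !nm_sq !ipE (ipC y); ring. Qed.

Lemma cauchy_nm (u : nat -> X) :
  (forall e, 0 < e -> exists N, forall m n, (N <= m)%N -> (N <= n)%N ->
     nm (u m - u n) <= e) ->
  exists l, forall e, 0 < e -> exists N, forall n, (N <= n)%N -> nm (u n - l) <= e.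
Proof.
move=> cu; have [|l hl] := @hilb_complete R X u.
  move=> e e0; have se : 0 < Num.sqrt e by rewrite sqrtr_gt0.
  have [N hN] := cu _ se; exists N => m n Nm Nn.
  by rewrite -nm_sq -[leRHS](sqr_sqrtr (ltW e0)) ler_sqr ?nnegrE ?nm_ge0 ?(ltW se)// hN.
exists l => e e0; have [|N hN] := hl (e ^+ 2); first by rewrite exprn_gt0.
by exists N => n Nn; rewrite nm_le ?(ltW e0)// hN.
Qed.

Lemma invS_le e : 0 < e -> exists N, forall n, (N <= n)%N -> n.+1%:R^-1 <= e.
Proof.
move=> e0; exists (Num.truncn e^-1) => n Nn.
rewrite invf_ple ?posrE//; apply: ltW; apply: lt_le_trans (truncnS_gt _) _.
by rewrite ler_nat.
Qed.

Lemma le_addeps a b : (forall e, 0 < e -> a <= b + e) -> a <= b.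
Proof. by move=> h; apply/ler_addgt0Pr. Qed.

(** First variation: a quadratic polynomial in [t] that vanishes at zero and is nowhere negative has
    no linear term. The slack [e] allows its use along a minimizing sequence. The test value is
    [t = - a / (b + 1)], with [e = t ^+ 2]. *)
Lemma quad_eps a b : 0 <= b ->
  (forall e t, 0 < e -> - e <= b * t ^+ 2 + 2 * t * a) -> a = 0.
Proof.
move=> b0 h; apply/eqP/negPn/negP => a0.
have a20 : 0 < a ^+ 2 by rewrite exprn_even_gt0.
have b1 : 0 < b + 1 by lra.
pose t := - a / (b + 1).
have tE : t * (b + 1) = - a by rewrite /t mulfVK ?gt_eqF.
have t0 : 0 < t ^+ 2 by rewrite exprn_even_gt0//= /t mulf_eq0 oppr_eq0 invr_eq0 (negbTE a0) gt_eqF.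
have aE : a = - (t * (b + 1)) by rewrite tE opprK.
have bt : 0 <= b * t ^+ 2 by rewrite mulr_ge0// ltW.
have := h (t ^+ 2) t t0; rewrite aE; clear -t0 bt; clearbody t; lra.
Qed.

(** The representing vector minimizes [ip x x - 2 * f x]. The parallelogram law makes minimizing
    sequences Cauchy, since the value at a midpoint is at least the infimum. *)
Lemma riesz (f : X -> R) C :
  (forall x y, f (x + y) = f x + f y) -> (forall a x, f (a *: x) = a * f x) ->
  (forall x, `|f x| <= C * nm x) ->
  exists z, forall x, f x = ip z x.
Proof.
move=> fD fZ fC.
pose q x := ip x x - 2 * f x.
have q_lb x : - C ^+ 2 <= q x.
  rewrite /q -nm_sq; have := fC x; rewrite ler_norml => /andP[_].
  have := sqr_ge0 (nm x - C); lra.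
pose m := inf [set q x | x in setT].
have hm : has_inf [set q x | x in setT].
  by split; [exists (q 0), 0|exists (- C ^+ 2) => _ [x _ <-]].
have m_le x : m <= q x by apply: ge_inf; [case: hm|exists x].
have mP e : 0 < e -> exists x, q x <= m + e.
  by move=> e0; have [_ [x _ <-] h] := inf_adherent e0 hm; exists x; exact: ltW.
have /choice[u hu] : forall n : nat, exists x, q x <= m + n.+1%:R^-1.
  by move=> n; apply: mP; rewrite invr_gt0.
have par x y : ip (x - y) (x - y) = 2 * q x + 2 * q y - 4 * q (2^-1 *: (x + y)).
  by rewrite /q fZ fD !ipE (ipC y x); field.
have [|z hz] := @hilb_complete R X u.
  move=> e e0; have [|N hN] := @invS_le (e / 4); first by lra.
  exists N => i j Ni Nj; rewrite par.
  have := m_le (2^-1 *: (u i + u j)).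
  have := le_trans (hu i) (lerD (lexx m) (hN _ Ni)).
  have := le_trans (hu j) (lerD (lexx m) (hN _ Nj)); lra.
exists z => x; apply/eqP; rewrite eq_sym -subr_eq0; apply/eqP.
apply: (@quad_eps _ (ip x x)); first exact: ip_ge0.
move=> e t e0.
pose B := 2 * `|t| * nm x + 1.
have B0 : 0 < B by rewrite /B ltr_wpDl// !mulr_ge0// nm_ge0.
pose d := e / (2 * B).
have d0 : 0 < d by rewrite divr_gt0// mulr_gt0.
have [N1 hN1] := hz (d ^+ 2) (exprn_gt0 _ d0).
have [|N2 hN2] := @invS_le (e / 2); first by lra.
pose n := maxn N1 N2.
have h1 := hN1 n (leq_maxl _ _); have h2 := hN2 n (leq_maxr _ _).
have {}h1 : nm (u n - z) <= d by rewrite nm_le// ltW.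
have h3 := le_trans (hu n) (lerD (m_le (u n + t *: x)) h2).
have h4 := ip_nm (u n - z) x.
have h5 : nm (u n - z) * nm x <= d * nm x by rewrite ler_wpM2r// nm_ge0.
have h6 : `|2 * t * ip (u n - z) x| <= e / 2.
  have -> : e / 2 = d * B by rewrite /d; field; lra.
  rewrite !normrM [ `|2|]ger0_norm//.
  have -> : d * B = 2 * `|t| * (d * nm x) + d by rewrite /B; ring.
  have : 2 * `|t| * `|ip (u n - z) x| <= 2 * `|t| * (d * nm x).
    by rewrite ler_wpM2l ?mulr_ge0// (le_trans h4).
  lra.
move: h3 h6; rewrite /q fD fZ !ipE ler_norml => h3 /andP[_].
rewrite (ipC x (u n)) in h3 *; lra.
Qed.

(** Baire's theorem for a covering by closed sets. If no [F n] contains a ball, nested balls with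
    radii at least halved at each step, each new one missing the next [F n], have centres converging
    to a point outside every [F n]. *)
Lemma baire_ball (F : nat -> X -> Prop) :
  (forall n x, (forall e, 0 < e -> exists2 y, F n y & nm (x - y) <= e) -> F n x) ->
  (forall x, exists n, F n x) ->
  exists n x0 d, 0 < d /\ forall z, nm (z - x0) <= d -> F n z.
Proof.
move=> clF covF; apply: contrapT => nball.
(* A pair is a centre and a radius. The premise [0 < p.2] stands under the existential so that
   choice yields a function on all pairs. *)
have step (p : X * R) n : exists p' : X * R, 0 < p.2 ->
    [/\ 0 < p'.2, p'.2 <= p.2 / 2, nm (p'.1 - p.1) <= p.2 / 2 &
        forall y, nm (p'.1 - y) <= p'.2 -> ~ F n y].
  case: p => x d; have [d0|d0] := pselect (0 < d); last by exists (x, d) => /= /d0.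
  have /= [z zd Fz] : exists2 z, nm (z - x) <= d / 2 & ~ F n z.
    apply: contrapT => h; apply: nball; exists n, x, (d / 2); split; first by lra.
    by move=> z zd; apply: contrapT => Fz; apply: h; exists z.
  have [e e0 he] : exists2 e, 0 < e & forall y, nm (z - y) <= e -> ~ F n y.
    apply: contrapT => h; apply: Fz; apply: clF => e e0.
    apply: contrapT => h'; apply: h; exists e => // y ye Fy.
    by apply: h'; exists y.
  exists (z, Num.min e (d / 2)) => /= _; split => //.
  - by rewrite lt_min e0; lra.
  - by rewrite ge_min lexx orbT.
  - by move=> y; rewrite le_min => /andP[/he].
have /choice[f hf] : forall pn : (X * R) * nat, exists p' : X * R, 0 < pn.1.2 ->
    [/\ 0 < p'.2, p'.2 <= pn.1.2 / 2, nm (p'.1 - pn.1.1) <= pn.1.2 / 2 &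
        forall y, nm (p'.1 - y) <= p'.2 -> ~ F pn.2 y] by case=> p n; exact: step.
pose p := fix p n := if n is k.+1 then f (p k, k) else (0 : X, 1 : R).
have p0 n : 0 < (p n).2.
  by elim: n => [|n ih] /=; [exact: ltr01|have [] := hf (p n, n) ih].
have pS n := hf (p n, n) (p0 n).
have psmall n : (p n).2 <= n.+1%:R^-1.
  elim: n => [|n ih]; first by rewrite /= invr1.
  have [_ h _ _] := pS n; apply: (le_trans h).
  apply: (@le_trans _ _ (n.+1%:R^-1 / 2)); first by rewrite ler_pM2r.
  rewrite -invfM lef_pV2 ?posrE ?mulr_gt0// -natrM ler_nat.
  by rewrite muln2 -addnn addSn addnS !ltnS leq_addr.
have pdist n k : nm ((p (n + k)%N).1 - (p n).1) + (p (n + k)%N).2 <= (p n).2.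
  elim: k => [|k ih]; first by rewrite addn0 subrr nm0 add0r.
  have [_ h1 h2 _] := pS (n + k)%N; rewrite addnS /=.
  have := @nm_trans (p (n + k)%N).1 (f (p (n + k)%N, (n + k)%N)).1 (p n).1.
  move: h1 h2 ih => /=; lra.
have pdist' n m : (n <= m)%N -> nm ((p m).1 - (p n).1) <= (p n).2.
  move=> nm_; rewrite -(subnKC nm_); have := pdist n (m - n)%N.
  have := p0 (n + (m - n))%N; lra.
have [|l hl] := @cauchy_nm (fun n => (p n).1).
  move=> e e0; have [|N hN] := @invS_le (e / 2); first by lra.
  exists N => m n Nm Nn.
  have := @nm_trans (p N).1 (p m).1 (p n).1; rewrite (nm_distC (p N).1).
  have := pdist' _ _ Nm; have := pdist' _ _ Nn; have := le_trans (psmall N) (hN N (leqnn _)); lra.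
have [n Fl] := covF l.
have [_ _ _ hn] := pS n; apply: hn Fl.
change (f (p n, n)) with (p n.+1).
apply: le_addeps => e e0; have [N hN] := hl e e0.
have h1 := hN _ (leq_maxl N n.+1); have h2 := pdist' _ _ (leq_maxr N n.+1).
have := @nm_trans (p (maxn N n.+1)).1 (p n.+1).1 l.
rewrite (nm_distC (p n.+1).1 (p _).1); lra.
Qed.

End HilbertSpace.

(** * Bounded linear maps between real Hilbert spaces *)

Section BoundedLinear.
Variables (R : realType) (X Y : hilb R).

Definition blin (L : X -> Y) (C : R) : Prop :=
  [/\ forall x y, L (x + y) = L x + L y, forall a x, L (a *: x) = a *: L x,
      0 <= C & forall x, nm (L x) <= C * nm x].

Variables (L : X -> Y) (C : R).
Hypothesis hL : blin L C.

Lemma blinD x y : L (x + y) = L x + L y. Proof. by case: hL. Qed.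
Lemma blinZ a x : L (a *: x) = a *: L x. Proof. by case: hL. Qed.
Lemma blin_ge0 : 0 <= C. Proof. by case: hL. Qed.
Lemma blin_nm x : nm (L x) <= C * nm x. Proof. by case: hL. Qed.
Lemma blin0 : L 0 = 0. Proof. by rewrite -(scale0r 0) blinZ scale0r. Qed.
Lemma blinN x : L (- x) = - L x. Proof. by rewrite -scaleN1r blinZ scaleN1r. Qed.
Lemma blinB x y : L (x - y) = L x - L y. Proof. by rewrite blinD blinN. Qed.

Lemma adjoint z : exists w, forall x, ip (L x) z = ip w x.
Proof.
apply: (@riesz _ _ _ (C * nm z)) => [x y|a x|x].
- by rewrite blinD ipDl.
- by rewrite blinZ ipZl.
- rewrite mulrAC; apply: le_trans (ip_nm _ _) _.
  by rewrite ler_wpM2r ?nm_ge0// blin_nm.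
Qed.

End BoundedLinear.

Global Opaque nm.

(* Abstracting norms keeps lra from comparing vectors up to conversion. *)
Ltac nm_lra :=
  repeat match goal with |- context [nm ?x] => move: (nm x) => ? end; lra.

(** * Simple functions and finite Borel gluing *)

Section SimpleFunctions.
Variable R : realType.

Lemma simple_function_pair (Y Z : Type) (p : R -> Y) (q : R -> Z) :
  simple_function p -> simple_function q ->
  simple_function (fun s => (p s, q s)).
Proof.
move=> [fp mp] [fq mq]; split.
  apply: sub_finite_set (finite_setX fp fq) => _ [s _ <-].
  by split; exists s.
move=> [y z]; rewrite (_ : _ @^-1` _ = p @^-1` [set y] `&` q @^-1` [set z]).
  exact: measurableI.
by apply/seteqP; split=> s /= [-> ->].
Qed.

Lemma simple_function_comp (Y Z : Type) (p : R -> Y) (k : Y -> Z) :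
  simple_function p -> simple_function (k \o p).
Proof.
move=> [fp mp]; split.
  by apply: sub_finite_set (finite_image k fp) => _ [s _ <-]; exists (p s) => //; exists s.
move=> z; rewrite (_ : _ @^-1` _ =
    \bigcup_(y in range p `&` k @^-1` [set z]) p @^-1` [set y]).
  by apply: fin_bigcup_measurable => //; exact: finite_setIl.
apply/seteqP; split=> s /=; first by move=> <-; exists (p s) => //; split=> //; exists s.
by move=> [y [_ /= <-] /= <-].
Qed.

Lemma simple_function_shift (Y : Type) (p : R -> Y) h :
  simple_function p -> simple_function (fun s => p (s + h)).
Proof.
move=> [fp mp]; split.
  by apply: sub_finite_set fp => _ [s _ <-]; exists (s + h).
move=> y; have /(_ measurableT _ (mp y)) : measurable_fun [set: measurableTypeR R] (fun s : R => s + h).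
  by apply: measurable_funD => //; exact: measurable_cst.
by rewrite setTI.
Qed.

Lemma simple_function_cst (Y : Type) (y : Y) : simple_function (fun _ : R => y).
Proof.
split; first by apply: sub_finite_set (finite_set1 y) => _ [s _ <-].
by move=> z; have := @measurable_cst _ _ (measurableTypeR R) (measurableTypeR R) setT 0;
  rewrite preimage_cst; case: ifP.
Qed.

Lemma simple_function_measurable (p : R -> bool) :
  measurable [set s | p s] -> simple_function p.
Proof.
move=> mp; split.
  by apply: sub_finite_set (finite_set2 true false) => b _; case: b; [left|right].
case; first by rewrite (_ : _ @^-1` _ = [set s | p s])//.
rewrite (_ : _ @^-1` _ = ~` [set s | p s]); first exact: measurableC.
apply/seteqP; split => s /=; first by move=> ->.
by case: (p s).
Qed.

(** Only finitely many [G y] occur, each on a Borel set. This is what turns norms of [pw] functions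
    into members of [bm]. *)
Lemma simple_glue (Y : Type) (p : R -> Y) (G : Y -> R -> R) :
  simple_function p -> (forall y, bm (G y)) -> bm (fun s => G (p s) s).
Proof.
move=> [fp mp] bG; split.
  move=> _ A mA; rewrite setTI (_ : _ @^-1` _ =
      \bigcup_(y in range p) (p @^-1` [set y] `&` G y @^-1` A)).
    apply: fin_bigcup_measurable => // y _; apply: measurableI => //.
    by have [/(_ measurableT _ mA)] := bG y; rewrite setTI.
  apply/seteqP; split=> s /=; first by move=> h; exists (p s) => //; exists s.
  by move=> [y _ [/= <-]].
move=> a b.
have /choice[C hC] : forall y, exists C, forall s, a <= s <= b -> `|G y s| <= C.
  by move=> y; have [_] := bG y; exact.
have /finite_seqP[l lE] : finite_set (C @` range p) by exact: finite_image.
exists (\sum_(c <- l) `|c|) => s sab.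
have : C (p s) \in l.
  have : (C @` range p) (C (p s)) by exists (p s) => //; exists s.
  by rewrite lE.
move=> /(big_rem _) ->/=; apply: le_trans (hC _ _ sab) _.
by rewrite (le_trans (ler_norm _))// lerDl sumr_ge0.
Qed.

End SimpleFunctions.

Section Ri.
Variable R : realType.

Lemma ri_cauchy_schwarz (a b : R) (f : R -> R) : bm f -> a <= b ->
  ri a b f ^+ 2 <= (b - a) * ri a b (fun s => f s ^+ 2).
Proof.
move=> bf; rewrite le_eqVlt => /orP[/eqP ->|ab].
  by rewrite ri_nil// expr0n subrr mul0r.
have ab0 : 0 < b - a by rewrite subr_gt0.
pose c := ri a b f / (b - a).
have : 0 <= ri a b (fun s => (f s ^+ 2 - (2 * c) * f s) + c ^+ 2).
  by apply: ri_ge0 => s _ _; have := sqr_ge0 (f s - c); lra.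
have b2 := bmX 2 bf; have b1 := bmZ (2 * c) bf.
rewrite riD; [|exact: bmB|exact: bm_cst].
rewrite riB// riZ// ri_cst ?(ltW ab)//.
have cE : ri a b f = c * (b - a) by rewrite /c divfK ?gt_eqF.
rewrite cE; move: (ri a b _) => q; clearbody c.
rewrite -(pmulr_rge0 _ ab0); nra.
Qed.

End Ri.

(** * Controls and vector-valued integrals *)

Section PiecewiseContinuous.
Variable R : realType.

Definition econt (X : hilb R) (g : R -> X) : Prop :=
  forall t e, 0 < e -> exists2 d, 0 < d &
    forall s, `|s - t| <= d -> nm (g s - g t) <= e.

(* Borel measurable selections from finitely many continuous functions: a class
   of X-valued functions closed under all operations needed on controls. *)
Definition pw (X : hilb R) (f : R -> X) : Prop :=
  exists (Y : Type) (p : R -> Y) (g : Y -> R -> X),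
    [/\ simple_function p, forall y, econt (g y) & forall s, f s = g (p s) s].

Lemma econt_cst (X : hilb R) (x : X) : econt (fun=> x).
Proof. by move=> t e e0; exists 1 => // s _; rewrite subrr nm0 ltW. Qed.

Lemma econtD (X : hilb R) (f g : R -> X) :
  econt f -> econt g -> econt (fun s => f s + g s).
Proof.
move=> cf cg t e e0; have e2 : 0 < e / 2 by lra.
have [d d0 hd] := cf t _ e2; have [d' d'0 hd'] := cg t _ e2.
exists (Num.min d d') => [|s]; first by rewrite lt_min d0.
rewrite le_min => /andP[/hd h /hd' h'].
by rewrite opprD addrACA; apply: le_trans (nmD _ _) _; lra.
Qed.

Lemma econt_shift (X : hilb R) (f : R -> X) h :
  econt f -> econt (fun s => f (s + h)).
Proof.
move=> cf t e e0; have [d d0 hd] := cf (t + h) e e0.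
by exists d => // s sd; apply: hd; rewrite opprD addrACA subrr addr0.
Qed.

Lemma econt_blin (X Y : hilb R) (f : R -> X) (L : X -> Y) C :
  blin L C -> econt f -> econt (fun s => L (f s)).
Proof.
move=> hL cf t e e0; have C0 := blin_ge0 hL.
have [|d d0 hd] := cf t (e / (C + 1)); first by rewrite divr_gt0//; lra.
exists d => // s /hd h; rewrite -(blinB hL); apply: le_trans (blin_nm hL _) _.
apply: le_trans (ler_wpM2l C0 h) _.
by rewrite mulrCA ler_piMr ?(ltW e0)// ler_pdivrMr; lra.
Qed.

Lemma continuous_eps (f : R -> R) :
  (forall t e, 0 < e -> exists2 d, 0 < d &
    forall s, `|s - t| <= d -> `|f s - f t| <= e) -> continuous f.
Proof.
move=> cf t; apply/cvgrPdist_le => e e0; have [d d0 hd] := cf t e e0.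
have := nbhsx_ballx t d d0; apply: filterS => s; rewrite /ball/= => h.
by rewrite distrC; apply: hd; rewrite distrC ltW.
Qed.

Lemma econt_nm_continuous (X : hilb R) (f : R -> X) :
  econt f -> continuous (fun s => nm (f s)).
Proof.
move=> cf; apply: continuous_eps => t e e0; have [d d0 hd] := cf t e e0.
by exists d => // s /hd; apply: le_trans; exact: nm_dist.
Qed.

(** Meant for a semigroup applied to a moving vector: strong continuity in [s] and a Lipschitz bound
    in the vector, uniform for [s] near [t], together give joint continuity. *)
Lemma econt_action (X Y : hilb R) (T : R -> X -> Y) (f : R -> X) :
  (forall x, econt (fun s => T s x)) ->
  (forall t, exists2 C, 0 <= C & forall s, `|s - t| <= 1 ->
     forall x y, nm (T s x - T s y) <= C * nm (x - y)) ->
  econt f -> econt (fun s => T s (f s)).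
Proof.
move=> cT bT cf t e e0; have [D D0 hD] := bT t.
have [|d d0 hd] := cf t (e / (2 * (D + 1))).
  by rewrite divr_gt0// mulr_gt0//; lra.
have [|d' d'0 hd'] := cT (f t) t (e / 2); first by lra.
exists (Num.min 1 (Num.min d d')) => [|s]; first by rewrite !lt_min ltr01 d0.
rewrite !le_min => /and3P[/hD h1 /hd h2 /hd' h3].
apply: le_trans (@nm_trans _ _ (T s (f t)) _ _) _.
have := h1 (f s) (f t); have := ler_wpM2l D0 h2.
have : D * (e / (2 * (D + 1))) <= e / 2.
  rewrite (_ : _ * _ = e / 2 * (D / (D + 1))); last by field; lra.
  by rewrite ler_piMr ?divr_ge0 ?(ltW e0)// ler_pdivrMr; lra.
lra.
Qed.

Section Closure.
Variables X Y Z : hilb R.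
Implicit Types (f g : R -> X).

Lemma pw_econt f : econt f -> pw f.
Proof.
move=> cf; exists unit, (fun=> tt), (fun=> f); split=> //.
exact: simple_function_cst.
Qed.

Lemma pw_cst (x : X) : pw (fun=> x).
Proof. exact/pw_econt/econt_cst. Qed.

Lemma pw_map (T : R -> X -> Y) f :
  (forall g, econt g -> econt (fun s => T s (g s))) ->
  pw f -> pw (fun s => T s (f s)).
Proof.
move=> cT [A [p [g [sp cg fE]]]].
exists A, p, (fun a s => T s (g a s)); split=> // [a|s]; first exact: cT.
by rewrite fE.
Qed.

Lemma pwD f g : pw f -> pw g -> pw (fun s => f s + g s).
Proof.
move=> [A [p [f' [sp cf fE]]]] [B [q [g' [sq cg gE]]]].
exists (A * B)%type, (fun s => (p s, q s)), (fun ab s => f' ab.1 s + g' ab.2 s).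
split=> [|ab|s]; [exact: simple_function_pair|exact: econtD|].
by rewrite fE gE.
Qed.

Lemma pw_shift h f : pw f -> pw (fun s => f (s + h)).
Proof.
move=> [A [p [g [sp cg fE]]]].
exists A, (fun s => p (s + h)), (fun a s => g a (s + h)); split=> // [|a].
  exact: simple_function_shift.
exact: econt_shift.
Qed.

Lemma pw_cat h f g : pw f -> pw g -> pw (fun s => if s <= h then f s else g s).
Proof.
move=> [A [p [f' [sp cf fE]]]] [B [q [g' [sq cg gE]]]].
exists (bool * (A * B))%type, (fun s => (s <= h, (p s, q s))),
  (fun c s => if c.1 then f' c.2.1 s else g' c.2.2 s).
split=> [|[[] ab] /=|s /=]; [|exact: cf|exact: cg|by rewrite fE gE].
apply: simple_function_pair; last exact: simple_function_pair.
apply: simple_function_measurable.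
rewrite (_ : [set s | _] = `]-oo, h]%classic) //.
Qed.

Lemma pw_bm_nm f : pw f -> bm (fun s => nm (f s)).
Proof.
move=> [A [p [g [sp cg fE]]]].
under eq_fun do rewrite fE.
apply: (@simple_glue _ _ p (fun a s => nm (g a s))) => // a.
exact/bm_continuous/econt_nm_continuous.
Qed.

End Closure.

Lemma pw_blin (X Y : hilb R) (L : X -> Y) C (f : R -> X) :
  blin L C -> pw f -> pw (fun s => L (f s)).
Proof.
by move=> hL; apply: (@pw_map _ _ (fun=> L)) => g; exact: (econt_blin hL).
Qed.

Lemma blinZr (X : hilb R) a : blin (fun x : X => a *: x) `|a|.
Proof.
split=> // [x y|b x|x]; first exact: scalerDr.
- by rewrite !scalerA mulrC.
- by rewrite nmZ.
Qed.

Lemma pwZ (X : hilb R) a (f : R -> X) : pw f -> pw (fun s => a *: f s).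
Proof. exact/pw_blin/blinZr. Qed.

Lemma pwN (X : hilb R) (f : R -> X) : pw f -> pw (fun s => - f s).
Proof. by move=> pf; under eq_fun do rewrite -scaleN1r; exact: pwZ. Qed.

Lemma pwB (X : hilb R) (f g : R -> X) : pw f -> pw g -> pw (fun s => f s - g s).
Proof. by move=> pf pg; apply: pwD => //; exact: pwN. Qed.

Lemma pw_bm_ip (X : hilb R) (f g : R -> X) : pw f -> pw g ->
  bm (fun s => ip (f s) (g s)).
Proof.
move=> pf pg.
have -> : (fun s => ip (f s) (g s)) = (fun s =>
    4^-1 * (nm (f s + g s) ^+ 2 - nm (f s - g s) ^+ 2)).
  by apply/funext => s; rewrite !nm_sq !ipE (ipC (g s)); field.
by apply/bmZ/bmB; apply/bmX/pw_bm_nm; [exact: pwD|exact: pwB].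
Qed.

End PiecewiseContinuous.

Section VectorIntegral.
Variables (R : realType) (X : hilb R).
Implicit Types (f g : R -> X) (a b : R) (z : X).

(** The weak (Pettis) integral. For [pw] functions the representing vector exists by [riesz], as
    [pintE] shows, so the default [0] is not reached for them. *)
Definition pint a b f : X :=
  xget 0 [set w | forall z, ip w z = ri a b (fun s => ip (f s) z)].

Lemma pintE a b f z : pw f -> ip (pint a b f) z = ri a b (fun s => ip (f s) z).
Proof.
move=> pf; have bz w := pw_bm_ip pf (pw_cst w).
rewrite /pint; case: xgetP => [w _ /(_ z)//|/=].
suff [w hw] : exists w, forall z, ri a b (fun s => ip (f s) z) = ip w z.
  by move=> /(_ w)[] y; rewrite hw.
apply: (@riesz _ _ _ (ri a b (fun s => nm (f s)))) => [x y|c x|x].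
- by rewrite -riD//; apply: ri_ext => s _ _; rewrite ipDr.
- by rewrite -riZ//; apply: ri_ext => s _ _; rewrite ipZr.
- apply: le_trans (ri_norm _ _ (bz x)) _.
  rewrite mulrC -riZ; last exact: pw_bm_nm.
  apply: ri_le => [||s _ _]; [exact: bm_norm|exact/bmZ/pw_bm_nm|].
  by rewrite mulrC ip_nm.
Qed.

Lemma pint_ext a b f g : (forall s, a < s -> s <= b -> f s = g s) ->
  pint a b f = pint a b g.
Proof.
move=> fg; rewrite /pint; congr (xget 0 _); apply/seteqP; split=> w /= h z;
by rewrite h; apply: ri_ext => s s1 s2; rewrite fg.
Qed.

Lemma pint_nm a b f : pw f -> nm (pint a b f) <= ri a b (fun s => nm (f s)).
Proof.
move=> pf; apply: nm_test => [|z].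
  by apply: ri_ge0 => s _ _; exact: nm_ge0.
rewrite pintE// mulrC -riZ; last exact: pw_bm_nm.
apply: ri_le => [||s _ _]; [exact: (pw_bm_ip pf (pw_cst z))|exact/bmZ/pw_bm_nm|].
by rewrite mulrC ip_le.
Qed.

Lemma pintD a b f g : pw f -> pw g ->
  pint a b (fun s => f s + g s) = pint a b f + pint a b g.
Proof.
move=> pf pg; apply: ip_inj => z; rewrite ipDl !pintE//; last exact: pwD.
rewrite -riD; [|exact: (pw_bm_ip pf (pw_cst z))|exact: (pw_bm_ip pg (pw_cst z))].
by apply: ri_ext => s _ _; rewrite ipDl.
Qed.

Lemma pint_split a b c f : pw f -> a <= b -> b <= c ->
  pint a c f = pint a b f + pint b c f.
Proof.
move=> pf ab bc; apply: ip_inj => z; rewrite ipDl !pintE// -ri_split//.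
exact: (pw_bm_ip pf (pw_cst z)).
Qed.

Lemma pint_shift a b h f : pw f ->
  pint (a + h) (b + h) f = pint a b (fun s => f (s + h)).
Proof.
move=> pf; apply: ip_inj => z; rewrite !pintE//; last exact: pw_shift.
by rewrite ri_shift//; exact: (pw_bm_ip pf (pw_cst z)).
Qed.

Lemma pint_nil a b f : pw f -> b <= a -> pint a b f = 0.
Proof. by move=> pf ba; apply: ip_inj => z; rewrite pintE// ri_nil// ip0l. Qed.

Lemma pint_cst a b z : a <= b -> pint a b (fun=> z) = (b - a) *: z.
Proof.
move=> ab; apply: ip_inj => w; rewrite pintE; last exact: pw_cst.
by rewrite ri_cst// ipZl mulrC.
Qed.

End VectorIntegral.

Lemma pint_blin (R : realType) (X Y : hilb R) (L : X -> Y) C a b (f : R -> X) :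
  blin L C -> pw f -> pint a b (fun s => L (f s)) = L (pint a b f).
Proof.
move=> hL pf; apply: ip_inj => z; rewrite pintE; last exact: pw_blin hL pf.
have [w hw] := adjoint hL z; rewrite hw ipC pintE//.
by apply: ri_ext => s _ _; rewrite hw ipC.
Qed.

Lemma pintZ (R : realType) (X : hilb R) a b c (f : R -> X) : pw f ->
  pint a b (fun s => c *: f s) = c *: pint a b f.
Proof. exact: (pint_blin _ _ (blinZr X c)). Qed.

Lemma pintB (R : realType) (X : hilb R) a b (f g : R -> X) : pw f -> pw g ->
  pint a b (fun s => f s - g s) = pint a b f - pint a b g.
Proof.
move=> pf pg; rewrite pintD//; last exact: pwN.
congr (_ + _); rewrite -scaleN1r -pintZ//; apply: pint_ext => s _ _.
by rewrite scaleN1r.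
Qed.

Global Opaque pint.

(** * Semigroups *)

Section Semigroup.
Variables (R : realType) (X : hilb R).

(** Fixing the identity at negative times gives [S (t - s)] a meaning for every [s] and makes
    [t |-> S t x] continuous on the whole line. *)
Record semigroup (S : R -> X -> X) : Prop := Semigroup {
  sg_blin : forall t, exists C, blin (S t) C;
  sg_neg : forall t x, t <= 0 -> S t x = x;
  sg_add : forall s t x, 0 <= s -> 0 <= t -> S (s + t) x = S s (S t x);
  sg_cont : forall x e, 0 < e -> exists2 d, 0 < d &
    forall h, 0 <= h <= d -> nm (S h x - x) <= e }.

Variable S : R -> X -> X.
Hypothesis hS : semigroup S.

(** Uniform boundedness by Baire. One index [n] governs both the bound [n] and the length
    [n.+1%:R^-1] of the time interval, so that strong continuity at zero alone shows that the sets
    [F n] cover; they are closed because each [S t] is bounded. *)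
Lemma sg_local_bound : exists d M, [/\ 0 < d, 1 <= M &
  forall t x, t <= d -> nm (S t x) <= M * nm x].
Proof.
pose F (n : nat) x := forall t, 0 <= t <= n.+1%:R^-1 -> nm (S t x) <= n%:R.
have clF n x : (forall e, 0 < e -> exists2 y, F n y & nm (x - y) <= e) -> F n x.
  move=> h t t01; apply: le_addeps => e e0; have [C hC] := sg_blin hS t.
  have C0 := blin_ge0 hC.
  have [|y Fy xy] := h (e / (C + 1)); first by rewrite divr_gt0//; lra.
  have := Fy t t01; have := nm_subl (S t x) (S t y); rewrite -(blinB hC).
  have := blin_nm hC (x - y); have := ler_wpM2l C0 xy.
  have : C * (e / (C + 1)) <= e.
    by rewrite mulrCA ler_piMr ?(ltW e0)// ler_pdivrMr; lra.
  lra.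
have covF x : exists n, F n x.
  have [d d0 hd] := sg_cont hS x ltr01.
  have [N hN] := invS_le d0; pose k := Num.truncn (nm x + 1).
  exists (maxn N k.+1) => t /andP[t0 tn].
  have /hd : 0 <= t <= d.
    by rewrite t0 (le_trans tn)//; apply: hN; exact: leq_maxl.
  have : nm x + 1 <= (maxn N k.+1)%:R.
    by rewrite (le_trans (ltW (truncnS_gt _)))// ler_nat leq_maxr.
  by have := nm_subl (S t x) x; lra.
have [n [x0 [d [d0 hd]]]] := baire_ball clF covF.
(* Differences of two points of the ball give the bound [2 * n%:R] on the ball of radius [d] about
   zero. The summand [1] takes care of nonpositive times and of [1 <= M]. *)
exists n.+1%:R^-1, (1 + 2 * n%:R / d); split.
- by rewrite invr_gt0.
- by rewrite lerDl divr_ge0// ?(ltW d0)// mulr_ge0.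
move=> t x tn; have [t0|t0] := leP t 0.
  by rewrite sg_neg// ler_peMl ?nm_ge0// lerDl divr_ge0// ?(ltW d0)// mulr_ge0.
have [C hC] := sg_blin hS t.
have t01 : 0 <= t <= n.+1%:R^-1 by rewrite (ltW t0).
have hsmall z : nm z <= d -> nm (S t z) <= 2 * n%:R.
  move=> zd; have := hd (z + x0); rewrite addrK => /(_ zd t t01) h1.
  have := hd x0; rewrite subrr nm0 => /(_ (ltW d0) t t01) h2.
  by rewrite -(addrK x0 z) (blinB hC); apply: le_trans (nmB _ _) _; lra.
have [->|x0'] := eqVneq x 0.
  by rewrite (blin0 hC) nm0 mulr0.
have nx : 0 < nm x.
  rewrite lt_neqAle nm_ge0 andbT eq_sym; apply: contra_neq x0'; exact: nm_eq0.
have dx : 0 < d / nm x by rewrite divr_gt0.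
have := hsmall ((d / nm x) *: x).
rewrite (blinZ hC) !nmZ (gtr0_norm dx) divfK ?gt_eqF// => /(_ (lexx d)).
rewrite mulrC -ler_pdivlMr// => h; apply: (le_trans h).
rewrite (_ : 2 * n%:R / (d / nm x) = 2 * n%:R / d * nm x); last first.
  by field; rewrite !gt_eqF.
by rewrite ler_wpM2r ?nm_ge0// lerDr.
Qed.

Lemma sg_bounded T : exists2 M, 1 <= M & forall t, t <= T -> blin (S t) M.
Proof.
have [d [M [d0 M1 hM]]] := sg_local_bound.
have M0 : 0 <= M by lra.
have key n : forall t x, t <= n%:R * d -> nm (S t x) <= M ^+ n.+1 * nm x.
  elim: n => [|n ih] t x.
    by rewrite mul0r expr1 => t0; apply: hM; lra.
  rewrite -natr1 mulrDl mul1r => tn.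
  have [td|td] := leP t d.
    apply: le_trans (hM _ _ td) _; rewrite ler_wpM2r ?nm_ge0// exprS.
    by rewrite ler_peMr// exprn_ege1.
  rewrite -(subrK d t) sg_add//; [|lra..].
  apply: le_trans (ih _ _ _) _; first lra.
  by rewrite [M ^+ n.+2]exprSr -mulrA ler_wpM2l ?exprn_ge0// hM.
exists (M ^+ (Num.truncn (T / d)).+2); first by rewrite exprn_ege1.
move=> t tT; have [C hC] := sg_blin hS t; have [hD hZ _ _] := hC.
split=> // [|x]; first by rewrite exprn_ge0.
apply: key; apply: (le_trans tT); rewrite -ler_pdivrMr//.
exact/ltW/truncnS_gt.
Qed.

Lemma sgB t x y : S t (x - y) = S t x - S t y.
Proof. by have [C /blinB] := sg_blin hS t. Qed.

Lemma sgD t x y : S t (x + y) = S t x + S t y.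
Proof. by have [C /blinD] := sg_blin hS t. Qed.

Lemma sgZ t a x : S t (a *: x) = a *: S t x.
Proof. by have [C /blinZ] := sg_blin hS t. Qed.

Lemma sg_econt x : econt (fun t => S t x).
Proof.
move=> t e e0; have [M M1 hM] := sg_bounded (t + 1).
have M0 : 0 < M by lra.
have [|d d0 hd] := sg_cont hS x (e := e / M); first by rewrite divr_gt0.
have key a b : a <= b -> b <= t + 1 -> b - a <= d -> nm (S b x - S a x) <= e.
  move=> ab bt abd; have [b0|b0] := leP b 0.
    by rewrite !sg_neg// ?subrr ?nm0 ?(ltW e0)// (le_trans ab).
  have [a0|a0] := leP a 0.
    rewrite (sg_neg hS x a0).
    have [bd|bd] := leP b d.
      have := hd b; rewrite (ltW b0) bd => /(_ isT) h; apply: (le_trans h).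
      by rewrite ler_piMr ?(ltW e0)// invf_le1.
    by lra.
  have -> : S b x = S a (S (b - a) x).
    by rewrite -sg_add ?subr_ge0 ?(ltW a0)// addrC subrK.
  rewrite -sgB; apply: le_trans (blin_nm (hM _ _) _) _; first lra.
  by rewrite -ler_pdivlMl// mulrC; apply: hd; lra.
exists (Num.min d 1) => [|s]; first by rewrite lt_min d0 ltr01.
rewrite le_min !ler_norml => /andP[/andP[h1 h2] /andP[h3 h4]].
have [st|ts] := leP s t; last by apply: key; lra.
by rewrite nm_distC; apply: key; lra.
Qed.

End Semigroup.

(** * Trajectories *)

Section Trajectories.
Variables (R : realType) (X U : hilb R) (S : R -> X -> X) (B : U -> X) (b : R).
Hypotheses (hS : semigroup S) (hB : blin B b).
Implicit Types (x y : X) (u v : R -> U) (t s h : R).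

Definition conv t u : X := pint 0 t (fun s => S (t - s) (B (u s))).

Definition traj t x u : X := S t x + conv t u.

Lemma trajE t x u : traj t x u = S t x + conv t u.
Proof. by []. Qed.

Lemma convE t u : conv t u = pint 0 t (fun s => S (t - s) (B (u s))).
Proof. by []. Qed.

Lemma econt_conv t (g : R -> U) : econt g -> econt (fun s => S (t - s) (B (g s))).
Proof.
move=> cg; apply: (@econt_action R X X (fun s => S (t - s)) (fun s => B (g s))).
- move=> x r e e0; have [d d0 hd] := sg_econt hS x (t - r) e0.
  exists d => // s sd; apply: hd.
  by rewrite (_ : t - s - (t - r) = r - s) 1?distrC//; ring.
- move=> r; have [M M1 hM] := sg_bounded hS (t - r + 1).
  exists M => [|s]; first by lra.
  rewrite ler_norml => /andP[h1 h2] x y; rewrite -(sgB hS).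
  by apply: (blin_nm (hM _ _)); lra.
- exact: (econt_blin hB).
Qed.

Lemma pw_conv t u : pw u -> pw (fun s => S (t - s) (B (u s))).
Proof.
by apply: (pw_map (T := fun s w => S (t - s) (B w))) => g; exact: econt_conv.
Qed.

Lemma convD t u v : pw u -> pw v ->
  conv t (fun s => u s + v s) = conv t u + conv t v.
Proof.
move=> pu pv; rewrite /conv -pintD; try exact: pw_conv.
by apply: pint_ext => s _ _; rewrite (blinD hB) (sgD hS).
Qed.

Lemma convZ t a u : pw u -> conv t (fun s => a *: u s) = a *: conv t u.
Proof.
move=> pu; rewrite /conv -pintZ; last exact: pw_conv.
by apply: pint_ext => s _ _; rewrite (blinZ hB) (sgZ hS).
Qed.

Lemma trajD t x y u v : pw u -> pw v ->
  traj t (x + y) (fun s => u s + v s) = traj t x u + traj t y v.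
Proof. by move=> pu pv; rewrite /traj convD// (sgD hS) addrACA. Qed.

Lemma trajZ t a x u : pw u ->
  traj t (a *: x) (fun s => a *: u s) = a *: traj t x u.
Proof. by move=> pu; rewrite /traj convZ// (sgZ hS) scalerDr. Qed.

Lemma trajB t x y u v : pw u -> pw v ->
  traj t (x - y) (fun s => u s - v s) = traj t x u - traj t y v.
Proof.
move=> pu pv; rewrite -(scaleN1r y) -(scaleN1r (traj t y v)) -trajZ// -trajD//.
  by congr (traj _ _ _); apply/funext => s; rewrite scaleN1r.
exact: pwZ.
Qed.

Lemma conv_ext t u v : (forall s, 0 < s -> s <= t -> u s = v s) ->
  conv t u = conv t v.
Proof. by move=> uv; apply: pint_ext => s s0 st; rewrite uv. Qed.

Lemma traj_ext t x u v : (forall s, 0 < s -> s <= t -> u s = v s) ->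
  traj t x u = traj t x v.
Proof. by move=> uv; rewrite /traj (conv_ext uv). Qed.

Lemma conv_cst0 t : conv t (fun=> 0) = 0.
Proof.
rewrite /conv (_ : (fun s => _) = fun=> 0); last first.
  by apply/funext => s; rewrite (blin0 hB); have [C /blin0] := sg_blin hS (t - s).
have [t0|t0] := leP 0 t; first by rewrite pint_cst// scaler0.
by rewrite pint_nil ?(ltW t0)//; exact: pw_cst.
Qed.

Lemma traj_cst0 t x : traj t x (fun=> 0) = S t x.
Proof. by rewrite /traj conv_cst0 addr0. Qed.

Lemma conv_neg t u : pw u -> t <= 0 -> conv t u = 0.
Proof. by move=> pu t0; rewrite /conv pint_nil//; exact: pw_conv. Qed.

Lemma traj_neg t x u : pw u -> t <= 0 -> traj t x u = x.
Proof. by move=> pu t0; rewrite /traj conv_neg// addr0 (sg_neg hS). Qed.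

Lemma traj_flow t h x u : pw u -> 0 <= t -> 0 <= h ->
  traj (t + h) x u = traj t (traj h x u) (fun s => u (s + h)).
Proof.
move=> pu t0 h0; rewrite /traj (sgD hS) -(sg_add hS)// -addrA; congr (_ + _).
have [C hC] := sg_blin hS t.
rewrite /conv (pint_split (pw_conv _ pu) h0) ?lerDr//; congr (_ + _).
  rewrite -(pint_blin _ _ hC); last exact: pw_conv.
  apply: pint_ext => s s0 sh.
  by rewrite -(sg_add hS) ?subr_ge0// addrA.
rewrite -{1}(add0r h) pint_shift; last exact: pw_conv.
by apply: pint_ext => s _ _; rewrite opprD addrACA subrr addr0.
Qed.

Lemma conv_bound T : exists2 C, 0 <= C & forall t u, pw u -> t <= T ->
  nm (conv t u) <= C * ri 0 t (fun s => nm (u s)).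
Proof.
have [M M1 hM] := sg_bounded hS T.
have b0 := blin_ge0 hB.
exists (M * b) => [|t u pu tT]; first by rewrite mulr_ge0//; lra.
apply: le_trans (pint_nm _ _ (pw_conv _ pu)) _.
have bu := pw_bm_nm pu.
rewrite -riZ//; apply: ri_le => [||s s0 st]; [exact/pw_bm_nm/pw_conv|exact: bmZ|].
apply: le_trans (blin_nm (hM _ _) _) _; first by lra.
by rewrite -mulrA ler_wpM2l ?(blin_nm hB)//; lra.
Qed.

Lemma conv_bound2 T : 0 <= T -> exists2 C, 0 <= C & forall t u, pw u -> 0 <= t <= T ->
  nm (conv t u) ^+ 2 <= C * t * ri 0 t (fun s => nm (u s) ^+ 2).
Proof.
move=> T0; have [C C0 hC] := conv_bound T; exists (C ^+ 2) => [|t u pu /andP[t0 tT]].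
  exact: sqr_ge0.
have bu := pw_bm_nm pu.
have := ri_cauchy_schwarz bu t0; rewrite subr0 => h.
rewrite -mulrA; apply: le_trans (ler_wpM2l (sqr_ge0 C) h).
rewrite -exprMn ler_sqr ?nnegrE ?nm_ge0 ?mulr_ge0//; first exact: hC.
by apply: ri_ge0 => s _ _; exact: nm_ge0.
Qed.

Lemma pw_bounded u a c : pw u ->
  exists2 C, 0 <= C & forall s, a <= s <= c -> nm (u s) <= C.
Proof.
move=> /pw_bm_nm[_ /(_ a c)[C hC]]; exists `|C| => // s /hC h.
by apply: le_trans (ler_norm _) (le_trans h (ler_norm _)).
Qed.

Lemma traj_bounded T x u : pw u ->
  exists2 C, 0 <= C & forall t, t <= T -> nm (traj t x u) <= C.
Proof.
move=> pu; have [M M1 hM] := sg_bounded hS T.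
have [C C0 hC] := conv_bound T; have bu := pw_bm_nm pu.
have I0 : 0 <= ri 0 T (fun s => nm (u s)).
  by apply: ri_ge0 => s _ _; exact: nm_ge0.
exists (M * nm x + C * ri 0 T (fun s => nm (u s))) => [|t tT].
  by rewrite addr_ge0 ?mulr_ge0 ?nm_ge0//; lra.
apply: le_trans (nmD _ _) _; apply: lerD; first exact: blin_nm (hM _ tT) _.
apply: le_trans (hC _ _ pu tT) _; rewrite ler_wpM2l//.
have [t0|t0] := leP 0 t; last by rewrite ri_nil// ltW.
rewrite (ri_split bu t0 tT) lerDl.
by apply: ri_ge0 => s _ _; exact: nm_ge0.
Qed.

(** By the flow property the increment is a semigroup increment at the fixed vector [traj t x u]
    plus a convolution over an interval of length [h], on which the control is bounded. *)
Lemma traj_right_continuous x u t e : pw u -> 0 < e -> exists2 d, 0 < d &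
  forall h, 0 <= h <= d -> nm (traj (t + h) x u - traj t x u) <= e.
Proof.
move=> pu e0; have [t0|t0] := ltP t 0.
  exists (- t) => [|h h01]; first by lra.
  by rewrite !traj_neg ?subrr ?nm0 ?(ltW e0)//; lra.
have [C C0 hC] := conv_bound 1.
have put := pw_shift t pu.
have [D D0 hD] := pw_bounded 0 1 put.
have [|d d0 hd] := sg_cont hS (traj t x u) (e := e / 2); first by lra.
have CD : 0 < C * D + 1 by rewrite ltr_wpDl// mulr_ge0.
exists (Num.min d (Num.min 1 (e / (2 * (C * D + 1))))).
  by rewrite !lt_min d0 ltr01 divr_gt0// mulr_gt0.
move=> h; rewrite !le_min => /andP[h0 /and3P[hd' h1 he]].
rewrite (_ : _ - _ = (S h (traj t x u) - traj t x u) +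
    conv h (fun s => u (s + t))); last by rewrite (addrC t) traj_flow// addrAC.
apply: le_trans (nmD _ _) _.
have := hd h; rewrite h0 hd' => /(_ isT).
have : nm (conv h (fun s => u (s + t))) <= C * (D * h).
  apply: le_trans (hC _ _ put h1) _; rewrite ler_wpM2l//.
  rewrite -[h in D * h]subr0 -ri_cst//.
  apply: ri_le => [||s s0 sh]; [exact: pw_bm_nm|exact: bm_cst|].
  by apply: hD; lra.
have : h * (C * D + 1) <= e / 2.
  have -> : e / 2 = (e / (2 * (C * D + 1))) * (C * D + 1) by field; lra.
  by rewrite ler_wpM2r// ltW.
lra.
Qed.

Lemma bm_traj x u : pw u -> bm (fun t => nm (traj t x u)).
Proof.
move=> pu; split.
  apply: right_continuous_measurable => t e e0.
  have [d d0 hd] := traj_right_continuous x t pu e0; exists d => // h /hd.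
  by apply: le_trans; exact: nm_dist.
move=> a c; have [C C0 hC] := traj_bounded c x pu; exists C => s /andP[_ sc].
by rewrite ger0_norm ?nm_ge0// hC.
Qed.

End Trajectories.

Global Opaque conv traj.

(** * Quadratic costs *)

Section Cost.
Variables (R : realType) (X U : hilb R) (S : R -> X -> X) (B : U -> X) (b : R).
Hypotheses (hS : semigroup S) (hB : blin B b).
Implicit Types (x y : X) (u v : R -> U) (t s h : R).
Notation traj := (traj S B).

Definition energy t u : R := ri 0 t (fun s => nm (u s) ^+ 2).

Definition cost t x u : R :=
  ri 0 t (fun s => nm (traj s x u) ^+ 2 + nm (u s) ^+ 2).

(* The terminal penalty makes finite horizons comparable with one another. *)
Definition pcost k t x u : R := cost t x u + k * nm (traj t x u) ^+ 2.

Definition ctrl_cat h u v : R -> U := fun s => if s <= h then u s else v (s - h).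

Lemma energyE t u : energy t u = ri 0 t (fun s => nm (u s) ^+ 2).
Proof. by []. Qed.

Lemma costE t x u :
  cost t x u = ri 0 t (fun s => nm (traj s x u) ^+ 2 + nm (u s) ^+ 2).
Proof. by []. Qed.

Lemma pcostE k t x u : pcost k t x u = cost t x u + k * nm (traj t x u) ^+ 2.
Proof. by []. Qed.

Lemma bm_cost x u : pw u -> bm (fun s => nm (traj s x u) ^+ 2 + nm (u s) ^+ 2).
Proof.
by move=> pu; apply: bmD; apply: bmX; [exact: (bm_traj hS hB)|exact: pw_bm_nm].
Qed.

Lemma cost_ge0 t x u : 0 <= cost t x u.
Proof. by apply: ri_ge0 => s _ _; rewrite addr_ge0 ?sqr_ge0. Qed.

Lemma energy_ge0 t u : 0 <= energy t u.
Proof. by apply: ri_ge0 => s _ _; rewrite sqr_ge0. Qed.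

Lemma pcost_ge0 k t x u : 0 <= k -> 0 <= pcost k t x u.
Proof. by move=> k0; rewrite addr_ge0 ?cost_ge0// mulr_ge0// sqr_ge0. Qed.

Lemma energy_mono s t u : pw u -> 0 <= s -> s <= t -> energy s u <= energy t u.
Proof.
move=> pu s0 st; rewrite /energy [leRHS](ri_split _ s0 st)//; last exact/bmX/pw_bm_nm.
by rewrite lerDl; apply: ri_ge0 => r _ _; exact: sqr_ge0.
Qed.

Lemma energy_cost t x u : pw u -> energy t u <= cost t x u.
Proof.
move=> pu; apply: ri_le => [||s _ _]; [exact/bmX/pw_bm_nm|exact: bm_cost|].
by rewrite lerDr sqr_ge0.
Qed.

Lemma cost_flow t h x u : pw u -> 0 <= t -> 0 <= h ->
  cost (t + h) x u = cost h x u + cost t (traj h x u) (fun s => u (s + h)).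
Proof.
move=> pu t0 h0; have bc := bm_cost x pu.
rewrite /cost (ri_split bc h0) ?lerDr//; congr (_ + _).
have := ri_shift 0 t h bc; rewrite add0r => ->; apply: ri_ext => s s0 st.
by rewrite (traj_flow hS hB)// ltW.
Qed.

Lemma cost_ext t x u v : (forall s, 0 < s -> s <= t -> u s = v s) ->
  cost t x u = cost t x v.
Proof.
move=> uv; apply: ri_ext => s s0 st.
have -> : traj s x u = traj s x v.
  by apply: traj_ext => r r0 rs; apply: uv => //; exact: le_trans rs st.
by rewrite uv.
Qed.

Lemma pw_ctrl_cat h u v : pw u -> pw v -> pw (ctrl_cat h u v).
Proof. by move=> pu pv; apply: pw_cat => //; exact: (pw_shift (- h)). Qed.

Lemma traj_cat h x u v : traj h x (ctrl_cat h u v) = traj h x u.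
Proof. by apply: traj_ext => s _ sh; rewrite /ctrl_cat sh. Qed.

Lemma ctrl_cat_shift h u v s : 0 < s -> ctrl_cat h u v (s + h) = v s.
Proof.
by move=> s0; rewrite /ctrl_cat gerDr leNgt s0 /= addrK.
Qed.

Lemma traj_cat_shift t h x u v : pw u -> pw v -> 0 <= t -> 0 <= h ->
  traj (t + h) x (ctrl_cat h u v) = traj t (traj h x u) v.
Proof.
move=> pu pv t0 h0; rewrite (traj_flow hS hB)//; last exact: pw_ctrl_cat.
rewrite traj_cat; apply: traj_ext => s s0 _; exact: ctrl_cat_shift.
Qed.

Lemma pcost_cat k t h x u v : pw u -> pw v -> 0 <= t -> 0 <= h ->
  pcost k (t + h) x (ctrl_cat h u v) =
  cost h x u + pcost k t (traj h x u) v.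
Proof.
move=> pu pv t0 h0; rewrite /pcost traj_cat_shift// cost_flow//; last exact: pw_ctrl_cat.
rewrite traj_cat addrA.
have -> : cost h x (ctrl_cat h u v) = cost h x u.
  by apply: cost_ext => s _ sh; rewrite /ctrl_cat sh.
by congr (_ + _ + _); apply: cost_ext => s s0 _; exact: ctrl_cat_shift.
Qed.

Lemma pcost_flow k t h x u : pw u -> 0 <= t -> 0 <= h ->
  pcost k (t + h) x u =
  cost h x u + pcost k t (traj h x u) (fun s => u (s + h)).
Proof.
by move=> pu t0 h0; rewrite /pcost cost_flow// (traj_flow hS hB)// addrA.
Qed.

Lemma pcost_par k t x y u v : pw u -> pw v ->
  pcost k t (x + y) (fun s => u s + v s) + pcost k t (x - y) (fun s => u s - v s) =
  2 * pcost k t x u + 2 * pcost k t y v.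
Proof.
move=> pu pv; have puv := pwD pu pv; have puv' := pwB pu pv.
rewrite /pcost (trajD hS hB)// (trajB hS hB)//.
have := congr1 ( *%R k) (nm_par (traj t x u) (traj t y v)).
suff : cost t (x + y) (fun s => u s + v s) + cost t (x - y) (fun s => u s - v s) =
  2 * cost t x u + 2 * cost t y v by lra.
have bx := bm_cost x pu; have by_ := bm_cost y pv.
rewrite /cost -!riZ// -!riD; [|exact: bmZ|exact: bmZ|exact: bm_cost|exact: bm_cost].
apply: ri_ext => s _ _ /=; rewrite (trajD hS hB)// (trajB hS hB)//.
have := nm_par (traj s x u) (traj s y v); have := nm_par (u s) (v s); lra.
Qed.

Lemma pcostZ k t a x u : pw u ->
  pcost k t (a *: x) (fun s => a *: u s) = a ^+ 2 * pcost k t x u.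
Proof.
move=> pu; rewrite /pcost (trajZ hS hB)// mulrDr nmZ exprMn real_normK ?num_real//.
congr (_ + _); last by ring.
rewrite /cost -riZ; last exact: bm_cost.
apply: ri_ext => s _ _; rewrite (trajZ hS hB)// !nmZ !exprMn !real_normK ?num_real//.
by rewrite mulrDr.
Qed.

Lemma traj_energy T : 0 <= T -> exists2 C, 0 <= C & forall s x u, pw u -> s <= T ->
  nm (traj s x u) ^+ 2 <= C * (nm x ^+ 2 + energy s u).
Proof.
move=> T0; have [M M1 hM] := sg_bounded hS T.
have [C C0 hC] := conv_bound2 hS hB T0.
have M2 : 1 <= M ^+ 2 by rewrite exprn_ege1.
have CT : 0 <= C * T by rewrite mulr_ge0.
exists (2 * M ^+ 2 + 2 * C * T) => [|s x u pu sT]; first by lra.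
have e0 := energy_ge0 s u.
have [s0|s0] := leP s 0.
  rewrite (traj_neg hS hB)//.
  have := sqr_ge0 (nm x); nra.
apply: le_trans (sq_nmD _ _) _.
have h1 : nm (S s x) ^+ 2 <= M ^+ 2 * nm x ^+ 2.
  by rewrite -exprMn ler_sqr ?nnegrE ?nm_ge0 ?mulr_ge0 ?nm_ge0 ?(blin_nm (hM _ sT))//; lra.
have h2 := hC s u pu _; rewrite (ltW s0) sT in h2; have {}h2 := h2 isT.
have h3 : C * s * energy s u <= C * T * energy s u.
  by rewrite ler_wpM2r// ler_wpM2l.
have := sqr_ge0 (nm x).
have := mulr_ge0 (sqr_ge0 M) e0; have := mulr_ge0 CT (sqr_ge0 (nm x)).
rewrite /energy in h2 h3 *; nra.
Qed.

(** A homogeneous form of controllability: energy and squared error are relative to [nm x ^+ 2],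
    with [C] independent of [x] and [e]. Reaching zero only approximately is what simple controls
    can achieve. *)
Definition approx_null_controllable : Prop :=
  exists T C, [/\ 0 < T, 0 <= C & forall x e, 0 < e -> exists u,
    [/\ pw u, energy T u <= C * nm x ^+ 2 & nm (traj T x u) ^+ 2 <= e * nm x ^+ 2]].

(** Running cost at most [c * nm x ^+ 2] and a final state with half the squared norm are compatible
    with the penalty once [c + k / 2 <= k]; hence [k = 2 * c + 1]. Horizons between [T] and [2 * T]
    are treated directly. Longer ones follow by induction: the penalty at time [T] pays for the
    continuation. *)
Lemma null_cost : approx_null_controllable -> exists T k, [/\ 0 <= T, 0 < k &
  forall x t, T <= t -> exists2 u, pw u & pcost k t x u <= k * nm x ^+ 2].
Proof.
move=> [T [C [T0 C0 hN]]].
have [D D0 hD] := traj_energy (T := 2 * T) (mulr_ge0 (ler0n _ 2) (ltW T0)).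
have [M M1 hM] := sg_bounded hS T.
(* The state cost over a horizon of at most [2 * T], estimated by [traj_energy], plus the energy
   bound [C]. *)
pose c := 2 * T * (D * (1 + C)) + C.
have c0 : 0 <= c.
  by have := mulr_ge0 D0 C0; have := mulr_ge0 (ltW T0) (mulr_ge0 D0 C0);
    have := mulr_ge0 (ltW T0) D0; rewrite /c; nra.
pose k := 2 * c + 1; have k0 : 0 < k by rewrite /k; lra.
exists T, k; split => //; first exact: ltW.
have base x t : T <= t <= 2 * T -> exists2 u, pw u & pcost k t x u <= k * nm x ^+ 2.
  move=> /andP[Tt tT].
  have M0 : 0 < 2 * M ^+ 2 by rewrite mulr_gt0// exprn_gt0//; lra.
  (* After time [T] the control is zero, and the free evolution multiplies the squared norm by at
     most [M ^+ 2]; this tolerance leaves [nm x ^+ 2 / 2]. *)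
  have [|u [pu hE hT]] := hN x (2 * M ^+ 2)^-1; first by rewrite invr_gt0.
  have p0 := @pw_cst _ _ (0 : U).
  exists (ctrl_cat T u (fun=> 0)); first exact: pw_ctrl_cat.
  set w := ctrl_cat T u (fun=> 0); have pw_ : pw w by exact: pw_ctrl_cat.
  have Ew s : energy s w <= C * nm x ^+ 2.
    have [s0|s0] := leP s 0.
      by rewrite /energy ri_nil// mulr_ge0// sqr_ge0.
    have Ew1 : energy T w = energy T u.
      by apply: ri_ext => r _ rT; rewrite /w /ctrl_cat rT.
    have [sT|sT] := leP s T.
      by apply: le_trans (energy_mono pw_ (ltW s0) sT) _; rewrite Ew1.
    rewrite /energy (ri_split _ (ltW T0) (ltW sT)); last exact/bmX/pw_bm_nm.
    rewrite -/(energy T w) Ew1 (@ri_ext _ T s _ (fun=> 0)) ?ri_cst ?(ltW sT)// ?mul0r ?addr0//.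
    by move=> r Tr _; rewrite /w /ctrl_cat leNgt Tr /= nm0 expr0n.
  have x0 := sqr_ge0 (nm x).
  have tr s : s <= 2 * T -> nm (traj s x w) ^+ 2 <= D * (1 + C) * nm x ^+ 2.
    move=> sT; apply: le_trans (hD _ _ _ pw_ sT) _.
    by rewrite -mulrA ler_wpM2l// mulrDl mul1r lerD2l.
  have h1 : cost t x w <= c * nm x ^+ 2.
    rewrite /cost riD; [|exact/bmX/(bm_traj hS hB)|exact/bmX/pw_bm_nm].
    rewrite /c mulrDl; apply: lerD; last exact: Ew.
    apply: le_trans (ri_le (g := fun=> D * (1 + C) * nm x ^+ 2) _ (bm_cst _) _) _.
    - exact/bmX/(bm_traj hS hB).
    - by move=> s _ st; apply: tr; lra.
    rewrite ri_cst ?subr0; last by lra.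
    have q0 : 0 <= D * (1 + C) * nm x ^+ 2.
      by apply: mulr_ge0 => //; apply: mulr_ge0 => //; apply: addr_ge0.
    by have := ler_wpM2r q0 tT; lra.
  have h2 : nm (traj t x w) ^+ 2 <= nm x ^+ 2 / 2.
    have := @traj_cat_shift (t - T) T x u (fun=> 0) pu p0.
    rewrite subrK subr_ge0 Tt (ltW T0) => /(_ isT isT) ->.
    rewrite (traj_cst0 hS hB).
    have h3 : nm (S (t - T) (traj T x u)) <= M * nm (traj T x u).
      by apply: (blin_nm (hM _ _)); lra.
    have h4 : nm (S (t - T) (traj T x u)) ^+ 2 <= M ^+ 2 * nm (traj T x u) ^+ 2.
      by rewrite -exprMn ler_sqr ?nnegrE ?nm_ge0 ?mulr_ge0 ?nm_ge0//; lra.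
    apply: (le_trans h4).
    apply: le_trans (ler_wpM2l (sqr_ge0 M) hT) _.
    rewrite (_ : M ^+ 2 * ((2 * M ^+ 2)^-1 * nm x ^+ 2) = nm x ^+ 2 / 2)//.
    by field; rewrite gt_eqF//; lra.
  by rewrite /pcost /k; have := ler_wpM2l (ltW k0) h2; rewrite /k; lra.
suff key n : forall x t, T <= t <= n.+2%:R * T ->
    exists2 u, pw u & pcost k t x u <= k * nm x ^+ 2.
  move=> x t Tt; apply: (key (Num.truncn (t / T))); rewrite Tt -ler_pdivrMr//.
  apply: ltW; apply: lt_le_trans (truncnS_gt _) _; rewrite ler_nat; exact: leqW.
elim: n => [|n ih] x t; first exact: base.
move=> /andP[Tt tn]; have [t2|t2] := leP t (2 * T); first by apply: base; rewrite Tt.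
have [|u pu hu] := base x T; first by rewrite lexx; lra.
have [|v pv hv] := ih (traj T x u) (t - T).
  by move: tn; rewrite -natr1 mulrDl mul1r => tn; lra.
exists (ctrl_cat T u v); first exact: pw_ctrl_cat.
rewrite -(subrK T t) pcost_cat ?subr_ge0 ?(ltW T0)//.
by apply: le_trans hu; rewrite /pcost lerD2l.
Qed.

End Cost.

Global Opaque energy cost pcost.

(** * Optimal control and closed loop *)

Ltac gen_cost := repeat match goal with
  | |- context [pcost ?S ?B ?k ?t ?x ?u] => generalize (pcost S B k t x u) => ?
  | |- context [cost ?S ?B ?t ?x ?u] => generalize (cost S B t x u) => ?
  end.

(** * The value function and its quadratic form *)

Section ValueFunction.
Variables (R : realType) (X U : hilb R) (S : R -> X -> X) (B : U -> X) (b : R).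
Hypotheses (hS : semigroup S) (hB : blin B b).
Variables (T k : R).
Hypotheses (T0 : 0 <= T) (k0 : 0 < k).
Hypothesis hext : forall x t, T <= t ->
  exists2 u, pw u & pcost S B k t x u <= k * nm x ^+ 2.
Implicit Types (x y : X) (u v : R -> U) (t s h e : R).
Notation traj := (traj S B).
Notation cost := (cost S B).
Notation pcost := (pcost S B k).

(** The horizon is part of the infimum, the penalty standing for the cost still to come. The horizon
    [t = 0] yields [value_le_sq]. *)
Definition value x : R :=
  inf [set c | exists t u, [/\ 0 <= t, pw u & c = pcost t x u]].

Definition near_opt e t x u : Prop :=
  [/\ 0 <= t, pw u & pcost t x u <= value x + e].

Let has_inf_pcost x : has_inf [set c | exists t u, [/\ 0 <= t, pw u & c = pcost t x u]].
Proof.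
split; first by exists (pcost 0 x (fun=> 0)), 0, (fun=> 0); split=> //; exact: pw_cst.
by exists 0 => _ [t [u [_ _ ->]]]; apply: pcost_ge0; exact: ltW.
Qed.

Lemma value_le t x u : 0 <= t -> pw u -> value x <= pcost t x u.
Proof. by move=> t0 pu; apply: ge_inf; [case: (has_inf_pcost x)|exists t, u]. Qed.

Lemma value_ge0 x : 0 <= value x.
Proof.
apply: lb_le_inf; first by case: (has_inf_pcost x).
by move=> _ [t [u [_ _ ->]]]; apply: pcost_ge0; exact: ltW.
Qed.

Lemma value_le_sq x : value x <= k * nm x ^+ 2.
Proof.
have p0 := @pw_cst _ _ (0 : U).
have := value_le x (lexx 0) p0.
by rewrite pcostE (traj_neg hS hB)// costE ri_nil// add0r.
Qed.

(** By [hext] the penalty at the old horizon pays for a continuation of any length at least [T].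
    This brings controls for different states to a common horizon, where they can be added. *)
Lemma near_opt_ext e t t' x u : near_opt e t x u -> t + T <= t' ->
  exists2 v, near_opt e t' x v & forall s, s <= t -> v s = u s.
Proof.
move=> [t0 pu hu] tt'.
have [|v pv hv] := hext (traj t x u) (t := t' - t); first by lra.
exists (ctrl_cat t u v) => [|s st]; last by rewrite /ctrl_cat st.
split; [by have := T0; lra|exact: pw_ctrl_cat|].
rewrite -(subrK t t') (pcost_cat hS hB)//; last by have := T0; lra.
by apply: le_trans hu; rewrite !pcostE lerD2l.
Qed.

Lemma near_opt_exists x e : 0 < e -> exists2 t0, 0 <= t0 &
  forall t, t0 <= t -> exists u, near_opt e t x u.
Proof.
move=> e0; have [_ [t [u [t0 pu ->]]] h] := inf_adherent e0 (has_inf_pcost x).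
have ou : near_opt e t x u by split=> //; exact: ltW.
exists (t + T) => [|t' tt']; first by have := T0; lra.
by have [v ov _] := near_opt_ext ou tt'; exists v.
Qed.

Opaque value.

Ltac gen_lra := gen_cost; repeat match goal with
  | |- context [value ?x] => move: (value x) => ?
  end; lra.

Lemma value_scale_le a x : value (a *: x) <= a ^+ 2 * value x.
Proof.
apply: le_addeps => e e0.
have c0 : 0 < a ^+ 2 + 1 by have := sqr_ge0 a; lra.
have [|t0 t00 /(_ t0 (lexx _))[u [_ pu hu]]] := @near_opt_exists x (e / (a ^+ 2 + 1)).
  by rewrite divr_gt0.
apply: le_trans (value_le _ t00 (pwZ a pu)) _.
rewrite (pcostZ hS hB)//; apply: le_trans (ler_wpM2l (sqr_ge0 a) hu) _.
rewrite mulrDr lerD2l mulrCA ler_piMr ?(ltW e0)// ler_pdivrMr//; lra.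
Qed.

Lemma valueZ a x : value (a *: x) = a ^+ 2 * value x.
Proof.
apply/eqP; rewrite eq_le value_scale_le /=.
have [->|a0] := eqVneq a 0; first by rewrite expr0n mul0r value_ge0.
have a2 : 0 < a ^+ 2 by rewrite exprn_even_gt0.
rewrite -ler_pdivlMl// -exprVn.
by rewrite -{1}(scalerK a0 x) value_scale_le.
Qed.

Lemma valueN x : value (- x) = value x.
Proof. by rewrite -scaleN1r valueZ sqrrN expr1n mul1r. Qed.

Lemma value0 : value 0 = 0.
Proof. by rewrite -(scale0r 0) valueZ expr0n mul0r. Qed.

(** Sum and difference of near-optimal controls on a common horizon compete for [x + y] and [x - y].
    The reverse inequality is this one at [x + y] and [x - y], combined with homogeneity. *)
Let value_par_le x y : value (x + y) + value (x - y) <= 2 * value x + 2 * value y.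
Proof.
apply: le_addeps => e e0.
have e4 : 0 < e / 4 by lra.
have [t1 t10 h1] := near_opt_exists x e4; have [t2 t20 h2] := near_opt_exists y e4.
have [|u [t0 pu hu]] := h1 (Num.max t1 t2); first by rewrite le_max lexx.
have [|v [_ pv hv]] := h2 (Num.max t1 t2); first by rewrite le_max lexx orbT.
have := value_le (x + y) t0 (pwD pu pv); have := value_le (x - y) t0 (pwB pu pv).
have := pcost_par hS hB k (Num.max t1 t2) x y pu pv; move: hu hv e0; gen_lra.
Qed.

Lemma value_par x y : value (x + y) + value (x - y) = 2 * value x + 2 * value y.
Proof.
apply/eqP; rewrite eq_le value_par_le /=.
have := value_par_le (x + y) (x - y).
have -> : x + y + (x - y) = 2 *: x by rewrite addrACA subrr addr0 -mulr2n scaler_nat.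
have -> : x + y - (x - y) = 2 *: y.
  by rewrite opprD opprK addrACA subrr add0r -mulr2n scaler_nat.
rewrite !valueZ; lra.
Qed.

Definition vform x y : R := (value (x + y) - value (x - y)) / 4.

Lemma vformC x y : vform x y = vform y x.
Proof. by rewrite /vform (addrC y) -(valueN (x - y)) opprB. Qed.

(** The Jordan-von Neumann argument: in [h1 + h2 - h3 - h4] the unwanted values cancel by [e1] and
    [e2], which rest on evenness of [value]. *)
Lemma vformD x y z : vform (x + y) z = vform x z + vform y z.
Proof.
have h1 := value_par (x + z) y; have h2 := value_par (y + z) x.
have h3 := value_par (x - z) y; have h4 := value_par (y - z) x.
have e1 : value (x + z - y) = value (y - z - x).
  by rewrite -valueN; congr value; rewrite !opprD opprK addrC addrA addrAC.
have e2 : value (y + z - x) = value (x - z - y).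
  by rewrite -valueN; congr value; rewrite !opprD opprK addrC addrA addrAC.
have e3 : y + z + x = x + y + z by rewrite addrAC (addrC y).
have e4 : y - z + x = x + y - z by rewrite addrAC (addrC y).
have e5 : x + z + y = x + y + z by rewrite addrAC.
have e6 : x - z + y = x + y - z by rewrite addrAC.
rewrite e1 e5 in h1; rewrite e2 e3 in h2; rewrite e6 in h3; rewrite e4 in h4.
rewrite /vform; move: h1 h2 h3 h4; gen_lra.
Qed.

Lemma vform_diag x : vform x x = value x.
Proof.
rewrite /vform subrr value0 -mulr2n -scaler_nat valueZ; lra.
Qed.

Lemma valueD x y : value (x + y) = value x + 2 * vform x y + value y.
Proof. by rewrite /vform; have := value_par x y; lra. Qed.

Let vform_le x y : `|vform x y| <= (value x + value y) / 2.
Proof.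
have := value_par x y; have := value_ge0 (x + y); have := value_ge0 (x - y).
by rewrite ler_norml /vform; lra.
Qed.

(** Cauchy's functional equation. The additive function [g] vanishes on integers, so its bound on
    the unit interval holds everywhere; then [n%:R * g p = g (n%:R * p)] stays bounded for all [n]
    and forces [g p = 0]. *)
Let additive_bounded (f : R -> R) C : (forall p q, f (p + q) = f p + f q) ->
  (forall p, 0 <= p <= 1 -> `|f p| <= C) -> forall p, f p = p * f 1.
Proof.
move=> fD fC.
pose g p := f p - p * f 1.
have gD p q : g (p + q) = g p + g q by rewrite /g fD; ring.
have g1 : g 1 = 0 by rewrite /g mul1r subrr.
have g0 : g 0 = 0 by have := gD 0 0; rewrite addr0; lra.
have gN p : g (- p) = - g p by have := gD p (- p); rewrite subrr g0; lra.
have gn n p : g (n%:R * p) = n%:R * g p.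
  elim: n => [|n ih]; first by rewrite !mul0r.
  by rewrite -natr1 !mulrDl !mul1r gD ih.
have gz (m : int) : g m%:~R = 0.
  by case: m => n; rewrite ?NegzE ?mulrNz ?gN -(mulr1 (_%:~R)) ?gn ?g1 ?mulr0 ?oppr0.
have gC p : `|g p| <= C + `|f 1|.
  rewrite -(subrK (Num.floor p)%:~R p) gD gz addr0.
  have := floor_le p; have := floorD1_gt p; rewrite intrD/= => h1 h2.
  have p01 : 0 <= p - (Num.floor p)%:~R <= 1 by lra.
  apply: le_trans (ler_normB _ _) _; apply: lerD; first exact: fC.
  by rewrite normrM ler_piMl// ger0_norm; lra.
move=> p; apply/eqP; rewrite -subr_eq0 -/(g p) -normr_le0.
apply: le_addeps => e e0; rewrite add0r.
have C0 : 0 <= C + `|f 1| by apply: le_trans (gC 0).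
pose n := (Num.truncn ((C + `|f 1|) / e)).+1.
have n0 : 0 < n%:R :> R by rewrite ltr0n.
rewrite -(ler_pM2l n0) -[n%:R in leLHS]ger0_norm// -normrM -gn.
apply: (le_trans (gC _)); rewrite -ler_pdivrMr//.
exact/ltW/truncnS_gt.
Qed.

Lemma vformZ a x y : vform (a *: x) y = a * vform x y.
Proof.
have := @additive_bounded (fun p => vform (p *: x) y) ((value x + value y) / 2).
move=> -> //; first by rewrite scale1r.
- by move=> p q; rewrite scalerDl vformD.
- move=> p /andP[p0 p1]; apply: le_trans (vform_le _ _) _.
  rewrite ler_pM2r// lerD2r valueZ ler_piMl ?value_ge0//.
  by rewrite expr_le1.
Qed.

Lemma vformN x y : vform (- x) y = - vform x y.
Proof. by rewrite -scaleN1r vformZ mulN1r. Qed.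

(** The bound by half the sum of the values is applied to [nm y *: x] and [nm x *: y], which have
    equal norms; this turns the sum into a product. *)
Lemma vform_nm x y : `|vform x y| <= k * nm x * nm y.
Proof.
have key z w : nm z = 0 -> vform z w = 0.
  by move=> /nm_eq0 ->; rewrite -(scale0r 0) vformZ mul0r.
have := nm_ge0 x; rewrite le_eqVlt => /orP[/eqP/esym x0|x0].
  by rewrite key// normr0 x0 mulr0 mul0r.
have := nm_ge0 y; rewrite le_eqVlt => /orP[/eqP/esym y0|y0].
  by rewrite vformC key// normr0 y0 mulr0.
have xy : 0 < nm x * nm y by rewrite mulr_gt0.
have := vform_le (nm y *: x) (nm x *: y).
rewrite vformZ vformC vformZ vformC normrM normrM.
rewrite [ `|nm x|]ger0_norm ?nm_ge0// [ `|nm y|]ger0_norm ?nm_ge0//.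
rewrite !valueZ => h; rewrite -(ler_pM2l xy).
have h1 := ler_wpM2l (sqr_ge0 (nm y)) (value_le_sq x).
have h2 := ler_wpM2l (sqr_ge0 (nm x)) (value_le_sq y).
by move: h h1 h2; rewrite !expr2; lra.
Qed.

Lemma value_dist x y : `|value x - value y| <= k * nm (x - y) * nm (x + y).
Proof.
have -> : value x - value y = vform (x - y) (x + y).
  rewrite vformD vformN !(vformC _ (x + y)) !vformD !vform_diag (vformC y x); ring.
exact: vform_nm.
Qed.

(** * Near-optimal controls and dynamic programming *)

Lemma near_opt_sub e e' t x y u v : near_opt e t x u -> near_opt e' t y v ->
  pcost t (x - y) (fun s => u s - v s) <= value (x - y) + (2 * e + 2 * e').
Proof.
move=> [t0 pu hu] [_ pv hv].
have := pcost_par hS hB k t x y pu pv; have := value_par x y.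
have := value_le (x + y) t0 (pwD pu pv); move: hu hv; gen_lra.
Qed.

Lemma near_opt_add e e' t x y u v : near_opt e t x u -> near_opt e' t y v ->
  near_opt (2 * e + 2 * e') t (x + y) (fun s => u s + v s).
Proof.
move=> [t0 pu hu] [_ pv hv]; split=> //; first exact: pwD.
have := pcost_par hS hB k t x y pu pv; have := value_par x y.
have := value_le (x - y) t0 (pwB pu pv); move: hu hv; gen_lra.
Qed.

Lemma near_optZ e a t x u : near_opt e t x u ->
  near_opt (a ^+ 2 * e) t (a *: x) (fun s => a *: u s).
Proof.
move=> [t0 pu hu]; split=> //; first exact: pwZ.
by rewrite (pcostZ hS hB)// valueZ -mulrDr ler_wpM2l ?sqr_ge0.
Qed.

Lemma value_flow_le h x u : 0 <= h -> pw u -> value x <= cost h x u + value (traj h x u).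
Proof.
move=> h0 pu; apply: le_addeps => e e0.
have [t0 t00 /(_ t0 (lexx _))[v [_ pv hv]]] := near_opt_exists (traj h x u) e0.
have := value_le x (addr_ge0 t00 h0) (pw_ctrl_cat h pu pv).
rewrite (pcost_cat hS hB)//; lra.
Qed.

(** Bellman's principle: by [value_flow_le] the head cannot gain on [value x], so the whole defect
    [e] bounds that of the tail. *)
Lemma near_opt_tail e t h x u : near_opt e t x u -> 0 <= h <= t ->
  near_opt e (t - h) (traj h x u) (fun s => u (s + h)).
Proof.
move=> [t0 pu hu] /andP[h0 ht]; split; [lra|exact: pw_shift|].
have := value_flow_le x h0 pu.
have := @pcost_flow _ _ _ _ _ _ hS hB k (t - h) h x u pu; rewrite subr_ge0 ht h0.
move=> /(_ isT isT); rewrite subrK; move: hu; gen_lra.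
Qed.

Lemma near_opt_head e t h x u : near_opt e t x u -> 0 <= h <= t ->
  cost h x u + value (traj h x u) <= value x + e.
Proof.
move=> [t0 pu hu] /andP[h0 ht].
have := @pcost_flow _ _ _ _ _ _ hS hB k (t - h) h x u pu; rewrite subr_ge0 ht h0.
move=> /(_ isT isT); rewrite subrK.
have th : 0 <= t - h by lra.
have := value_le (traj h x u) th (pw_shift h pu); move: hu; gen_lra.
Qed.

Lemma energy_le_pcost s t x u : pw u -> s <= t -> 0 <= t -> energy s u <= pcost t x u.
Proof.
move=> pu st t0; have [s0|s0] := leP s 0.
  by rewrite energyE ri_nil// pcost_ge0// ltW.
apply: le_trans (energy_mono pu (ltW s0) st) _.
apply: le_trans (energy_cost hS hB _ x pu) _.
by rewrite pcostE lerDl mulr_ge0 ?sqr_ge0// ltW.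
Qed.

(** The difference of two controls for [x] is a control for the state [0], whose value is [0]; by
    [near_opt_sub] its penalized cost is at most [2 * e + 2 * e]. This bounds its energy, hence its
    trajectory, and explains the factor in [4 * C]. *)
Lemma near_opt_unique a : 0 <= a -> exists2 C, 0 <= C & forall s x e t u t' v,
  s <= a -> s <= t -> s <= t' -> near_opt e t x u -> near_opt e t' x v ->
  nm (traj s x u - traj s x v) ^+ 2 <= C * e.
Proof.
move=> a0; have [C C0 hC] := traj_energy hS hB a0.
exists (4 * C) => [|s x e t u t' v sa st st' ou ov]; first by lra.
have [|u' ou' uu'] := near_opt_ext ou (t' := Num.max t t' + T).
  by rewrite lerD2r le_max lexx.
have [|v' ov' vv'] := near_opt_ext ov (t' := Num.max t t' + T).
  by rewrite lerD2r le_max lexx orbT.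
rewrite (@traj_ext _ _ _ S B s x u u') ?(@traj_ext _ _ _ S B s x v v'); first last.
- by move=> r _ rs; rewrite uu'// (le_trans rs).
- by move=> r _ rs; rewrite vv'// (le_trans rs).
have := near_opt_sub ou' ov'.
have [tm pu' _] := ou'; have [_ pv' _] := ov'.
rewrite subrr value0 => h.
rewrite -(trajB hS hB)// subrr.
apply: le_trans (hC _ _ _ (pwB pu' pv') sa) _.
rewrite nm0 expr0n add0r (mulrC 4) -mulrA ler_wpM2l//.
apply: le_trans (energy_le_pcost 0 (pwB pu' pv') _ tm) _; last by lra.
have : s <= Num.max t t' by rewrite le_max st.
have := T0; lra.
Qed.

(** * Optimal trajectories as limits *)

Definition opt_traj s x : X := xget 0 [set y | forall e, 0 < e ->
  exists2 d, 0 < d & forall t u, s <= t -> near_opt d t x u ->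
    nm (traj s x u - y) <= e].

Lemma near_opt_le e e' t x u : near_opt e t x u -> e <= e' -> near_opt e' t x u.
Proof. by move=> [? ? h] ee'; split=> //; apply: (le_trans h); rewrite lerD2l. Qed.

(** States reached with defects [n.+1%:R^-1] form a Cauchy sequence by [near_opt_unique]. Its limit
    meets the specification, so the default of [xget] is never taken. *)
Lemma opt_trajP s x e : 0 < e -> exists2 d, 0 < d &
  forall t u, s <= t -> near_opt d t x u -> nm (traj s x u - opt_traj s x) <= e.
Proof.
rewrite /opt_traj; case: xgetP => [y _ /= h|/= hn]; first exact: h.
exfalso.
have [|C C0 hC] := @near_opt_unique (Num.max s 0); first by rewrite le_max lexx orbT.
have sm : s <= Num.max s 0 by rewrite le_max lexx.
have /choice[f hf] : forall n : nat, exists tu : R * (R -> U),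
    s <= tu.1 /\ near_opt n.+1%:R^-1 tu.1 x tu.2.
  move=> n; have [|t0 t00 h] := @near_opt_exists x n.+1%:R^-1.
    by rewrite invr_gt0.
  have [|u ou] := h (Num.max s t0); first by rewrite le_max lexx orbT.
  by exists (Num.max s t0, u); rewrite /= le_max lexx.
have key r : 0 < r -> exists2 d, 0 < d & forall t u t' v, s <= t -> s <= t' ->
    near_opt d t x u -> near_opt d t' x v -> nm (traj s x u - traj s x v) <= r.
  move=> r0; exists (r ^+ 2 / (C + 1)); first by rewrite divr_gt0 ?exprn_gt0//; lra.
  move=> t u t' v st st' ou ov; rewrite -ler_sqr ?nnegrE ?nm_ge0 ?(ltW r0)//.
  apply: le_trans (hC _ _ _ _ _ _ _ sm st st' ou ov) _.
  by rewrite mulrCA ler_piMr ?sqr_ge0// ler_pdivrMr; lra.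
have [|y hy] := @cauchy_nm _ _ (fun n => traj s x (f n).2).
  move=> r r0; have [d d0 hd] := key r r0; have [N hN] := invS_le d0.
  exists N => m n Nm Nn; have [s1 o1] := hf m; have [s2 o2] := hf n.
  by apply: (hd _ _ _ _ s1 s2); [exact: near_opt_le o1 (hN _ Nm)|exact: near_opt_le o2 (hN _ Nn)].
apply: (hn y) => r r0; have r2 : 0 < r / 2 by lra.
have [d d0 hd] := key _ r2; exists d => // t u st ou.
have [N hN] := invS_le d0; have [N' hN'] := hy _ r2.
have [s1 o1] := hf (maxn N N').
have o1' := near_opt_le o1 (hN _ (leq_maxl _ _)).
have := hd _ _ _ _ st s1 ou o1'; have := hN' _ (leq_maxr N N').
have := @nm_trans _ _ (traj s x (f (maxn N N')).2) (traj s x u) y; lra.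
Qed.

Opaque opt_traj.

(** Unlike in [opt_trajP], the rate is uniform in the initial state. The semigroup law needs this,
    because there the second leg starts from a state that depends on the chosen control. *)
Lemma opt_traj_near a : 0 <= a -> exists2 C, 0 <= C & forall s x e t u,
  s <= a -> s <= t -> 0 <= e -> near_opt e t x u ->
  nm (traj s x u - opt_traj s x) ^+ 2 <= C * e.
Proof.
move=> a0; have [C C0 hC] := near_opt_unique a0.
exists (2 * C) => [|s x e t u sa st e0 ou]; first by lra.
apply: le_addeps => r r0.
have c0 : 0 < 2 * C + 2 by lra.
have [d d0 hd] := opt_trajP s x (e := Num.min 1 (r / (2 * C + 2)))
  (ltac:(by rewrite lt_min ltr01 divr_gt0)).
pose d' := Num.min d (r / (2 * C + 2)).
have d'0 : 0 < d' by rewrite lt_min d0 divr_gt0.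
have [t0 t00 h] := near_opt_exists x d'0.
have [|v ov] := h (Num.max t0 s); first by rewrite le_max lexx.
have sm : s <= Num.max t0 s by rewrite le_max lexx orbT.
have h1 : nm (traj s x v - opt_traj s x) <= Num.min 1 (r / (2 * C + 2)).
  by apply: hd sm _; apply: near_opt_le ov _; rewrite ge_min lexx.
have h2 : nm (traj s x u - traj s x v) ^+ 2 <= C * (e + d').
  apply: hC sa st sm _ _; first by apply: near_opt_le ou _; rewrite lerDl ltW.
  by apply: near_opt_le ov _; rewrite lerDr.
have -> : traj s x u - opt_traj s x =
   (traj s x u - traj s x v) + (traj s x v - opt_traj s x) by rewrite addrA subrK.
apply: le_trans (sq_nmD _ _) _.
have h3 : nm (traj s x v - opt_traj s x) ^+ 2 <= r / (2 * C + 2).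
  move: h1; rewrite le_min => /andP[h1 h1']; apply: le_trans h1'.
  by rewrite expr2 ler_piMl ?nm_ge0.
have h4 : C * d' <= C * (r / (2 * C + 2)) by rewrite ler_wpM2l// ge_min lexx orbT.
have h5 : (2 * C + 2) * (r / (2 * C + 2)) = r by rewrite mulrC divfK// gt_eqF.
clearbody d'; move: h2 h3 h4 h5; move: (r / (2 * C + 2)) => q.
move: (nm _ ^+ 2) => n1; move: (nm _ ^+ 2) => n2; lra.
Qed.

Lemma opt_traj_unique s x y :
  (forall e, 0 < e -> exists t u, [/\ s <= t, near_opt e t x u &
     nm (traj s x u - y) <= e]) -> opt_traj s x = y.
Proof.
move=> h; apply/eqP; rewrite -subr_eq0; apply/eqP/nm_eq0/eqP.
rewrite eq_le nm_ge0 andbT; apply: le_addeps => e e0; rewrite add0r.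
have e2 : 0 < e / 2 by lra.
have [d d0 hd] := opt_trajP s x e2.
have [|t [u [st ou hu]]] := h (Num.min d (e / 2)); first by rewrite lt_min d0.
have := hd t u st (near_opt_le ou _); rewrite ge_min lexx => /(_ isT).
move: hu; rewrite le_min => /andP[_ hu].
have := @nm_trans _ _ (traj s x u) (opt_traj s x) y.
rewrite (nm_distC (opt_traj s x) (traj s x u)); lra.
Qed.

Lemma opt_trajD s x y : opt_traj s (x + y) = opt_traj s x + opt_traj s y.
Proof.
apply: opt_traj_unique => e e0; have e4 : 0 < e / 4 by lra.
have [d d0 hd] := opt_trajP s x e4; have [d' d'0 hd'] := opt_trajP s y e4.
have m0 : 0 < Num.min (e / 4) (Num.min d d') by rewrite !lt_min e4 d0.
have [t1 t10 h1] := near_opt_exists x m0; have [t2 t20 h2] := near_opt_exists y m0.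
pose t := Num.max s (Num.max t1 t2).
have [|u ou] := h1 t; first by rewrite !le_max lexx orbT.
have [|v ov] := h2 t; first by rewrite !le_max lexx !orbT.
have st : s <= t by rewrite le_max lexx.
exists t, (fun r => u r + v r); split=> //.
  apply: near_opt_le (near_opt_add ou ov) _.
  have : Num.min (e / 4) (Num.min d d') <= e / 4 by rewrite ge_min lexx.
  move: (Num.min _ _) => m; lra.
have [_ pu _] := ou; have [_ pv _] := ov.
rewrite (trajD hS hB)// opprD addrACA; apply: le_trans (nmD _ _) _.
have := hd t u st (near_opt_le ou _); rewrite !ge_min lexx orbT => /(_ isT).
have := hd' t v st (near_opt_le ov _); rewrite !ge_min lexx !orbT => /(_ isT).
nm_lra.
Qed.

Lemma opt_trajZ s a x : opt_traj s (a *: x) = a *: opt_traj s x.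
Proof.
apply: opt_traj_unique => e e0.
have c0 : 0 < `|a| + 1 by have := normr_ge0 a; lra.
have c1 : 0 < a ^+ 2 + 1 by have := sqr_ge0 a; lra.
have [|d d0 hd] := opt_trajP s x (e := e / (`|a| + 1)); first by rewrite divr_gt0.
have m0 : 0 < Num.min d (e / (a ^+ 2 + 1)) by rewrite lt_min d0 divr_gt0.
have [t1 t10 h1] := near_opt_exists x m0.
have [|u ou] := h1 (Num.max s t1); first by rewrite le_max lexx orbT.
have st : s <= Num.max s t1 by rewrite le_max lexx.
exists (Num.max s t1), (fun r => a *: u r); split=> //.
  apply: near_opt_le (near_optZ a ou) _.
  apply: le_trans (ler_wpM2l (sqr_ge0 a) (_ : _ <= e / (a ^+ 2 + 1))) _.
    by rewrite ge_min lexx orbT.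
  by rewrite mulrCA ler_piMr ?(ltW e0)// ler_pdivrMr; lra.
have [_ pu _] := ou.
rewrite (trajZ hS hB)// -scalerBr nmZ.
have := hd _ u st (near_opt_le ou _); rewrite ge_min lexx => /(_ isT) h.
apply: le_trans (ler_wpM2l (normr_ge0 a) h) _.
by rewrite mulrCA ler_piMr ?(ltW e0)// ler_pdivrMr; lra.
Qed.

Lemma opt_traj_neg s x : s <= 0 -> opt_traj s x = x.
Proof.
move=> s0; apply: opt_traj_unique => e e0.
have [t t0 /(_ t (lexx _))[u ou]] := near_opt_exists x e0.
have [_ pu _] := ou; exists t, u; split=> //; first exact: le_trans s0 t0.
by rewrite (traj_neg hS hB)// subrr nm0 ltW.
Qed.

Lemma opt_traj_bounded a : 0 <= a -> exists2 M, 0 < M & forall s y, s <= a ->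
  nm (opt_traj s y) <= M * nm y.
Proof.
move=> a0; have [C C0 hC] := opt_traj_near a0.
have [C' C'0 hC'] := traj_energy hS hB a0.
(* The energy of a near-optimal control is at most [k * nm y ^+ 2] up to the defect, so
   [traj_energy] bounds the state; the factor [2] comes from passing to the limit, and the final
   [+ 1] makes the constant positive. *)
exists (Num.sqrt (2 * C' * (2 + k)) + 1) => [|s y sa].
  by rewrite ltr_wpDl// sqrtr_ge0.
apply: (@le_trans _ _ (Num.sqrt (2 * C' * (2 + k)) * nm y)); last first.
  by rewrite ler_wpM2r ?nm_ge0// lerDl.
have D0 : 0 <= 2 * C' * (2 + k) by have := mulr_ge0 C'0 (ltW k0); lra.
rewrite -ler_sqr ?nnegrE ?mulr_ge0 ?sqrtr_ge0 ?nm_ge0// exprMn (sqr_sqrtr D0).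
apply: le_addeps => r r0.
have c1 : 0 < 2 * C' + 2 * C + 1 by lra.
have r'0 : 0 < r / (2 * C' + 2 * C + 1) by rewrite divr_gt0.
have [t1 t10 g] := near_opt_exists y r'0.
have [|u ou] := g (Num.max s t1); first by rewrite le_max lexx orbT.
have sm : s <= Num.max s t1 by rewrite le_max lexx.
have [tm pu hu] := ou.
have q1 := hC s y _ _ u sa sm (ltW r'0) ou.
have q2 := hC' s y u pu sa.
have q3 := energy_le_pcost y pu sm tm.
have q4 := value_le_sq y.
have q5 : C' * (nm y ^+ 2 + energy s u) <=
    C' * (nm y ^+ 2 + (k * nm y ^+ 2 + r / (2 * C' + 2 * C + 1))).
  by rewrite ler_wpM2l// lerD2l; lra.
have q6 : nm (opt_traj s y) ^+ 2 <=
    2 * nm (traj s y u) ^+ 2 + 2 * nm (traj s y u - opt_traj s y) ^+ 2.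
  rewrite (nm_distC (traj s y u)).
  by rewrite -{1}(subrK (traj s y u) (opt_traj s y)) addrC sq_nmD.
have q7 : (2 * C' + 2 * C + 1) * (r / (2 * C' + 2 * C + 1)) = r.
  by rewrite mulrC divfK// gt_eqF.
have q8 := mulr_ge0 C'0 (sqr_ge0 (nm y)).
have q9 := mulr_ge0 (ltW k0) q8.
move: q1 q2 q5 q6 q7 r'0 q8 q9.
move: (r / _) (nm (traj s y u - _)) (nm (traj s y u)) (nm (opt_traj s y)) (nm y).
move: (energy s u) => E q n1 n2 n3 n4; lra.
Qed.

(** Bellman's principle in the limit: the tail of a near-optimal control is near-optimal from the
    state reached at time [t], and that state tends to [opt_traj t x]. *)
Lemma opt_traj_add s t x : 0 <= s -> 0 <= t ->
  opt_traj (s + t) x = opt_traj s (opt_traj t x).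
Proof.
move=> s0 t0; have [C C0 hC] := opt_traj_near s0.
apply/eqP; rewrite -subr_eq0; apply/eqP/nm_eq0/eqP.
rewrite eq_le nm_ge0 andbT; apply: le_addeps => e e0; rewrite add0r.
have e4 : 0 < e / 4 by lra.
have e34 : e / 4 + (e / 4 + e / 4) <= e by lra.
have [d1 d10 h1] := opt_trajP (s + t) x e4.
have [M M0 hM] := opt_traj_bounded s0.
have [|d2 d20 h2] := opt_trajP t x (e := e / (4 * M)).
  by rewrite divr_gt0// mulr_gt0.
pose d := Num.min (Num.min d1 d2) ((e / 4) ^+ 2 / (C + 1)).
have d0 : 0 < d by rewrite !lt_min d10 d20 divr_gt0 ?exprn_gt0//; lra.
have [t1 t10 g] := near_opt_exists x d0.
have [|u ou] := g (Num.max (s + t) t1); first by rewrite le_max lexx orbT.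
have st : s + t <= Num.max (s + t) t1 by rewrite le_max lexx.
have tt : t <= Num.max (s + t) t1 by lra.
have [_ pu _] := ou.
have k1 := h1 _ u st (near_opt_le ou _).
rewrite /d !ge_min lexx in k1; have {}k1 := k1 isT.
have k2 := h2 _ u tt (near_opt_le ou _).
rewrite /d !ge_min lexx orbT in k2; have {}k2 := k2 isT.
have := near_opt_tail (h := t) ou; rewrite t0 tt => /(_ isT) otail.
have sst : s <= Num.max (s + t) t1 - t by lra.
have k3 := hC s _ _ _ _ (lexx s) sst (ltW d0) otail.
rewrite -(traj_flow hS hB)// in k3.
have k4 : nm (traj (s + t) x u - opt_traj s (traj t x u)) <= e / 4.
  rewrite -ler_sqr ?nnegrE ?nm_ge0 ?(ltW e4)//; apply: (le_trans k3).
  apply: le_trans (ler_wpM2l C0 (_ : _ <= (e / 4) ^+ 2 / (C + 1))) _.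
    by rewrite ge_min lexx orbT.
  by rewrite mulrCA ler_piMr ?sqr_ge0// ler_pdivrMr; lra.
have k5 : nm (opt_traj s (traj t x u) - opt_traj s (opt_traj t x)) <= e / 4.
  rewrite -scaleN1r -opt_trajZ -opt_trajD scaleN1r; apply: le_trans (hM _ _ (lexx s)) _.
  apply: le_trans (ler_wpM2l (ltW M0) k2) _.
  by rewrite le_eqVlt; apply/orP; left; apply/eqP; field; rewrite gt_eqF.
apply: le_trans (@nm_trans _ _ (traj (s + t) x u) _ _) (le_trans _ e34).
apply: lerD; first by rewrite nm_distC.
exact: le_trans (@nm_trans _ _ (opt_traj s (traj t x u)) _ _) (lerD k4 k5).
Qed.

Lemma vformDr x y z : vform x (y + z) = vform x y + vform x z.
Proof. by rewrite vformC vformD !(vformC x). Qed.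

Lemma vformZr a x y : vform x (a *: y) = a * vform x y.
Proof. by rewrite vformC vformZ (vformC x). Qed.

Lemma vformNr x y : vform x (- y) = - vform x y.
Proof. by rewrite vformC vformN (vformC x). Qed.

(** * Monotonicity of the value and boundedness in time *)

Lemma value_opt_traj t x : 0 <= t -> value (opt_traj t x) <= value x.
Proof.
move=> t0; apply: le_addeps => e e0.
pose D := 2 * nm (opt_traj t x) + 1.
have D1 : 1 <= D by rewrite lerDr mulr_ge0// nm_ge0.
have kD : 0 < k * D + 1 by have := mulr_ge0 (ltW k0) (le_trans ler01 D1); lra.
have m0 : 0 < Num.min 1 (e / (2 * (k * D + 1))).
  by rewrite lt_min ltr01 divr_gt0// mulr_gt0.
have [d d0 hd] := opt_trajP t x m0.
have m1 : 0 < Num.min d (e / 2) by rewrite lt_min d0; lra.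
have [t1 t10 h] := near_opt_exists x m1.
have [|u ou] := h (Num.max t t1); first by rewrite le_max lexx orbT.
have tt : t <= Num.max t t1 by rewrite le_max lexx.
have := hd _ _ tt (near_opt_le ou _); rewrite ge_min lexx => /(_ isT).
rewrite le_min => /andP[h1 h2].
have := near_opt_head (h := t) (near_opt_le ou (_ : _ <= e / 2)).
rewrite t0 tt ge_min lexx orbT => /(_ isT isT) h3.
have h4 := cost_ge0 S B t x u.
have := value_dist (traj t x u) (opt_traj t x).
have h5 : nm (traj t x u + opt_traj t x) <= D.
  have := nmD (traj t x u) (opt_traj t x).
  have := nm_subl (traj t x u) (opt_traj t x); rewrite /D.
  move: h1; nm_lra.
have h6 : k * nm (traj t x u - opt_traj t x) * nm (traj t x u + opt_traj t x) <= e / 2.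
  apply: (@le_trans _ _ (k * (e / (2 * (k * D + 1))) * D)).
    apply: ler_pM => //; [|exact: nm_ge0|by rewrite ler_pM2l].
    by apply: mulr_ge0 (nm_ge0 _); exact: ltW.
  rewrite (_ : _ * D = e / 2 * (k * D / (k * D + 1))); last by field; rewrite gt_eqF.
  by rewrite ler_piMr ?ler_pdivrMr//; lra.
rewrite ler_norml => /andP[h7 _].
by move: h3 h4 h6 h7; gen_lra.
Qed.

(** [value x] itself need not dominate the norm of [x], but it dominates the state one unit of time
    later: the estimate of [traj_energy] on [[s, 1]] is integrated over [s], which brings in the
    running cost. *)
Lemma opt_traj_observable : exists2 C, 0 <= C & forall x,
  nm (opt_traj 1 x) ^+ 2 <= C * value x.
Proof.
have [C C0 hC] := traj_energy hS hB ler01.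
have [C' C'0 hC'] := opt_traj_near ler01.
exists (2 * C) => [|x]; first by lra.
apply: le_addeps => e e0.
have c1 : 0 < 2 * C + 2 * C' + 1 by lra.
have m0 : 0 < e / (2 * C + 2 * C' + 1) by rewrite divr_gt0.
have [t1 t10 h] := near_opt_exists x m0.
have [|u ou] := h (Num.max 1 t1); first by rewrite le_max lexx orbT.
have tt : 1 <= Num.max 1 t1 by rewrite le_max lexx.
have q1 := hC' 1 x _ _ u (lexx _) tt (ltW m0) ou.
have := near_opt_head (h := 1) ou; rewrite ler01 tt => /(_ isT) q2.
have q3 := value_ge0 (traj 1 x u).
have [_ pu _] := ou.
have bt : bm (fun s => nm (traj s x u) ^+ 2) by exact/bmX/(bm_traj hS hB).
have q4 : nm (traj 1 x u) ^+ 2 <= C * cost 1 x u.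
  rewrite costE riD//; last exact/bmX/pw_bm_nm.
  rewrite -energyE mulrDr -riZ// -[leLHS]mulr1 -[X in _ * X](subr0 1) -ri_cst//.
  rewrite -[X in _ + X]mulr1 -[X in _ * X](subr0 1) -ri_cst//.
  rewrite -riD; [|exact: bmZ|exact: bm_cst].
  apply: ri_le => [||s s0 s1]; [exact: bm_cst|by apply: bmD; [exact: bmZ|exact: bm_cst]|].
  have := @traj_flow _ _ _ _ _ _ hS hB (1 - s) s x u pu.
  rewrite subr_ge0 s1 (ltW s0) subrK => /(_ isT isT) ->.
  apply: le_trans (hC (1 - s) _ _ (pw_shift s pu) _) _; first by lra.
  rewrite -mulrDr ler_wpM2l// lerD2l !energyE.
  have := ri_shift 0 (1 - s) s (bmX 2 (pw_bm_nm pu)).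
  rewrite add0r subrK => <-.
  rewrite [leRHS](ri_split (bmX 2 (pw_bm_nm pu)) (ltW s0) s1) lerDr.
  by apply: ri_ge0 => r _ _; exact: sqr_ge0.
have q5 : nm (opt_traj 1 x) ^+ 2 <=
    2 * nm (traj 1 x u) ^+ 2 + 2 * nm (traj 1 x u - opt_traj 1 x) ^+ 2.
  rewrite (nm_distC (traj 1 x u)).
  by rewrite -{1}(subrK (traj 1 x u) (opt_traj 1 x)) addrC sq_nmD.
have q6 : C * cost 1 x u <= C * (value x + e / (2 * C + 2 * C' + 1)).
  by rewrite ler_wpM2l//; lra.
have q7 : (2 * C + 2 * C' + 1) * (e / (2 * C + 2 * C' + 1)) = e.
  by rewrite mulrC divfK// gt_eqF.
move: q1 q4 q5 q6 q7 m0; move: (cost 1 x u) (value x) (e / _) => c v q.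
move: (nm _) (nm _) (nm _) => n1 n2 n3; lra.
Qed.

(** Past time one, [opt_traj_observable] is applied to the state one unit earlier, whose value has
    not increased and is at most [k * nm x ^+ 2]. *)
Lemma opt_traj_uniform_bound : exists M, forall t x, nm (opt_traj t x) <= M * nm x.
Proof.
have [C C0 hC] := opt_traj_observable.
have [M M0 hM] := opt_traj_bounded ler01.
have Ck : 0 <= C * k by rewrite mulr_ge0// ltW.
exists (M + Num.sqrt (C * k)) => t x.
have [t1|t1] := leP t 1.
  apply: le_trans (hM _ _ t1) _.
  by rewrite ler_wpM2r ?nm_ge0// lerDl sqrtr_ge0.
rewrite -(subrK 1 t) addrC opt_traj_add//; last by lra.
apply: (@le_trans _ _ (Num.sqrt (C * k) * nm x)); last first.
  by rewrite ler_wpM2r ?nm_ge0// lerDr ltW.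
rewrite -ler_sqr ?nnegrE ?mulr_ge0 ?sqrtr_ge0 ?nm_ge0// exprMn (sqr_sqrtr Ck).
apply: (le_trans (hC _)); rewrite -mulrA ler_wpM2l//.
by apply: le_trans (value_opt_traj _ _) (value_le_sq _); lra.
Qed.

(* The dynamic programming inequality at [x + e *: w] gives the continuity,
   uniform in [w], that would otherwise require the adjoint semigroup. *)
Lemma vform_right_continuous x e : 0 < e -> exists2 d, 0 < d &
  forall r w, 0 <= r <= d -> `|vform x (S r w - w)| <= e * nm w.
Proof.
move=> e0; have [M M1 hM] := sg_bounded hS 1; have M0 := le_trans ler01 M1.
have kM : 0 < k * M ^+ 2 + 1 by have := mulr_ge0 (ltW k0) (sqr_ge0 M); lra.
(* The step in the direction [z]: it is small enough that [l * value (S r z)] is at most [e]. The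
   time [r] is then restricted in terms of [l]. *)
pose l := Num.min 1 (e / (k * M ^+ 2 + 1)).
have l0 : 0 < l by rewrite lt_min ltr01 divr_gt0.
have l1 : l <= 1 by rewrite ge_min lexx.
have lk : l * (k * M ^+ 2 + 1) <= e.
  by rewrite -ler_pdivlMr// ge_min lexx orbT.
pose A := k * (M + 1) * nm x + k * M + 1.
have kx : 0 <= k * (M + 1) * nm x.
  by apply: mulr_ge0 (nm_ge0 _); apply: mulr_ge0; [exact: ltW|lra].
have kM0 : 0 <= k * M by apply: mulr_ge0; [exact: ltW|lra].
have A0 : 0 < A by rewrite /A; lra.
pose Q := M ^+ 2 * (nm x + 1) ^+ 2 + 1.
have Q0 : 0 < Q by have := mulr_ge0 (sqr_ge0 M) (sqr_ge0 (nm x + 1)); rewrite /Q; lra.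
have [|d d0 hd] := sg_cont hS x (e := l * e / (8 * A)).
  by rewrite divr_gt0 ?mulr_gt0.
exists (Num.min 1 (Num.min d (l * e / (8 * Q)))).
  by rewrite !lt_min ltr01 d0 divr_gt0 ?mulr_gt0.
move=> r w; rewrite !le_min => /andP[r0 /and3P[r1 rd rQ]].
have {}rQ : r * Q <= l * e / 8.
  by rewrite -ler_pdivlMr// (_ : _ / Q = l * e / (8 * Q))//; field; rewrite gt_eqF.
have := hd r; rewrite r0 rd => /(_ isT) hdl.
have {}hdl : A * nm (S r x - x) <= l * e / 8.
  rewrite mulrC -ler_pdivlMr// (_ : _ / A = l * e / (8 * A))//.
  by field; rewrite gt_eqF.
have Sr := hM r r1.
have key z : nm z <= 1 -> vform x (z - S r z) <= e.
  move=> z1.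
  have p0 := @pw_cst _ _ (0 : U).
  (* The zero control is tried on [[0, r]]. After expansion in [l] the values of [x] and [S r x]
     almost cancel and the linear part is [2 * l * vform x (z - S r z)]. The bound is one-sided;
     applied to [z] and [- z] it gives the absolute value. *)
  have hf := value_flow_le (x + l *: z) r0 p0.
  rewrite (traj_cst0 hS hB) in hf.
  have h1 : cost r (x + l *: z) (fun=> 0) <= r * Q.
    rewrite costE; apply: le_trans (ri_le (g := fun=> Q) _ (bm_cst _) _) _.
    - exact: (bm_cost hS hB).
    - move=> s s0 sr; rewrite (traj_cst0 hS hB) nm0 expr0n addr0.
      have : nm (S s (x + l *: z)) <= M * (nm x + 1).
        apply: le_trans (blin_nm (hM s _) _) _; first exact: le_trans sr r1.
        rewrite ler_wpM2l//.
        apply: le_trans (nmD _ _) _; rewrite lerD2l nmZ gtr0_norm//.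
        by rewrite -[leRHS]mulr1; apply: ler_pM => //; rewrite ?nm_ge0// ltW.
      rewrite -ler_sqr ?nnegrE ?nm_ge0 ?mulr_ge0 ?addr_ge0 ?nm_ge0//.
      by move/le_trans; apply; rewrite exprMn /Q lerDl ler01.
    by rewrite ri_cst// subr0 mulrC.
  rewrite (blinD Sr) (blinZ Sr) !valueD !valueZ !vformZr in hf.
  have h2 := value_ge0 z.
  have h3 : value (S r z) <= k * M ^+ 2.
    apply: (le_trans (value_le_sq _)); rewrite ler_pM2l// -[leRHS]mulr1.
    rewrite -[X in _ * X](expr1n _ 2) -exprMn ler_sqr ?nnegrE ?mulr_ge0 ?nm_ge0//.
    by rewrite mulr1; apply: le_trans (blin_nm Sr _) _; rewrite -[leRHS]mulr1 ler_wpM2l.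
  have h4 := value_dist (S r x) x.
  have h5 : nm (S r x + x) <= (M + 1) * nm x.
    apply: le_trans (nmD _ _) _; rewrite mulrDl mul1r lerD2r.
    exact: blin_nm.
  have d_ge0 := nm_ge0 (S r x - x).
  have h6 : k * nm (S r x - x) * nm (S r x + x) <=
      k * (M + 1) * nm x * nm (S r x - x).
    apply: le_trans (ler_wpM2l (mulr_ge0 (ltW k0) d_ge0) h5) _.
    by rewrite [leLHS]mulrAC !mulrA.
  have h7 : vform (S r x) (S r z) - vform x (S r z) <= k * M * nm (S r x - x).
    have -> : vform (S r x) (S r z) - vform x (S r z) = vform (S r x - x) (S r z).
      by rewrite vformD vformN.
    apply: le_trans (ler_norm _) (le_trans (vform_nm _ _) _).
    have h8 : nm (S r z) <= M.
      by apply: le_trans (blin_nm Sr _) _; rewrite -[leRHS]mulr1 ler_wpM2l.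
    by rewrite [leRHS]mulrAC ler_wpM2l ?mulr_ge0 ?(ltW k0).
  have -> : vform x (z - S r z) = vform x z - vform x (S r z).
    by rewrite vformC vformD vformN !(vformC _ x).
  have h9 : l * l * (k * M ^+ 2) <= l * e.
    by rewrite -mulrA ler_pM2l// (le_trans _ lk)// ler_pM2l// lerDl ler01.
  have h10 : l * l * value (S r z) <= l * l * (k * M ^+ 2).
    by rewrite ler_wpM2l// mulr_ge0// ltW.
  have h11 : 0 <= l * l * value z by rewrite mulr_ge0// mulr_ge0// ltW.
  have h12 : l * (vform (S r x) (S r z) - vform x (S r z)) <= l * (k * M * nm (S r x - x)).
    by rewrite ler_pM2l.
  have h13 : l * (k * M * nm (S r x - x)) <= k * M * nm (S r x - x).
    by rewrite ler_piMl// mulr_ge0.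
  have h14 : 0 <= k * (M + 1) * nm x * nm (S r x - x) by rewrite mulr_ge0.
  have h15 : 0 <= k * M * nm (S r x - x) by rewrite mulr_ge0.
  have h16 : 0 < l * e by rewrite mulr_gt0.
  rewrite -(ler_pM2l l0).
  move: hf h4 h1 h6 h9 h10 h11 h12 h13 h14 h15 h16 hdl d_ge0 rQ.
  rewrite /A ler_norml => hf /andP[_]; move: hf.
  rewrite !expr2.
  move: (cost _ _ _) (value _) (value _) (value _) (value _) => c1 v1 v2 v3 v4.
  move: (vform _ _) (vform _ _) (vform _ _) => f1 f2 f3.
  move: (nm (S r x - x)) (nm (S r x + x)) => n1 n2; lra.
have [w0|w0] := eqVneq (nm w) 0.
  rewrite (nm_eq0 w0) (blin0 Sr) subrr vformC -(scale0r 0) vformZ mul0r normr0.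
  by rewrite scale0r nm0 mulr0.
have nw : 0 < nm w by rewrite lt_neqAle eq_sym w0 nm_ge0.
have unit1 : nm ((nm w)^-1 *: w) <= 1.
  by rewrite nmZ gtr0_norm ?invr_gt0// mulVf.
have key' : `|vform x (S r ((nm w)^-1 *: w) - (nm w)^-1 *: w)| <= e.
  rewrite ler_norml -opprB vformNr lerN2 key//= -vformNr opprB.
  by have := key (- ((nm w)^-1 *: w)); rewrite nmN (blinN Sr) opprK addrC; exact.
rewrite (_ : S r w - w = nm w *: (S r ((nm w)^-1 *: w) - (nm w)^-1 *: w)).
  by rewrite vformZr normrM (gtr0_norm nw) mulrC ler_pM2r.
by rewrite (blinZ Sr) -scalerBr scalerA divff ?gt_eqF// scale1r.
Qed.

(** * The feedback law and the first-order expansion *)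

Definition feedback x : U :=
  xget 0 [set w | forall z, ip w z = - vform x (B z)].

(** In operator terms the feedback is the negative of the adjoint of [B] applied to [P x], where [P]
    represents [vform]: the feedback of Riccati theory, obtained without a Riccati equation. *)
Lemma feedbackE x z : ip (feedback x) z = - vform x (B z).
Proof.
rewrite /feedback; case: xgetP => [w _ /(_ z)//|/= hn]; exfalso.
have [w hw] : exists w, forall z, - vform x (B z) = ip w z.
  apply: (@riesz _ _ _ (k * nm x * b)) => [y y'|a y|y].
  - by rewrite (blinD hB) vformDr opprD.
  - by rewrite (blinZ hB) vformZr mulrN.
  - rewrite normrN; apply: le_trans (vform_nm _ _) _.
    rewrite -[leRHS]mulrA ler_wpM2l ?(blin_nm hB)//.
    by rewrite mulr_ge0 ?nm_ge0// ltW.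
by apply: (hn w) => y; rewrite hw.
Qed.

Lemma feedback_blin : blin feedback (k * b).
Proof.
have b0 := blin_ge0 hB; have kb : 0 <= k * b by rewrite mulr_ge0// ltW.
split=> // [x y|a x|x].
- by apply: ip_inj => z; rewrite ipDl !feedbackE vformD opprD.
- by apply: ip_inj => z; rewrite ipZl !feedbackE vformZ mulrN.
- apply: nm_test => [|z]; first by rewrite mulr_ge0 ?nm_ge0.
  rewrite feedbackE; apply: le_trans (ler_norm _) _; rewrite normrN.
  apply: le_trans (vform_nm _ _) _.
  have := ler_wpM2l (mulr_ge0 (ltW k0) (nm_ge0 x)) (blin_nm hB z).
  by move/le_trans; apply; rewrite le_eqVlt; apply/orP; left; apply/eqP; ring.
Qed.

Lemma vform_riesz x : exists w, forall y, vform x y = ip w y.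
Proof.
apply: (@riesz _ _ _ (k * nm x)) => [y y'|a y|y].
- exact: vformDr.
- exact: vformZr.
- exact: vform_nm.
Qed.

Lemma vform_conv x h u : pw u ->
  vform x (conv S B h u) = ri 0 h (fun s => vform x (S (h - s) (B (u s)))).
Proof.
move=> pu; have [w hw] := vform_riesz x.
rewrite hw ipC convE pintE; last exact: (pw_conv hS hB).
by apply: ri_ext => s _ _; rewrite hw ipC.
Qed.

Lemma conv_cst_expansion z e : 0 < e -> exists2 d, 0 < d & forall h, 0 <= h <= d ->
  nm (conv S B h (fun=> z) - h *: B z) <= e * h.
Proof.
move=> e0; have [d d0 hd] := sg_cont hS (B z) e0; exists d => // h /andP[h0 hd'].
have p0 := pw_conv hS hB h (pw_cst z).
have -> : conv S B h (fun=> z) - h *: B z = pint 0 h (fun s => S (h - s) (B z) - B z).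
  rewrite pintD//; last exact: pw_cst.
  by rewrite pint_cst// subr0 scalerN convE.
have p1 : pw (fun s => S (h - s) (B z) - B z) by apply: pwB => //; exact: pw_cst.
apply: le_trans (pint_nm _ _ p1) _.
rewrite -[X in _ * X](subr0 h) -ri_cst//.
apply: ri_le => [||s s0 sh]; [exact: pw_bm_nm|exact: bm_cst|].
by apply: hd; lra.
Qed.

(** Here [a] and [v] are state and control under the constant control, [d] and [w] the deviations.
    The cross term of the states is only estimated, that of the controls is kept exactly, since it
    will cancel. *)
Let sq_sum_lower (a d : X) (v w : U) Y c : nm a <= Y -> nm d <= c ->
  nm a ^+ 2 + nm v ^+ 2 + (nm w ^+ 2 + 2 * ip v w - 2 * (Y * c)) <=
  nm (a + d) ^+ 2 + nm (v + w) ^+ 2.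
Proof.
move=> aY dc; have := ip_nm a d; rewrite ler_norml => /andP[a3 _].
have a4 : nm a * nm d <= Y * c by apply: ler_pM => //; exact: nm_ge0.
have := ip_ge0 d; rewrite !nm_sq !ipE (ipC w v) (ipC d a); lra.
Qed.

(** [W1] and [W2] are the integrals of the deviation and of its square. Were [W1] larger than
    [q * (D + 1) * h], then [W1 ^+ 2] would exceed [h * q * D * W1 + (h * q) ^+ 2], against
    Cauchy-Schwarz. *)
Let sq_absorb (h q D W1 W2 : R) : 0 < h -> 0 < q -> 1 <= D -> 0 <= W1 ->
  W1 ^+ 2 <= h * W2 -> W2 <= q ^+ 2 * h + q * D * W1 -> W1 <= q * (D + 1) * h.
Proof.
move=> h0 q0 D1 W10 W12 W2le; rewrite leNgt; apply/negP => W1gt.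
have hq : 0 < h * q by rewrite mulr_gt0.
have g1 : W1 ^+ 2 <= h * (q ^+ 2 * h + q * D * W1).
  by apply: (le_trans W12); rewrite ler_pM2l.
have g2 : h * q * (h * q) < W1 * (h * q).
  rewrite ltr_pM2r//; apply: le_lt_trans W1gt.
  by have := ler_wpM2l (ltW hq) D1; lra.
have g3 : W1 * (q * (D + 1) * h) <= W1 * W1 by rewrite ler_wpM2l// ltW.
move: g1 g2 g3; rewrite !expr2; lra.
Qed.

(* Compare the cost with that of the constant control and complete the square. *)
Lemma near_opt_feedback x e : 0 < e -> exists2 d, 0 < d & forall h, 0 < h <= d ->
  exists2 d', 0 < d' & forall t u, h <= t -> near_opt d' t x u ->
    ri 0 h (fun s => nm (u s - feedback x)) <= e * h.
Proof.
move=> e0; pose v := feedback x.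
have pv := @pw_cst _ _ v.
have [M M1 hM] := sg_bounded hS 1; have M0 := le_trans ler01 M1.
have [C C0 hC] := conv_bound hS hB 1.
have [Y Y0 hY] := traj_bounded hS hB 1 x pv.
have b0 := blin_ge0 hB.
(* The coefficient of [q * W1] in the final estimate: [2 * Y * C] from the states, where [h <= q] is
   used, the next term from the terminal value, and [1] for the hypothesis [1 <= D] of
   [sq_absorb]. *)
pose D := 2 * Y * C + 2 * (b * (k * M + 1)) + 1.
have kMb : 0 <= b * (k * M + 1).
  by apply: mulr_ge0 => //; have := mulr_ge0 (ltW k0) (le_trans ler01 M1); lra.
have YC := mulr_ge0 Y0 C0.
have D1 : 1 <= D by rewrite /D; lra.
pose q := e / (D + 1).
have q0 : 0 < q by rewrite divr_gt0//; lra.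
have qD : q * (D + 1) = e by rewrite /q divfK// gt_eqF//; lra.
have [d1 d10 hd1] := vform_right_continuous x q0.
have [d2 d20 hd2] := traj_right_continuous hS hB x 0 pv q0.
exists (Num.min (Num.min 1 q) (Num.min d1 d2)).
  by rewrite !lt_min ltr01 q0 d10.
move=> h; rewrite !le_min => /andP[h0 /andP[/andP[h1 hq] /andP[hd1' hd2']]].
exists (q ^+ 2 * h) => [|t u ht ou]; first by rewrite mulr_gt0// exprn_gt0.
have [t0 pu hu] := ou.
pose w s := u s - v; have pw_ : pw w by exact: pwB.
have bw := pw_bm_nm pw_; have bw2 := bmX 2 bw.
have bvw := pw_bm_ip pv pw_.
have tu s : traj s x u = traj s x (fun=> v) + conv S B s w.
  rewrite -[in RHS](_ : traj s 0 w = conv S B s w); last first.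
    by rewrite trajE -{1}(subrr 0) (sgB hS) subrr add0r.
  rewrite -(trajD hS hB)// addr0; congr (traj s x _).
  by apply/funext => r; rewrite /w addrC subrK.
set W1 := ri 0 h (fun s => nm (u s - feedback x)).
pose W2 := ri 0 h (fun s => nm (w s) ^+ 2).
pose Ivw := ri 0 h (fun s => ip v (w s)).
have W10 : 0 <= W1 by apply: ri_ge0 => s _ _; exact: nm_ge0.
have W12 : W1 ^+ 2 <= h * W2.
  by have := ri_cauchy_schwarz bw (ltW h0); rewrite subr0.
have convW s : 0 < s -> s <= h -> nm (conv S B s w) <= C * W1.
  move=> s0 sh; apply: le_trans (hC _ _ pw_ _) _; first exact: le_trans sh h1.
  rewrite ler_wpM2l// /W1 (ri_split bw (ltW s0) sh) lerDl.
  by apply: ri_ge0 => r _ _; exact: nm_ge0.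
have step1 : cost h x (fun=> v) + (W2 + 2 * Ivw - 2 * Y * C * W1 * h) <= cost h x u.
  rewrite !costE /W2 /Ivw -riZ// -riD//; last exact: bmZ.
  rewrite -[X in _ * X](subr0 h) -ri_cst ?(ltW h0)//.
  rewrite -riB; [|by apply: bmD => //; exact: bmZ|exact: bm_cst].
  rewrite -riD; [|exact: (bm_cost hS hB)|].
    apply: ri_le => [||s s0 sh].
    - apply: bmD; first exact: (bm_cost hS hB).
      by apply: bmB (bm_cst _); apply: bmD => //; exact: bmZ.
    - exact: (bm_cost hS hB).
    have a1 := hY s (le_trans sh h1).
    have a2 := convW s s0 sh.
    rewrite tu (_ : u s = v + w s); last by rewrite /w addrC subrK.
    by apply: le_trans (sq_sum_lower _ _ a1 a2); rewrite -!mulrA.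
  by apply: bmB (bm_cst _); apply: bmD => //; exact: bmZ.
(* To first order the terminal value changes by twice the integral of [vform x (B (w s))], which is
   [- 2 * Ivw] by [feedbackE]. It cancels the cross term of [step1]: this is what singles out the
   feedback. *)
have step2 : value (traj h x (fun=> v)) - 2 * Ivw - 2 * (q * (b * (k * M + 1)) * W1)
    <= value (traj h x u).
  rewrite tu valueD.
  have a1 := value_ge0 (conv S B h w).
  suff : - Ivw - q * (b * (k * M + 1)) * W1 <= vform (traj h x (fun=> v)) (conv S B h w).
    by lra.
  rewrite vform_conv//.
  have [z hz] := vform_riesz (traj h x (fun=> v)).
  have bz : bm (fun s => vform (traj h x (fun=> v)) (S (h - s) (B (w s)))).
    under eq_fun do rewrite hz.
    exact: (pw_bm_ip (pw_cst z) (pw_conv hS hB h pw_)).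
  rewrite /W1 /Ivw -riZ// -mulN1r -riZ// -riB; [|exact: bmZ|exact: bmZ].
  apply: ri_le => [||s s0 sh]; [by apply: bmB; exact: bmZ|exact: bz|].
  rewrite -/v -/(w s).
  have c1 : nm (traj h x (fun=> v) - x) <= q.
    have := hd2 h; rewrite add0r hd2' (ltW h0) => /(_ isT).
    by rewrite (traj_neg hS hB (t := 0)).
  have hsh : h - s <= h by rewrite lerBlDr lerDl ltW.
  have Ss := hM (h - s) (le_trans hsh h1).
  have c2 : nm (S (h - s) (B (w s))) <= M * (b * nm (w s)).
    by apply: le_trans (blin_nm Ss _) _; rewrite ler_wpM2l ?(blin_nm hB).
  have c3 := vform_nm (traj h x (fun=> v) - x) (S (h - s) (B (w s))).
  have c4 : k * nm (traj h x (fun=> v) - x) * nm (S (h - s) (B (w s))) <=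
      k * q * (M * (b * nm (w s))).
    apply: ler_pM => //; [|exact: nm_ge0|by rewrite ler_pM2l].
    by apply: mulr_ge0 (nm_ge0 _); exact: ltW.
  have c5 := hd1 (h - s) (B (w s)); rewrite subr_ge0 sh (le_trans hsh hd1') in c5.
  have {}c5 := c5 isT.
  have c6 : q * nm (B (w s)) <= q * (b * nm (w s)).
    by rewrite ler_pM2l// (blin_nm hB).
  have c7 := feedbackE x (w s).
  rewrite -/v in c7.
  rewrite vformD vformN in c3; rewrite vformDr vformNr in c5.
  move: c3 c5; rewrite !ler_norml => /andP[c3 _] /andP[c5 _].
  move: c3 c4 c5 c6; rewrite c7.
  move: (vform _ _) (vform _ _) (vform _ _) => f1 f2 f3.
  move: (nm (B _)) (nm (S _ _)) (nm (_ - x)) (nm (w s)) => n1 n2 n3 n4; lra.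
(* Running cost plus terminal value is at least [value x] for the constant control and at most
   [value x + q ^+ 2 * h] for [u]; comparing the two leaves a bound on [W2]. *)
have step3 := value_flow_le x (ltW h0) pv.
have step4 := near_opt_head (h := h) ou; rewrite ht (ltW h0) in step4.
have {}step4 := step4 isT.
have W2le : W2 <= q ^+ 2 * h + q * D * W1.
  have g1 : 2 * Y * C * W1 * h <= 2 * Y * C * W1 * q.
    by rewrite ler_wpM2l// !mulr_ge0.
  have g2 : 0 <= q * W1 by rewrite mulr_ge0// ltW.
  move: step1 step2 step3 step4 g1 g2; rewrite /D.
  move: (cost _ _ _) (cost _ _ _) (value _) (value _) (value _) => c1 c2 c3 c4 c5; lra.
by rewrite -qD; exact: sq_absorb W12 W2le.
Qed.

(** The convolution depends on the control through the integral of its norm, by [conv_bound], so the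
    integral estimate of [near_opt_feedback] suffices and no pointwise information on controls near
    time zero is required. *)
Lemma opt_traj_expansion x e : 0 < e -> exists2 d, 0 < d & forall h, 0 <= h <= d ->
  nm (opt_traj h x - S h x - h *: B (feedback x)) <= e * h.
Proof.
move=> e0.
have [C C0 hC] := conv_bound hS hB 1.
have e1 : 0 < e / (4 * (C + 1)) by rewrite divr_gt0// mulr_gt0//; lra.
have [d1 d10 hd1] := near_opt_feedback x e1.
have e4 : 0 < e / 4 by lra.
have [d2 d20 hd2] := conv_cst_expansion (feedback x) e4.
exists (Num.min 1 (Num.min d1 d2)) => [|h]; first by rewrite !lt_min ltr01 d10.
rewrite !le_min => /andP[h0 /and3P[h1 h11 h2]].
move: h0; rewrite le_eqVlt => /orP[/eqP <-|h0].
  by rewrite (sg_neg hS)// opt_traj_neg// scale0r subr0 subrr nm0 mulr0.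
have [|d3 d30 hd3] := hd1 h; first by rewrite h0.
have eh : 0 < e / 4 * h by rewrite mulr_gt0.
have [d4 d40 hd4] := opt_trajP h x eh.
have m0 : 0 < Num.min d3 d4 by rewrite lt_min d30.
have [t1 t10 g] := near_opt_exists x m0.
have [|u ou] := g (Num.max h t1); first by rewrite le_max lexx orbT.
have ht : h <= Num.max h t1 by rewrite le_max lexx.
have k1 := hd3 _ u ht (near_opt_le ou _); rewrite ge_min lexx in k1.
have {}k1 := k1 isT.
have k2 := hd4 _ u ht (near_opt_le ou _); rewrite ge_min lexx orbT in k2.
have {}k2 := k2 isT.
have [_ pu _] := ou; have pv := @pw_cst _ _ (feedback x).
have k3 := hC h _ (pwB pu pv) h1.
have k4 := hd2 h; rewrite (ltW h0) h2 in k4; have {}k4 := k4 isT.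
have k5 : C * ri 0 h (fun s => nm (u s - feedback x)) <= e / 4 * h.
  apply: le_trans (ler_wpM2l C0 k1) _.
  rewrite (_ : C * (e / (4 * (C + 1)) * h) = e / 4 * h * (C / (C + 1))); last first.
    by field; rewrite gt_eqF//; lra.
  by rewrite ler_piMr ?(ltW eh)// ler_pdivrMr; lra.
have -> : opt_traj h x - S h x - h *: B (feedback x) =
    (opt_traj h x - traj h x u) + conv S B h (fun s => u s - feedback x) +
    (conv S B h (fun=> feedback x) - h *: B (feedback x)).
  have -> : conv S B h (fun s => u s - feedback x) =
      conv S B h u - conv S B h (fun=> feedback x).
    rewrite -[X in _ - X]scale1r -scaleNr -(convZ hS hB)// -(convD hS hB)//.
      by congr conv; apply/funext => s; rewrite scaleN1r.
    exact: pwZ.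
  by rewrite trajE opprD !addrA !subrK.
apply: le_trans (nmD _ _) _; apply: le_trans (lerD (nmD _ _) (lexx _)) _.
rewrite (nm_distC (opt_traj h x)).
move: k2 k3 k4 k5 eh; nm_lra.
Qed.

Lemma opt_traj_semigroup : semigroup opt_traj.
Proof.
split.
- move=> t; have [|M M0 hM] := @opt_traj_bounded (Num.max t 0).
    by rewrite le_max lexx orbT.
  exists M; split=> [x y|a x||x]; [exact: opt_trajD|exact: opt_trajZ|exact: ltW|].
  by apply: hM; rewrite le_max lexx.
- exact: opt_traj_neg.
- by move=> s t x; exact: opt_traj_add.
- move=> x e e0.
  have [d1 d10 hd1] := opt_traj_expansion x ltr01.
  have [|d2 d20 hd2] := sg_cont hS x (e := e / 2); first by lra.
  pose D := 1 + nm (B (feedback x)); have D0 : 0 < D by rewrite ltr_wpDr// nm_ge0.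
  exists (Num.min (Num.min d1 d2) (e / (2 * D))).
    by rewrite !lt_min d10 d20 divr_gt0// mulr_gt0.
  move=> h; rewrite !le_min => /andP[h0 /andP[/andP[h1 h2] h3]].
  have k1 := hd1 h; rewrite h0 h1 in k1; have {}k1 := k1 isT.
  have k2 := hd2 h; rewrite h0 h2 in k2; have {}k2 := k2 isT.
  have k3 : h * D <= e / 2.
    by rewrite -ler_pdivlMr// (_ : e / 2 / D = e / (2 * D))//; field; rewrite gt_eqF.
  have -> : opt_traj h x - x = (opt_traj h x - S h x - h *: B (feedback x)) +
     (S h x - x) + h *: B (feedback x).
    by rewrite (addrAC _ _ (h *: _)) subrK addrA subrK.
  apply: le_trans (nmD _ _) _; apply: le_trans (lerD (nmD _ _) (lexx _)) _.
  rewrite nmZ ger0_norm//; move: k1 k2 k3; rewrite /D; nm_lra.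
Qed.

(** Meant for multiplication by a scalar of modulus one, which is an isometry of the underlying real
    spaces commuting with [S] and [B]. *)
Definition symmetry (mX : X -> X) (mU : U -> U) : Prop :=
  [/\ blin mX 1, blin mU 1, (forall x y, ip (mX x) (mX y) = ip x y) /\
      (forall z z', ip (mU z) (mU z') = ip z z'),
      forall t x, S t (mX x) = mX (S t x) & forall z, B (mU z) = mX (B z)].

(** * Equivariance of the value, the closed loop and the feedback *)

Section Symmetry.
Variables (mX : X -> X) (mU : U -> U).
Hypothesis sym : symmetry mX mU.

Let pw_mU u : pw u -> pw (fun s => mU (u s)).
Proof. by case: sym => _ /pw_blin h _ _ _; exact: h. Qed.

Let nm_mX x : nm (mX x) = nm x.
Proof.
case: sym => _ _ [h _] _ _; apply/eqP.
by rewrite -(eqrXn2 (n := 2)) ?nm_ge0// !nm_sq h.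
Qed.

Let nm_mU z : nm (mU z) = nm z.
Proof.
case: sym => _ _ [_ h] _ _; apply/eqP.
by rewrite -(eqrXn2 (n := 2)) ?nm_ge0// !nm_sq h.
Qed.

Lemma traj_symmetry t x u : pw u -> traj t (mX x) (fun s => mU (u s)) = mX (traj t x u).
Proof.
case: sym => mXl mUl _ hc hBm pu; rewrite !trajE (blinD mXl) hc; congr (_ + _).
rewrite !convE -(pint_blin _ _ mXl); last exact: (pw_conv hS hB).
by apply: pint_ext => s _ _; rewrite hBm hc.
Qed.

Lemma pcost_symmetry t x u : pw u -> pcost t (mX x) (fun s => mU (u s)) = pcost t x u.
Proof.
move=> pu; rewrite !pcostE traj_symmetry// nm_mX; congr (_ + _); rewrite !costE.
by apply: ri_ext => s _ _; rewrite traj_symmetry// nm_mX nm_mU.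
Qed.

Lemma value_symmetry_le x : value (mX x) <= value x.
Proof.
apply: le_addeps => e e0; have [t t0 /(_ t (lexx _))[u [_ pu hu]]] := near_opt_exists x e0.
by apply: le_trans (value_le _ t0 (pw_mU pu)) _; rewrite pcost_symmetry.
Qed.

End Symmetry.

Section SymmetryInverse.
Variables (mX mX' : X -> X) (mU mU' : U -> U).
Hypotheses (sym : symmetry mX mU) (sym' : symmetry mX' mU').
Hypotheses (mXK : cancel mX mX') (mUK : cancel mU' mU).

Lemma value_symmetry x : value (mX x) = value x.
Proof.
apply/eqP; rewrite eq_le (value_symmetry_le sym)/=.
by rewrite -{1}(mXK x) (value_symmetry_le sym').
Qed.

Lemma opt_traj_symmetry t x : opt_traj t (mX x) = mX (opt_traj t x).
Proof.
have [mXl mUl _ _ _] := sym.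
apply: opt_traj_unique => e e0; have [d d0 hd] := opt_trajP t x e0.
have m0 : 0 < Num.min d e by rewrite lt_min d0.
have [t1 t10 g] := near_opt_exists x m0.
have [|u ou] := g (Num.max t t1); first by rewrite le_max lexx orbT.
have tt : t <= Num.max t t1 by rewrite le_max lexx.
have [tm pu hu] := ou.
exists (Num.max t t1), (fun s => mU (u s)); split=> //.
  split=> //; first exact: (pw_blin mUl).
  rewrite (pcost_symmetry sym)// value_symmetry; apply: (le_trans hu).
  by rewrite lerD2l ge_min lexx orbT.
rewrite (traj_symmetry sym)// -(blinB mXl); apply: le_trans (blin_nm mXl _) _.
by rewrite mul1r; apply: hd tt (near_opt_le ou _); rewrite ge_min lexx.
Qed.

Lemma feedback_symmetry x : feedback (mX x) = mU (feedback x).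
Proof.
have [mXl _ [_ hU] _ hBm] := sym.
apply: ip_inj => z; rewrite -(mUK z) hU !feedbackE hBm; congr (- _).
by rewrite /vform -(blinD mXl) -(blinB mXl) !value_symmetry.
Qed.

End SymmetryInverse.

End ValueFunction.

(** The third clause encodes the perturbed generator without mentioning domains, in a form that
    passes directly to difference quotients. The fourth is there to recover complex linearity. *)
Theorem bounded_closed_loop (R : realType) (X U : hilb R) (S : R -> X -> X)
    (B : U -> X) (b : R) :
  semigroup S -> blin B b -> approx_null_controllable S B ->
  exists (K : X -> U) (SK : R -> X -> X),
  [/\ exists c, blin K c,
      semigroup SK /\ (exists M, forall t x, nm (SK t x) <= M * nm x),
      forall x e, 0 < e -> exists2 d, 0 < d & forall h, 0 <= h <= d ->
        nm (SK h x - S h x - h *: B (K x)) <= e * h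
    & forall mX mX' mU mU', symmetry S B mX mU -> symmetry S B mX' mU' ->
        cancel mX mX' -> cancel mU' mU ->
        (forall t x, SK t (mX x) = mX (SK t x)) /\
        forall x, K (mX x) = mU (K x)].
Proof.
move=> hS hB /(null_cost hS hB)[T [k [T0 k0 hext]]].
exists (feedback S B k), (opt_traj S B k); split.
- by exists (k * b); exact: (feedback_blin hS hB T0 k0 hext).
- split; first exact: (opt_traj_semigroup hS hB T0 k0 hext).
  exact: (opt_traj_uniform_bound hS hB T0 k0 hext).
- exact: (opt_traj_expansion hS hB T0 k0 hext).
- move=> mX mX' mU mU' sym sym' mXK mUK; split.
    exact: (opt_traj_symmetry hS hB T0 k0 hext sym sym').
  exact: (feedback_symmetry hS hB T0 k0 hext sym sym').
Qed.

(** * Real and complex scalars *)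

Section Scalars.
Variables (R : realType) (c : scalar_kind).
Notation K := (scalar_field R c).
Notation r2s := (@scalar_of_real R c).
Implicit Types (a b : R) (z : K).

Lemma r2sD a b : r2s (a + b) = r2s a + r2s b.
Proof. by case: c => //=; simpc. Qed.

Lemma r2sM a b : r2s (a * b) = r2s a * r2s b.
Proof. by case: c => //=; simpc. Qed.

Lemma r2s1 : r2s 1 = 1. Proof. by case: c. Qed.

Lemma r2s0 : r2s 0 = 0. Proof. by case: c. Qed.

Lemma r2s_le a b : (r2s a <= r2s b) = (a <= b).
Proof. by case: c => //=; rewrite lecR. Qed.

Lemma r2s_lt a b : (r2s a < r2s b) = (a < b).
Proof. by case: c => //=; rewrite ltcR. Qed.

Lemma r2s_inj : injective r2s.
Proof. by case: c => //= a b [->]. Qed.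

Lemma r2sV a : r2s a^-1 = (r2s a)^-1.
Proof.
have [->|a0] := eqVneq a 0; first by rewrite invr0 r2s0 invr0.
have ra0 : r2s a != 0 by rewrite -r2s0 (inj_eq r2s_inj).
by apply: (mulfI ra0); rewrite -r2sM !divff ?r2s1.
Qed.

Lemma r2sK a : scalar_re (r2s a) = a. Proof. by case: c. Qed.

Lemma scalar_reD z z' : scalar_re (z + z') = scalar_re z + scalar_re z'.
Proof. by move: z z'; case: c => //= -[? ?] [? ?]. Qed.

Lemma scalar_re_r2sM a z : scalar_re (r2s a * z) = a * scalar_re z.
Proof. by move: z; case: c => //= -[p q] /=; rewrite mul0r subr0. Qed.

Lemma scalar_re_conj z : scalar_re (scalar_conj z) = scalar_re z.
Proof. by move: z; case: c => //= -[p q]. Qed.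

Lemma ge0_r2s z : 0 <= z -> z = r2s (scalar_re z).
Proof.
move: z; case: c => //= -[p q] /=.
by rewrite lecE /= => /andP[/eqP -> _].
Qed.

Lemma normr_r2s a : `|r2s a| = r2s `|a|.
Proof.
case: c => //=; rewrite normc_def/= expr0n addr0 sqrtr_sqr //.
Qed.

End Scalars.

Section RealNorm.
Variables (R : realType) (c : scalar_kind) (X : normedModType (scalar_field R c)).
Notation r2s := (@scalar_of_real R c).
Implicit Types (x y : X).

Lemma normr_rnorm x : `|x| = r2s (rnorm x).
Proof. exact: ge0_r2s. Qed.

Lemma rnorm_ge0 x : 0 <= rnorm x.
Proof. by rewrite -(r2s_le c) r2s0 -normr_rnorm. Qed.

Lemma rnorm_eq0 x : rnorm x = 0 -> x = 0.
Proof. by move=> x0; apply/normr0_eq0; rewrite normr_rnorm x0 r2s0. Qed.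

Lemma rnorm_unit z x : `|z| = 1 -> rnorm (z *: x) = rnorm x.
Proof. by move=> z1; rewrite /rnorm normrZ z1 mul1r. Qed.

End RealNorm.

(** A separate name for the same carrier keeps the module structure over [R] apart from the one over
    [scalar_field R c]. *)
Definition realified (R : realType) (c : scalar_kind)
  (X : normedModType (scalar_field R c)) : Type := X.

Section Realified.
Variables (R : realType) (c : scalar_kind) (X : normedModType (scalar_field R c)).
Notation r2s := (@scalar_of_real R c).

HB.instance Definition _ := GRing.Zmodule.on (realified X).

Let rscale (a : R) (x : realified X) : realified X := r2s a *: (x : X).

Let rscaleA a b x : rscale a (rscale b x) = rscale (a * b) x.
Proof. by rewrite /rscale scalerA r2sM. Qed.

Let rscale1 : left_id 1 rscale.
Proof. by move=> x; rewrite /rscale r2s1 scale1r. Qed.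

Let rscaleDr : right_distributive rscale +%R.
Proof. by move=> a x y; rewrite /rscale scalerDr. Qed.

Let rscaleDl x : {morph rscale^~ x : a b / a + b}.
Proof. by move=> a b; rewrite /rscale r2sD scalerDl. Qed.

HB.instance Definition _ := GRing.Zmodule_isLmodule.Build R (realified X)
  rscaleA rscale1 rscaleDr rscaleDl.

Lemma realified_scaleE (a : R) (x : realified X) : a *: x = r2s a *: (x : X).
Proof. by []. Qed.

End Realified.

Section RealHilbert.
Variables (R : realType) (c : scalar_kind) (X : completeNormedModType (scalar_field R c)).
Hypothesis hX : hilbert X.
Notation r2s := (@scalar_of_real R c).

Let dot := sval (cid hX).
Let dotE (x : X) : `|x| ^+ 2 = dot x x := svalP (cid hX) x.

Let rip (x y : realified X) : R := scalar_re (dot x y).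

Let ripDl (x y z : realified X) : rip (x + y) z = rip x z + rip y z.
Proof. by rewrite /rip linearDl scalar_reD. Qed.

Let ripZl a (x z : realified X) : rip (a *: x) z = a * rip x z.
Proof. by rewrite /rip realified_scaleE linearZl_LR scalar_re_r2sM. Qed.

Let ripC (x y : realified X) : rip x y = rip y x.
Proof. by rewrite /rip (hermitian_subproof (s := dot) (x : X) (y : X)) expr0 mul1r scalar_re_conj. Qed.

Let rip_norm (x : realified X) : rip x x = rnorm (x : X) ^+ 2.
Proof. by rewrite /rip -dotE normr_rnorm expr2 -r2sM r2sK. Qed.

Let rip_ge0 (x : realified X) : 0 <= rip x x.
Proof. by rewrite rip_norm sqr_ge0. Qed.

Let rip_eq0 (x : realified X) : rip x x = 0 -> x = 0.
Proof.
by rewrite rip_norm => /eqP; rewrite sqrf_eq0 => /eqP/rnorm_eq0.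
Qed.

Let rip_complete (u : nat -> realified X) :
  (forall e, 0 < e -> exists N, forall m n, (N <= m)%N -> (N <= n)%N ->
     rip (u m - u n) (u m - u n) <= e) ->
  exists l, forall e, 0 < e -> exists N, forall n, (N <= n)%N ->
     rip (u n - l) (u n - l) <= e.
Proof.
move=> cu.
have : cvg ((u : nat -> X) @ \oo).
  apply: cauchy_cvg; apply: cauchy_exP => e e0.
  have eE := ge0_r2s (ltW e0); have e'0 : 0 < scalar_re e.
    by rewrite -(r2s_lt c) r2s0 -eE.
  have [|N hN] := cu ((scalar_re e / 2) ^+ 2).
    by rewrite exprn_gt0// divr_gt0.
  exists (u N); exists N => // n /= Nn.
  rewrite -ball_normE /ball_/= normr_rnorm eE r2s_lt.
  have := hN N n (leqnn _) Nn.
  have e2 : 0 <= scalar_re e / 2 by lra.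
  rewrite rip_norm ler_sqr ?nnegrE ?rnorm_ge0// => h.
  by apply: le_lt_trans h _; lra.
move=> /cvg_ex[l /cvgrPdist_lt hl]; exists l => e e0.
have se : 0 < Num.sqrt e by rewrite sqrtr_gt0.
have [|N _ hN] := hl (r2s (Num.sqrt e)); first by rewrite -(r2s0 R c) r2s_lt.
exists N => n Nn; rewrite rip_norm -[leRHS](sqr_sqrtr (ltW e0)).
rewrite ler_sqr ?nnegrE ?rnorm_ge0 ?ltW//.
have := hN n Nn; rewrite /= normr_rnorm r2s_lt.
suff -> : rnorm (u n - l : X) = rnorm (l - u n : X) by [].
by rewrite /rnorm (distrC (u n : X) l).
Qed.

Definition real_hilb : hilb R :=
  Hilb ripDl ripZl ripC rip_ge0 rip_eq0 rip_complete.

Lemma nm_rnorm (x : real_hilb) : nm x = rnorm (x : X).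
Proof.
apply/eqP; rewrite -(eqrXn2 (n := 2)) ?nm_ge0 ?rnorm_ge0// nm_sq.
by rewrite -rip_norm.
Qed.

End RealHilbert.

(** * Measurable controls *)

Section LowerIntegral.
Variable R : realType.
Notation mu := (@lebesgue_measure R).
Local Open Scope ereal_scope.

(* No measurability is needed: the integral of a nonnegative function is the
   supremum of the integrals of the simple functions below it. *)
Lemma ge0_le_lower_integral (D : set R) (f g : R -> \bar R) :
  (forall x, D x -> 0 <= f x) -> (forall x, D x -> f x <= g x) ->
  \int[mu]_(x in D) f x <= \int[mu]_(x in D) g x.
Proof.
move=> f0 fg; have g0 x : D x -> 0 <= g x by move=> Dx; exact: le_trans (f0 _ Dx) (fg _ Dx).
rewrite !ge0_integralE//; apply: ereal_sup_le => _ [h /= hf <-].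
exists h => //= x; apply: (le_trans (hf x)).
by rewrite /patch; case: ifPn => // /set_mem; exact: fg.
Qed.

(** Since [f] is not assumed measurable, additivity of the integral is applied to the positive part
    of [a - b] off [N], a measurable function that lies below [f]. *)
Lemma ae_le_lower_integral (D N : set (measurableTypeR R)) (a b f : R -> R) :
  measurable D -> measurable N -> mu N = 0 ->
  measurable_fun D a -> measurable_fun D b ->
  (forall t, D t -> (0 <= a t)%R) -> (forall t, D t -> (0 <= b t)%R) ->
  (forall t, D t -> (0 <= f t)%R) ->
  (forall t, D t -> ~ N t -> (a t <= b t + f t)%R) ->
  \int[mu]_(t in D) (a t)%:E <= \int[mu]_(t in D) (b t)%:E + \int[mu]_(t in D) (f t)%:E.
Proof.
move=> mD mN N0 ma mb a0 b0 f0 abf.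
pose h t : R := if t \in N then 0%R else Num.max (a t - b t)%R 0%R.
have h0 t : (0 <= h t)%R by rewrite /h; case: ifP => // _; rewrite le_max lexx orbT.
have mh : measurable_fun D h.
  apply: measurable_fun_if => //.
  - apply: (measurable_fun_bool true).
    rewrite (_ : _ `&` _ = D `&` N); first exact: measurableI.
    apply/seteqP; split=> t [Dt] /= Nt; split=> //; first exact: set_mem.
    exact: mem_set.
  - apply: (measurable_funS mD); first by move=> t [].
    by apply: measurable_maxr => //; exact: measurable_funB.
have hf : \int[mu]_(t in D) (h t)%:E <= \int[mu]_(t in D) (f t)%:E.
  apply: ge0_le_lower_integral => t Dt; rewrite lee_fin// /h.
  case: ifPn => [_|/negP tN]; first exact: f0.
  rewrite ge_max f0// andbT lerBlDl; apply: abf => //.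
  by move=> Nt; apply: tN; exact: mem_set.
apply: (@le_trans _ _ (\int[mu]_(t in D) (b t + h t)%:E)); last first.
  under eq_integral do rewrite EFinD.
  rewrite ge0_integralD//=; first exact: leeD2l hf.
  - exact/measurable_EFinP.
  - by move=> t Dt; rewrite lee_fin.
  - exact/measurable_EFinP.
apply: ae_ge0_le_integral => //.
- exact/measurable_EFinP.
- by move=> t Dt; rewrite lee_fin addr_ge0// b0.
- by apply/measurable_EFinP; exact: measurable_funD.
exists N; split=> // t /= Ht; apply: contrapT => tN; apply: Ht => Dt.
rewrite lee_fin /h; case: ifPn => [/set_mem//|_].
by rewrite -lerBlDl le_max lexx.
Qed.

End LowerIntegral.

Section SimpleApproximation.
Variable R : realType.
Notation mu := (@lebesgue_measure R).

Lemma ri_EFin (T : R) (f : R -> R) : bm f ->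
  (ri 0 T f)%:E = (\int[mu]_(t in `]0%R, T[%classic) (f t)%:E)%E.
Proof.
move=> bf; have bi := bm_integrable 0 T bf; have [mf _] := bf.
rewrite riE /Rintegral fineK; last exact: (integrable_fin_num _ bi).
symmetry; apply: integral_itv_bndo_bndc.
by apply/measurable_EFinP; exact: measurable_funTS.
Qed.

Lemma pw_simple (U : hilb R) (s : R -> U) : simple_function s -> pw s.
Proof.
move=> hs; exists (hsort U), s, (fun y _ => y).
by split=> // y; exact: econt_cst.
Qed.

(** The approximants are kept only where their norm is at most twice that of [u], and are set to
    zero elsewhere. Where [u] is nonzero this eventually changes nothing; everywhere it bounds the
    energy by four times that of [u], independently of [e], and provides the domination for
    convergence in mean. *)
Lemma simple_approximation (U : hilb R) (T : R) (u : R -> U) (s : nat -> R -> U)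
    (N : set (measurableTypeR R)) :
  (forall n, simple_function (s n)) -> measurable N -> mu N = 0%E ->
  (forall t, 0 < t < T -> ~ N t -> forall e, 0 < e ->
     exists n0, forall n, (n0 <= n)%N -> nm (s n t - u t) <= e) ->
  (\int[mu]_(t in `]0%R, T[%classic) (nm (u t) ^+ 2)%:E < +oo)%E ->
  exists C, forall e, 0 < e -> exists (p : R -> U) (d : R -> R),
    [/\ simple_function p, ri 0 T (fun t => nm (p t) ^+ 2) <= C,
        measurable_fun setT d /\ (forall t, 0 <= d t),
        (forall t, 0 < t < T -> ~ N t -> nm (p t - u t) <= d t)
      & (\int[mu]_(t in `]0%R, T[%classic) (d t)%:E <= e%:E)%E].
Proof.
move=> ss mN N0 su u2.
pose D : set (measurableTypeR R) := `]0, T[%classic.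
have mD : measurable D by exact: measurable_itv.
pose G : set (measurableTypeR R) := D `\` N.
have mG : measurable G by exact: measurableD.
have su' t : G t -> forall e, 0 < e ->
     exists n0, forall n, (n0 <= n)%N -> nm (s n t - u t) <= e.
  by move=> [Dt Nt]; apply: su => //; move: Dt; rewrite /D/= in_itv.
have inG t : t \in G -> G t by exact: set_mem.
have indG t : G t -> \1_G t = 1 :> R by move=> Gt; rewrite indicE mem_set.
have indGN t : ~ G t -> \1_G t = 0 :> R by move=> Gt; rewrite indicE memNset.
pose g t := nm (u t) * \1_G t.
have mgen (q : nat -> R -> R) (f : R -> R) :
    (forall n, measurable_fun setT (q n)) ->
    (forall t, G t -> forall e, 0 < e -> exists n0, forall n, (n0 <= n)%N ->
       `|q n t - f t| <= e) ->
    measurable_fun [set: measurableTypeR R] (fun t => f t * \1_G t).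
  move=> mq qf; apply: (@measurable_fun_cvg _ _ _ _ (fun n t => q n t * \1_G t)).
    by move=> n; apply: measurable_funM => //; exact: measurable_indic.
  move=> t _; have [Gt|Gt] := pselect (G t); last first.
    by rewrite indGN// mulr0; under eq_fun do rewrite mulr0; exact: cvg_cst.
  rewrite indG// mulr1; under eq_fun do rewrite mulr1.
  apply/cvgrPdist_le => e e0; have [n0 hn0] := qf t Gt e e0.
  by exists n0 => // n /= /hn0; rewrite distrC.
have mg : measurable_fun setT g.
  apply: (mgen (fun n t => nm (s n t))) => [n|t Gt e e0].
    by have [] := pw_bm_nm (pw_simple (ss n)).
  have [n0 hn0] := su' t Gt e e0; exists n0 => n /hn0; apply: le_trans.
  exact: nm_dist.
have g0 t : 0 <= g t by rewrite mulr_ge0// nm_ge0.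
pose b n t := (t \in G) && (nm (s n t) <= 2 * g t).
pose p n t : U := if b n t then s n t else 0.
have sp n : simple_function (p n).
  have -> : p n = (fun y => if y.2 then y.1 else 0) \o (fun t => (s n t, b n t)).
    by apply/funext.
  apply/simple_function_comp/simple_function_pair => //.
  apply: simple_function_measurable.
  rewrite (_ : [set t | b n t] = G `&` [set t | nm (s n t) <= 2 * g t]); last first.
    apply/seteqP; split=> t /=; rewrite /b; first by move=> /andP[/inG].
    by move=> [Gt ->]; rewrite mem_set.
  have -> : [set t | nm (s n t) <= 2 * g t] =
      (fun t => 2 * g t - nm (s n t)) @^-1` `[0, +oo[.
    by apply/seteqP; split=> t /=; rewrite in_itv/= andbT subr_ge0.
  apply: measurableI => //; rewrite -[X in measurable X]setTI.
  have mh : measurable_fun setT (fun t => 2 * g t - nm (s n t)).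
    apply: measurable_funB; first by apply: measurable_funM => //; exact: measurable_cst.
    by have [] := pw_bm_nm (pw_simple (ss n)).
  exact: mh.
have pg n t : nm (p n t) <= 2 * g t.
  rewrite /p; case: ifP => [/andP[]//|_]; rewrite nm0 mulr_ge0//.
have pu t : G t -> forall e, 0 < e ->
    exists n0, forall n, (n0 <= n)%N -> nm (p n t - u t) <= e.
  move=> Gt e e0; have gE : g t = nm (u t) by rewrite /g indG// mulr1.
  have [u0|u0] := eqVneq (nm (u t)) 0.
    exists 0%N => n _; rewrite (nm_eq0 u0) subr0; apply: le_trans (pg n t) _.
    by rewrite gE u0 mulr0 ltW.
  have up : 0 < nm (u t) by rewrite lt_neqAle eq_sym u0 nm_ge0.
  have [n0 hn0] := su' t Gt _ up; have [n1 hn1] := su' t Gt e e0.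
  exists (maxn n0 n1) => n; rewrite geq_max => /andP[/hn0 h0 /hn1 h1].
  rewrite /p /b mem_set//= ifT// gE.
  by have := nm_subl (s n t) (u t); lra.
(* As [u] is only a limit of simple functions, the distance to it is shown to be Borel as the limit
   in [m] of the distances from [p n] to [p m]. *)
pose d n t := nm (p n t - u t) * \1_G t.
have md n : measurable_fun setT (d n).
  apply: (mgen (fun m t => nm (p n t - p m t))) => [m|t Gt e e0].
    by have [] := pw_bm_nm (pwB (pw_simple (sp n)) (pw_simple (sp m))).
  have [n0 hn0] := pu t Gt e e0; exists n0 => m /hn0; apply: le_trans.
  apply: le_trans (nm_dist _ _) _.
  rewrite [X in nm X](_ : _ = - (p m t - u t)) ?nmN//.
  by rewrite !opprB addrC addrA subrK.
have d0 n t : 0 <= d n t by rewrite mulr_ge0// nm_ge0.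
have dg n t : d n t <= 3 * g t.
  rewrite /d; have [Gt|Gt] := pselect (G t); last first.
    by rewrite indGN// mulr0 mulr_ge0.
  rewrite indG// mulr1; apply: le_trans (nmB _ _) _.
  by have := pg n t; rewrite /g indG// mulr1; lra.
have g2u : (\int[mu]_(t in D) (g t ^+ 2)%:E <= \int[mu]_(t in D) (nm (u t) ^+ 2)%:E)%E.
  apply: ge0_le_lower_integral => t Dt; rewrite lee_fin ?sqr_ge0//.
  rewrite ler_sqr ?nnegrE ?nm_ge0// /g indicE.
  by case: (_ \in _); rewrite ?mulr1// mulr0 nm_ge0.
have ig2 : mu.-integrable D (EFin \o (fun t => g t ^+ 2)).
  apply/integrableP; split.
    by apply/measurable_EFinP; apply: measurable_funTS; exact: measurable_funX.
  under eq_integral do rewrite /= ger0_norm ?sqr_ge0//.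
  exact: le_lt_trans u2.
have i1 : mu.-integrable D (EFin \o cst (1:R)).
  apply: measurable_bounded_integrable => //.
    by rewrite /= lebesgue_measure_itv/=; case: ifPn => // _; rewrite -EFinB ltry.
  exact: bounded_cst.
exists (4 * fine (\int[mu]_(t in D) (g t ^+ 2)%:E)%E) => e e0.
have cvd : (\int[mu]_(t in D) (d n t)%:E)%E @[n --> \oo] --> 0%E.
  have -> : 0%E = (\int[mu]_(t in D) (cst 0 t))%E by rewrite integral0.
  (* From [d n t <= 3 * g t] and [g t <= 1 + g t ^+ 2]: on a bounded interval, square integrability
     gives an integrable majorant. *)
  apply: (@dominated_cvg _ _ _ _ _ mD _ _ (fun t => (3 * (1 + g t ^+ 2))%:E)).
  - by move=> n; apply/measurable_EFinP; exact: measurable_funTS.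
  - move=> t Dt; apply/fine_cvgP; split; first exact: nearW.
    apply/cvgrPdist_le => r r0; rewrite /comp/= /d.
    have [Gt|Gt] := pselect (G t); last first.
      by apply: nearW => n; rewrite indGN// mulr0 subrr normr0 ltW.
    have [n0 hn0] := pu t Gt r r0; exists n0 => // n /= /hn0.
    by rewrite indG// mulr1 sub0r normrN ger0_norm// nm_ge0.
  - by [].
  - have := integrableZl mD 3 (integrableD mD i1 ig2); exact: eq_integrable.
  - move=> n t Dt /=; rewrite ger0_norm// lee_fin; apply: (le_trans (dg n t)).
    by have := sqr_ge0 (g t - 1); have := sqr_ge0 (g t); lra.
have /fine_cvgP[fin_d /cvgrPdist_le/(_ e e0) hd] := cvd.
have [n [fdn hdn]] : exists n, (\int[mu]_(t in D) (d n t)%:E)%E \is a fin_num /\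
    `|0 - fine (\int[mu]_(t in D) (d n t)%:E)%E| <= e.
  by near \oo%classic => n; exists n; split; near: n.
exists (p n), (d n); split => //.
- rewrite -lee_fin ri_EFin; last exact/bmX/pw_bm_nm/pw_simple.
  rewrite EFinM fineK; last exact: (integrable_fin_num _ ig2).
  rewrite -integralZl//; apply: ge0_le_lower_integral => t Dt.
    by rewrite lee_fin sqr_ge0.
  rewrite /= lee_fin.
  rewrite (_ : 4 * g t ^+ 2 = (2 * g t) ^+ 2); last by ring.
  rewrite ler_sqr ?nnegrE ?nm_ge0 ?pg//.
  by rewrite mulr_ge0.
- by split; [exact: md|exact: d0].
- move=> t Dt Nt; have Gt : G t by split=> //; rewrite /D /mkset in_itv.
  by rewrite /d indG// mulr1.
- rewrite -(fineK fdn) lee_fin; move: hdn; rewrite sub0r normrN.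
  exact: le_trans (ler_norm _).
Unshelve. all: by end_near.
Qed.

End SimpleApproximation.

(** * Exponential rescaling *)

Section Rescaling.
Variables (R : realType) (X : hilb R).

Lemma econt_scale (phi : R -> R) (f : R -> X) :
  continuous phi -> econt f -> econt (fun t => phi t *: f t).
Proof.
move=> cphi cf t e e0.
have c1 : 0 < `|phi t| + 1 by have := normr_ge0 (phi t); lra.
have [|d d0 hd] := cf t (Num.min 1 (e / (2 * (`|phi t| + 1)))).
  by rewrite lt_min ltr01 divr_gt0// mulr_gt0.
have c2 : 0 < nm (f t) + 1 by have := nm_ge0 (f t); lra.
have e'0 : 0 < e / (2 * (nm (f t) + 1)) by rewrite divr_gt0// mulr_gt0.
have [d' d'0 hd'] : exists2 d', 0 < d' & forall s, `|s - t| <= d' ->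
    `|phi s - phi t| <= e / (2 * (nm (f t) + 1)).
  have /cvgrPdist_le/(_ _ e'0) := cphi t.
  move=> /nbhs_ballP[d' /= d'0 hd']; exists (d' / 2) => [|s sd]; first by lra.
  rewrite distrC; apply: hd'; rewrite /ball/= distrC; lra.
exists (Num.min d d') => [|s]; first by rewrite lt_min d0.
rewrite le_min => /andP[/hd]; rewrite le_min => /andP[h1 h2] /hd' h3.
have -> : phi s *: f s - phi t *: f t = (phi s - phi t) *: f s + phi t *: (f s - f t).
  by rewrite scalerBl scalerBr addrA subrK.
apply: le_trans (nmD _ _) _; rewrite !nmZ.
have h4 : nm (f s) <= nm (f t) + 1 by have := nm_subl (f s) (f t); lra.
have h5 : `|phi s - phi t| * nm (f s) <= e / (2 * (nm (f t) + 1)) * (nm (f t) + 1).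
  by apply: ler_pM => //; exact: nm_ge0.
have h6 : `|phi t| * nm (f s - f t) <= (`|phi t| + 1) * (e / (2 * (`|phi t| + 1))).
  by apply: ler_pM => //; [exact: nm_ge0|rewrite lerDl].
have h7 : e / (2 * (nm (f t) + 1)) * (nm (f t) + 1) = e / 2 by field; lra.
have h8 : (`|phi t| + 1) * (e / (2 * (`|phi t| + 1))) = e / 2 by field; lra.
lra.
Qed.

Lemma continuous_expR_scale (w : R) : continuous (fun t => expR (w * t)).
Proof.
move=> t; apply: continuous_comp; last exact: continuous_expR.
by apply: continuousM; [exact: cst_continuous|exact: cvg_id].
Qed.

(** [Num.max t 0] preserves the convention that the semigroup is the identity at nonpositive
    times. *)
Definition sg_rescale (w : R) (S : R -> X -> X) (t : R) (x : X) : X :=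
  expR (w * Num.max t 0) *: S t x.

Lemma semigroup_rescale w S : semigroup S -> semigroup (sg_rescale w S).
Proof.
move=> hS; split.
- move=> t; have [C hC] := sg_blin hS t.
  exists (expR (w * Num.max t 0) * C); split=> [x y|a x||x].
  + by rewrite /sg_rescale (blinD hC) scalerDr.
  + by rewrite /sg_rescale (blinZ hC) !scalerA mulrC.
  + by rewrite mulr_ge0 ?expR_ge0// (blin_ge0 hC).
  + by rewrite /sg_rescale nmZ ger0_norm ?expR_ge0// -mulrA ler_wpM2l ?expR_ge0// (blin_nm hC).
- move=> t x t0; rewrite /sg_rescale (sg_neg hS)//.
  by rewrite (max_idPr t0) mulr0 expR0 scale1r.
- move=> s t x s0 t0; rewrite /sg_rescale (sg_add hS)// (sgZ hS) scalerA.
  rewrite !(max_idPl _) ?addr_ge0//.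
  by rewrite -expRD mulrDr.
- move=> x e e0.
  have [d d0 hd] := @econt_scale _ _ (@continuous_expR_scale w) (sg_econt hS x) 0 e e0.
  exists d => // h /andP[h0 hd']; have := hd h.
  rewrite subr0 ger0_norm// => /(_ hd').
  by rewrite /sg_rescale (max_idPl h0) mulr0 expR0 scale1r (sg_neg hS x (lexx 0)).
Qed.

End Rescaling.

(** * Rescaled controls and uniform controllability *)

Section NullControllability.
Variables (R : realType) (X U : hilb R) (S : R -> X -> X) (B : U -> X) (b : R).
Hypotheses (hS : semigroup S) (hB : blin B b).
Variable T : R.
Hypothesis T0 : 0 < T.
Implicit Types (x : X) (u : R -> U).

(** In the convolution the factor e^(w (T - s)) of the semigroup meets e^(w s) of the control,
    leaving the common factor e^(w T). *)
Lemma traj_rescale w x u : pw u ->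
  traj (sg_rescale w S) B T x (fun s => expR (w * s) *: u s) =
  expR (w * T) *: traj S B T x u.
Proof.
move=> pu; rewrite !trajE scalerDr /sg_rescale (max_idPl (ltW T0)); congr (_ + _).
rewrite !convE -pintZ; last exact: (pw_conv hS hB).
apply: pint_ext => s s0 sT; rewrite (blinZ hB) (sgZ hS) scalerA.
by rewrite (max_idPl _) ?subr_ge0// -expRD -mulrDr subrK.
Qed.

Lemma pw_rescale w u : pw u -> pw (fun s => expR (w * s) *: u s).
Proof.
apply: (@pw_map R U U (fun s z => expR (w * s) *: z)) => g cg.
by apply: econt_scale => //; exact: continuous_expR_scale.
Qed.

Lemma energy_rescale w u : 0 <= w -> pw u ->
  energy T (fun s => expR (w * s) *: u s) <= expR (w * T) ^+ 2 * energy T u.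
Proof.
move=> w0 pu; rewrite !energyE -riZ; last exact/bmX/pw_bm_nm.
apply: ri_le => [||s s0 sT].
- exact/bmX/pw_bm_nm/pw_rescale.
- exact/bmZ/bmX/pw_bm_nm.
rewrite nmZ ger0_norm ?expR_ge0// exprMn ler_wpM2r ?sqr_ge0//.
by rewrite ler_sqr ?nnegrE ?expR_ge0// ler_expR ler_wpM2l.
Qed.

(* Baire's theorem makes the energy bound uniform in the initial state. *)
Lemma approx_null_controllable_baire :
  (forall x, exists C, forall e, 0 < e -> exists u,
     [/\ pw u, energy T u <= C & nm (traj S B T x u) <= e]) ->
  approx_null_controllable S B.
Proof.
move=> hx.
pose F (n : nat) x := forall e, 0 < e -> exists u,
     [/\ pw u, energy T u <= n%:R & nm (traj S B T x u) <= e].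
have [M hM] := sg_blin hS T; have M0 := blin_ge0 hM.
have trB x y u v : pw u -> pw v ->
  traj S B T (x - y) (fun s => u s - v s) = traj S B T x u - traj S B T y v.
  exact: (trajB hS hB).
have clF n x : (forall e, 0 < e -> exists2 y, F n y & nm (x - y) <= e) -> F n x.
  move=> h e e0; have [|y Fy xy] := h (e / (2 * (M + 1))).
    by rewrite divr_gt0// mulr_gt0//; lra.
  have [|u [pu hu ht]] := Fy (e / 2); first by lra.
  exists u; split=> //.
  have := nm_subl (traj S B T x u) (traj S B T y u).
  have -> : traj S B T x u - traj S B T y u = S T (x - y).
    by rewrite !trajE (sgB hS) opprD addrACA subrr addr0.
  have := blin_nm hM (x - y); have := ler_wpM2l M0 xy.
  have : M * (e / (2 * (M + 1))) <= e / 2.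
    rewrite (_ : M * (e / (2 * (M + 1))) = e / 2 * (M / (M + 1))); last by field; lra.
    by rewrite ler_piMr ?divr_ge0 ?(ltW e0)// ler_pdivrMr; lra.
  move: ht; nm_lra.
have covF x : exists n, F n x.
  have [C hC] := hx x; exists (Num.truncn C).+1 => e /hC[u [pu hu ht]].
  by exists u; split=> //; apply: (le_trans hu); exact/ltW/truncnS_gt.
have [n [x0 [d [d0 hd]]]] := baire_ball clF covF.
exists T, (4 * n%:R / d ^+ 2); split=> // [|x e e0].
  by rewrite divr_ge0 ?sqr_ge0// mulr_ge0.
have [/nm_eq0 ->|xn0] := eqVneq (nm x) 0.
  exists (fun=> 0); split; first exact: pw_cst.
    rewrite energyE (@ri_ext _ 0 T _ (fun=> 0)) => [|s _ _]; last by rewrite nm0 expr0n.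
    by rewrite ri_cst ?(ltW T0)// mul0r nm0 expr0n mulr0.
  by rewrite (traj_cst0 hS hB) (blin0 hM) nm0 expr0n mulr0.
have nx : 0 < nm x by rewrite lt_neqAle eq_sym xn0 nm_ge0.
(* The state is [x = a *: ((x0 + a^-1 *: x) - x0)], a multiple of a difference of two points of the
   ball. Two controls of energy at most [n%:R] give the constant [4 * n%:R / d ^+ 2], and [r] below
   is chosen so that [(a * (2 * r)) ^+ 2 = e * nm x ^+ 2]. *)
pose a := nm x / d; have a0 : 0 < a by rewrite divr_gt0.
have Fz : F n (x0 + a^-1 *: x).
  apply: hd; rewrite addrC addKr nmZ gtr0_norm ?invr_gt0//.
  by rewrite /a invf_div divfK ?gt_eqF.
have F0 : F n x0 by apply: hd; rewrite subrr nm0 ltW.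
pose r := Num.sqrt e * d / 2; have r0 : 0 < r by rewrite divr_gt0// mulr_gt0// sqrtr_gt0.
have [u [pu hu tu]] := Fz _ r0; have [v [pv hv tv]] := F0 _ r0.
have puv := pwB pu pv.
exists (fun s => a *: (u s - v s)); split; first exact: pwZ.
- rewrite energyE.
  apply: (@le_trans _ _ (a ^+ 2 * (2 * energy T u + 2 * energy T v))).
    rewrite !energyE -!riZ; try exact/bmX/pw_bm_nm.
    have bu := bmZ 2 (bmX 2 (pw_bm_nm pu)); have bv := bmZ 2 (bmX 2 (pw_bm_nm pv)).
    rewrite -riD// -riZ; last exact: bmD.
    apply: ri_le => [||s _ _]; [exact/bmX/pw_bm_nm/pwZ|exact/bmZ/bmD|].
    rewrite nmZ exprMn real_normK ?num_real// ler_wpM2l ?sqr_ge0//.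
    by apply: le_trans (sq_nmD _ _) _; rewrite nmN.
  rewrite (_ : 4 * n%:R / d ^+ 2 * nm x ^+ 2 = a ^+ 2 * (4 * n%:R)); last first.
    by rewrite /a; field; rewrite gt_eqF.
  by rewrite ler_wpM2l ?sqr_ge0//; lra.
- have -> : traj S B T x (fun s => a *: (u s - v s)) =
      a *: (traj S B T (x0 + a^-1 *: x) u - traj S B T x0 v).
    rewrite -trB// -(trajZ hS hB)// (addrC x0) addrK scalerA divff ?gt_eqF// scale1r//.
  rewrite nmZ exprMn real_normK ?num_real//.
  apply: (@le_trans _ _ (a ^+ 2 * (2 * r) ^+ 2)).
    rewrite ler_wpM2l ?sqr_ge0// ler_sqr ?nnegrE ?nm_ge0//; last by lra.
    by apply: le_trans (nmB _ _) _; lra.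
  rewrite (_ : a ^+ 2 * (2 * r) ^+ 2 = Num.sqrt e ^+ 2 * nm x ^+ 2); last first.
    by rewrite /a /r; field; rewrite gt_eqF.
  by rewrite sqr_sqrtr// ltW.
Qed.

End NullControllability.

Lemma approx_null_controllable_rescale (R : realType) (X U : hilb R)
    (S : R -> X -> X) (B : U -> X) (b T w : R) :
  semigroup S -> blin B b -> 0 < T -> 0 <= w ->
  (forall x, exists C, forall e, 0 < e -> exists u,
     [/\ pw u, energy T u <= C & nm (traj S B T x u) <= e]) ->
  approx_null_controllable (sg_rescale w S) B.
Proof.
move=> hS hB T0 w0 hx.
apply: (approx_null_controllable_baire (semigroup_rescale w hS) hB T0) => x.
have [C hC] := hx x; exists (expR (w * T) ^+ 2 * C) => e e0.
have E0 : 0 < expR (w * T) by exact: expR_gt0.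
have [|u [pu hu ht]] := hC (e / expR (w * T)); first by rewrite divr_gt0.
exists (fun s => expR (w * s) *: u s); split; first exact: pw_rescale.
- apply: le_trans (energy_rescale T w0 pu) _.
  by rewrite ler_wpM2l ?sqr_ge0.
- rewrite (traj_rescale hS hB T0)// nmZ gtr0_norm//.
  by rewrite mulrC -ler_pdivlMr.
Qed.

(** * Transfer to the normed spaces *)

Section Topology.
Variables (R : realType) (c : scalar_kind).
Notation K := (scalar_field R c).
Notation r2s := (@scalar_of_real R c).

Lemma cvg_rnormP (V : normedModType K) (I : Type) (F : set_system I)
    (FF : Filter F) (f : I -> V) (l : V) :
  f @ F --> l <-> forall e : R, 0 < e -> \forall t \near F, rnorm (f t - l) <= e.
Proof.
split=> [/cvgrPdist_le fl e e0|h].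
  have /fl : 0 < r2s e by rewrite -(r2s0 R c) r2s_lt.
  apply: filterS => t; rewrite normr_rnorm r2s_le.
  by rewrite /rnorm distrC.
apply/cvgrPdist_le => e e0; have eE := ge0_r2s (ltW e0).
have /h : 0 < scalar_re e by rewrite -(r2s_lt c) r2s0 -eE.
by apply: filterS => t ht; rewrite distrC normr_rnorm eE r2s_le.
Qed.

Lemma at_right0P (P : R -> Prop) :
  (\forall h \near 0^'+, P h) <-> exists2 d, 0 < d & forall h, 0 < h <= d -> P h.
Proof.
split.
  rewrite /at_right /within /= => /nbhs_ballP[d /= d0 hd].
  exists (d / 2) => [|h /andP[h0 hd2]]; first by lra.
  by apply: hd => //; rewrite /ball/= sub0r normrN gtr0_norm//; lra.
move=> [d d0 hd]; rewrite /at_right /within /=; apply/nbhs_ballP.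
exists d => //= h; rewrite /ball/= sub0r normrN => hh h0; apply: hd.
by rewrite h0 /=; move: hh; rewrite gtr0_norm// => /ltW.
Qed.

Variables (V W : completeNormedModType K) (hV : hilbert V) (hW : hilbert W).

Lemma blin_continuous (f : {linear V -> W}) : continuous f ->
  exists C, blin (f : real_hilb hV -> real_hilb hW) C.
Proof.
move=> cf.
have /cvg_rnormP/(_ 1 ltr01) := cf 0.
move=> /nbhs_ballP[e /= e0 he]; have eE := ge0_r2s (ltW e0).
have r0 : 0 < scalar_re e by rewrite -(r2s_lt c) r2s0 -eE.
set r := scalar_re e in eE r0.
have h1 (x : real_hilb hV) : nm x <= r / 2 -> nm (f x : real_hilb hW) <= 1.
  rewrite !nm_rnorm => xr; have := he x; rewrite linear0 subr0; apply.
  rewrite -ball_normE /ball_/= sub0r normrN normr_rnorm eE r2s_lt.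
  by apply: le_lt_trans xr _; lra.
have fZ a (x : real_hilb hV) : (f (a *: x) : real_hilb hW) = a *: (f x : real_hilb hW).
  by rewrite realified_scaleE [LHS]linearZ.
exists (2 / r); split=> // [x y||x]; first exact: linearD.
  by rewrite divr_ge0// ltW.
have [/nm_eq0 ->|x0] := eqVneq (nm x) 0.
  have -> : (f (0 : real_hilb hV) : real_hilb hW) = 0 by exact: linear0.
  by rewrite !nm0 mulr0.
have nx : 0 < nm x by rewrite lt_neqAle eq_sym x0 nm_ge0.
have a0 : 0 < r / (2 * nm x) by rewrite divr_gt0// mulr_gt0.
have := h1 ((r / (2 * nm x)) *: x).
rewrite fZ !nmZ gtr0_norm//.
have -> : r / (2 * nm x) * nm x = r / 2 by field; rewrite gt_eqF.
move=> /(_ (lexx _)); rewrite mulrC -ler_pdivlMr// div1r invf_div.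
by move/le_trans; apply; rewrite le_eqVlt; apply/orP; left; apply/eqP; field; rewrite gt_eqF.
Qed.

Lemma continuous_blin (f : {linear V -> W}) C :
  blin (f : real_hilb hV -> real_hilb hW) C -> continuous f.
Proof.
move=> hf x; apply/cvg_rnormP => e e0; have C0 := blin_ge0 hf.
have r0 : 0 < e / (C + 1) by rewrite divr_gt0//; lra.
have rs : 0 < r2s (e / (C + 1)) by rewrite -(r2s0 R c) r2s_lt.
apply/nbhs_ballP; exists (r2s (e / (C + 1))) => //= y.
rewrite -ball_normE /ball_/= normr_rnorm r2s_lt => xy.
have {}xy : rnorm (y - x) <= e / (C + 1) by rewrite /rnorm distrC ltW.
have := blin_nm hf (y - x : V).
rewrite !nm_rnorm [X in rnorm X]linearB => h; apply: (le_trans h).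
apply: le_trans (ler_wpM2l C0 xy) _.
by rewrite mulrCA ler_piMr ?(ltW e0)// ler_pdivrMr; lra.
Qed.

(** Polar decomposition: a nonzero scalar is a positive real times a scalar of modulus one. *)
Lemma unit_linear (f : V -> W) :
  (forall x y, f (x + y) = f x + f y) ->
  (forall a x, f (r2s a *: x) = r2s a *: f x) ->
  (forall z x, `|z| = 1 -> f (z *: x) = z *: f x) -> linear f.
Proof.
move=> fD fr fu a x y; rewrite fD; congr (_ + _).
have [->|a0] := eqVneq a 0.
  by have := fr 0 x; rewrite r2s0 !scale0r.
have na : `|a| != 0 by rewrite normr_eq0.
have aE : a = r2s (scalar_re `|a|) * (a / `|a|).
  by rewrite -ge0_r2s// mulrCA divff// mulr1.
have z1 : `|a / `|a| | = 1 by rewrite normrM normfV normr_id divff.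
rewrite aE; move: (a / _) z1 => z z1.
by rewrite -!scalerA fr fu.
Qed.

End Topology.

Section UnitSymmetry.
Variables (R : realType) (c : scalar_kind).
Variables (X U : completeNormedModType (scalar_field R c)).
Hypotheses (hX : hilbert X) (hU : hilbert U).

(** The norm is preserved, and the real inner product is determined by the norm through
    polarization. *)
Lemma unit_blin (V : completeNormedModType (scalar_field R c)) (hV : hilbert V) z :
  `|z| = 1 -> blin (fun x : real_hilb hV => z *: (x : V) : real_hilb hV) 1 /\
  forall x y : real_hilb hV,
    ip (z *: (x : V) : real_hilb hV) (z *: (y : V)) = ip x y.
Proof.
move=> z1; set f := fun x : real_hilb hV => z *: (x : V) : real_hilb hV.
have fD x y : f (x + y) = f x + f y by rewrite /f [LHS]scalerDr.
have fZ a x : f (a *: x) = a *: f x.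
  by rewrite /f !realified_scaleE !scalerA mulrC.
have fn x : nm (f x) = nm x by rewrite !nm_rnorm rnorm_unit.
split; first by split=> // x; rewrite mul1r fn.
move=> x y; have := fn (x + y); rewrite fD => /(congr1 (fun r => r ^+ 2)).
have := congr1 (fun r => r ^+ 2) (fn x); have := congr1 (fun r => r ^+ 2) (fn y).
rewrite !nm_sq !ipE (ipC y) (ipC (f y)) /f; lra.
Qed.

Lemma unit_symmetry (S : R -> {linear X -> X}) (B : {linear U -> X}) w z : `|z| = 1 ->
  symmetry (sg_rescale w (fun t (x : real_hilb hX) => S (Num.max t 0) x : real_hilb hX))
    (fun v : real_hilb hU => B v : real_hilb hX)
    (fun x : real_hilb hX => z *: (x : X) : real_hilb hX)
    (fun v : real_hilb hU => z *: (v : U) : real_hilb hU).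
Proof.
move=> z1; have [b1 i1] := unit_blin hX z1; have [b2 i2] := unit_blin hU z1.
split=> // [t x|v]; last by rewrite [LHS]linearZ.
by rewrite /sg_rescale !realified_scaleE [S _ _]linearZ !scalerA mulrC.
Qed.

End UnitSymmetry.

Section ExpansionRescale.
Variables (R : realType) (X : hilb R).

(** The remainder is multiplied by e^(- w h), which is at most one because [0 <= w]; the only new
    term is h (e^(- w h) - 1) y, and it is o(h). *)
Lemma expansion_rescale (S SK : R -> X -> X) (w : R) (x y : X) : 0 <= w ->
  (forall e, 0 < e -> exists2 d, 0 < d & forall h, 0 <= h <= d ->
     nm (SK h x - sg_rescale w S h x - h *: y) <= e * h) ->
  forall e, 0 < e -> exists2 d, 0 < d & forall h, 0 <= h <= d ->
     nm (sg_rescale (- w) SK h x - S h x - h *: y) <= e * h.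
Proof.
move=> w0 hx e e0; have e2 : 0 < e / 2 by lra.
have [d1 d10 hd1] := hx _ e2.
have ny : 0 < nm y + 1 by have := nm_ge0 y; lra.
have e3 : 0 < e / (2 * (nm y + 1)) by rewrite divr_gt0// mulr_gt0.
have [d2 d20 hd2] : exists2 d, 0 < d & forall h, 0 <= h <= d ->
    `|expR (- w * h) - 1| <= e / (2 * (nm y + 1)).
  have /cvgrPdist_le/(_ _ e3) := @continuous_expR_scale R (- w) 0.
  move=> /nbhs_ballP[d /= d0 hd]; exists (d / 2) => [|h /andP[h0 hh]]; first by lra.
  have := hd h; rewrite mulr0 expR0 distrC; apply.
  by rewrite /ball/= sub0r normrN ger0_norm//; lra.
exists (Num.min d1 d2) => [|h]; first by rewrite lt_min d10.
rewrite le_min => /andP[h0 /andP[h1 h2]].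
have k1 := hd1 h; rewrite h0 h1 in k1; have {}k1 := k1 isT.
have k2 := hd2 h; rewrite h0 h2 in k2; have {}k2 := k2 isT.
rewrite /sg_rescale (max_idPl h0) in k1 *.
have -> : expR (- w * h) *: SK h x - S h x - h *: y =
   expR (- w * h) *: (SK h x - expR (w * h) *: S h x - h *: y) +
   h *: ((expR (- w * h) - 1) *: y).
  rewrite !scalerBr !scalerA -expRD mulNr addNr expR0 scale1r.
  rewrite mulrBr mulr1 scalerBl (mulrC h) addrA subrK //.
apply: le_trans (nmD _ _) _; rewrite !nmZ (ger0_norm h0) (ger0_norm (expR_ge0 _)).
have E1 : expR (- w * h) <= 1.
  by rewrite -expR0 ler_expR mulNr oppr_le0 mulr_ge0.
have k3 : expR (- w * h) * nm (SK h x - expR (w * h) *: S h x - h *: y) <= e / 2 * h.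
  by apply: le_trans k1; rewrite ler_piMl ?nm_ge0.
have k4 : h * (`|expR (- w * h) - 1| * nm y) <= h * (e / 2).
  rewrite ler_wpM2l//.
  apply: le_trans (ler_wpM2r (nm_ge0 y) k2) _.
  rewrite (_ : _ * nm y = e / 2 * (nm y / (nm y + 1))); last by field; lra.
  by rewrite ler_piMr ?(ltW e2)// ler_pdivrMr; lra.
lra.
Qed.

End ExpansionRescale.

(** * Simple integrals as weak integrals *)

Section Bochner.
Variables (R : realType) (c : scalar_kind).
Variables (X : completeNormedModType (scalar_field R c)) (hX : hilbert X).
Notation XH := (real_hilb hX).
Notation mu := (@lebesgue_measure R).

(** Tested against [z], both sides become the same finite sum, once [ip (s t) z] is written with the
    indicators of the level sets of [s]. *)
Lemma simple_integral_pint (T : R) (s : R -> X) : simple_function s ->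
  (simple_integral T s : XH) = pint 0 T (s : R -> XH).
Proof.
move=> hs; have [fs ms] := hs; have ps := @pw_simple _ XH s hs.
have bind x : bm (fun t => (s t == x)%:R : R).
  apply: (@simple_glue _ _ s (fun y _ => (y == x)%:R)) => // y; exact: bm_cst.
have riI x : ri 0 T (fun t => (s t == x)%:R) =
    fine (mu (`]0, T[%classic `&` s @^-1` [set x])).
  apply: EFin_inj; rewrite ri_EFin// fineK; last first.
    rewrite ge0_fin_numE//; apply: (@le_lt_trans _ _ (mu `]0, T[%classic)).
      by apply: le_measure => //; apply/mem_set => //; exact: (measurableI _ _ (measurable_itv _) (ms x)).
    by rewrite lebesgue_measure_itv/=; case: ifPn => // _; rewrite -EFinB ltry.
  rewrite setIC -integral_indic//; last exact: ms.
  apply: eq_integral => t _; rewrite indicE.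
  suff -> : (t \in s @^-1` [set x]) = (s t == x) by [].
  by apply/idP/eqP => [/set_mem|/mem_set].
apply: (@ip_inj _ XH) => z; rewrite pintE//.
rewrite /simple_integral fsbig_finite//=.
have -> : ri 0 T (fun t => ip (s t : XH) z) =
    ri 0 T (fun t => \sum_(x <- fset_set (range s)) (s t == x)%:R * ip (x : XH) z).
  apply: ri_ext => t _ _.
  have st : s t \in fset_set (range s) by rewrite in_fset_set// mem_set//; exists t.
  rewrite (bigD1_seq (s t) st (fset_uniq _))/=.
  rewrite eqxx mul1r big1 ?addr0// => x; rewrite eq_sym => /negPf ->.
  by rewrite mul0r.
have ri_sum (r : seq X) : bm (fun t => \sum_(x <- r) (s t == x)%:R * ip (x : XH) z) /\
   ri 0 T (fun t => \sum_(x <- r) (s t == x)%:R * ip (x : XH) z) =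
   \sum_(x <- r) fine (mu (`]0, T[%classic `&` s @^-1` [set x])) * ip (x : XH) z.
  elim: r => [|x r [bih ih]].
    split; first by under eq_fun do rewrite big_nil; exact: bm_cst.
    rewrite big_nil (@ri_ext _ 0 T _ (fun=> 0)); last by move=> t _ _; rewrite big_nil.
    have [T0|T0] := leP 0 T; first by rewrite ri_cst// mul0r.
    by rewrite ri_nil// ltW.
  have bx : bm (fun t => (s t == x)%:R * ip (x : XH) z).
    by apply: bmM => //; exact: bm_cst.
  have E : (fun t => \sum_(y <- x :: r) (s t == y)%:R * ip (y : XH) z) =
     (fun t => (s t == x)%:R * ip (x : XH) z +
       \sum_(y <- r) (s t == y)%:R * ip (y : XH) z).
    by apply/funext => t; rewrite big_cons.
  rewrite E; split; first exact: bmD.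
  rewrite riD// ih big_cons -riI; congr (_ + _).
  rewrite mulrC -riZ//; apply: ri_ext => t _ _; exact: mulrC.
rewrite (ri_sum _).2.
elim: (fset_set (range s) : seq X) => [|x r ih].
  by rewrite !big_nil; exact: (@ip0l R XH z).
rewrite !big_cons -ih; apply: etrans (@ipDl R XH _ _ _) _; congr (_ + _).
exact: (@ipZl R XH).
Qed.

End Bochner.

Section Transfer.
Variables (R : realType) (c : scalar_kind).
Variables (X U : completeNormedModType (scalar_field R c)).
Hypotheses (hX : hilbert X) (hU : hilbert U).
Notation XH := (real_hilb hX).
Notation UH := (real_hilb hU).
Notation r2s := (@scalar_of_real R c).
Notation mu := (@lebesgue_measure R).

(** [c0_semigroup] leaves negative times open while [semigroup] prescribes the identity there; the
    maximum reconciles the two. *)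
Definition real_sg (S : R -> {linear X -> X}) (t : R) (x : XH) : XH :=
  S (Num.max t 0) x.

Lemma real_sg_semigroup S : c0_semigroup S -> semigroup (real_sg S).
Proof.
move=> [cS S0 SD Sr]; split.
- move=> t; apply: (blin_continuous hX hX); apply: cS.
  by rewrite le_max lexx orbT.
- by move=> t x t0; rewrite /real_sg (max_idPr t0) S0.
- move=> s t x s0 t0; rewrite /real_sg !(max_idPl _) ?addr_ge0//.
  exact: SD.
- move=> x e e0; have /cvg_rnormP/(_ e e0)/at_right0P[d d0 hd] := Sr x.
  exists d => // h /andP[]; rewrite le_eqVlt => /orP[/eqP <- _|h0 hh].
    by rewrite /real_sg maxxx S0 subrr nm0 ltW.
  rewrite nm_rnorm /real_sg (max_idPl (ltW h0)); apply: hd.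
  by rewrite h0.
Qed.

Variables (S : R -> {linear X -> X}) (B : {linear U -> X}) (T : R).
Hypotheses (hS : c0_semigroup S) (hB : continuous B) (T0 : 0 < T).
Notation BR := (B : UH -> XH).

(** The integrand for the simple control [p] is compared with the one for [u], at the price of
    [M * b] times the distance in mean, and then with a simple function [sg n] from the definition
    of the Bochner integral. Together with the distance from the integral of [sg n] to [v], these
    are three errors of [e / 3]. *)
Lemma null_controllable_simple : exactly_null_controllable S B T ->
  forall x : XH, exists C, forall e, 0 < e -> exists u : R -> UH,
    [/\ pw u, energy T u <= C & nm (traj (real_sg S) BR T x u) <= e].
Proof.
move=> hN x; have hSR := real_sg_semigroup hS.
have [b hb] := blin_continuous hU hX hB.
have [M M1 hM] := sg_bounded hSR T.
have b0 := blin_ge0 hb.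
have Mb : 0 <= M * b by rewrite mulr_ge0//; lra.
have [u [[s [ss [N [mN N0 hN']]]] u2] [v [_ [sg [ssg hsg csg]]] yE]] := hN x.
have [||C hC] := @simple_approximation R UH T u s N ss mN N0.
- move=> t tT Nt e e0.
  have st : s n t @[n --> \oo] --> u t.
    apply: contrapT => h; apply: Nt; apply: hN' => /= /(_ _)/h.
    by apply; rewrite /= in_itv.
  have [n0 _ hn0] := (cvg_rnormP _ _ _).1 st e e0.
  by exists n0 => n nn0; rewrite nm_rnorm; exact: (hn0 n nn0).
- by under eq_integral do rewrite nm_rnorm.
exists C => e e0.
have e1 : 0 < e / (3 * (M * b + 1)) by rewrite divr_gt0// mulr_gt0//; lra.
have [p [d [sp Ep [md d0] pd id]]] := hC _ e1.
have pp := pw_simple sp.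
exists p; split=> //.
have e3 : 0 < e / 3 by lra.
have [n [h1 h2]] : exists n, (\int[mu]_(t in `]0%R, T[%classic)
      (rnorm (S (T - t) (B (u t)) - sg n t))%:E <= (e / 3)%:E)%E /\
    rnorm (simple_integral T (sg n) - v) <= e / 3.
  have /cvg_rnormP/(_ _ e3) n2 := csg.
  have n1 : \forall n \near \oo, (\int[mu]_(t in `]0%R, T[%classic)
      (rnorm (S (T - t) (B (u t)) - sg n t))%:E <= (e / 3)%:E)%E.
    have /fine_cvgP[f1 /cvgrPdist_le/(_ _ e3) f2] := hsg.
    near=> n.
    have fn : (\int[mu]_(t in `]0%R, T[%classic)
      (rnorm (S (T - t) (B (u t)) - sg n t))%:E)%E \is a fin_num by near: n.
    rewrite -(fineK fn) lee_fin; apply: le_trans (ler_norm _) _.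
    rewrite -normrN -sub0r; near: n; exact: f2.
  by near \oo%classic => n; exists n; split; near: n.
pose f (t : R) : XH := S (T - t) (B (u t)).
pose g (t : R) : XH := real_sg S (T - t) (BR (p t)).
pose q (t : R) : XH := sg n t.
have pg : pw g by exact: (pw_conv hSR hb T pp).
have pq : pw q by exact: (@pw_simple R XH (sg n) (ssg n)).
have pgq : pw (fun t => g t - q t) := pwB pg pq.
have key : nm (pint 0 T g - pint 0 T q) <= 2 * (e / 3).
  have -> : pint 0 T g - pint 0 T q = pint 0 T (fun t => g t - q t).
    by rewrite pintB.
  apply: le_trans (pint_nm _ _ pgq) _.
  rewrite -lee_fin ri_EFin; last exact: pw_bm_nm.
  (* The integral of [nm (f t - q t)] in the hypothesis is a lower integral, so the triangle
     inequality through [f] is integrated in this form, off the null set [N]. *)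
  have := @ae_le_lower_integral R `]0, T[ N (fun t => nm (g t - q t))
    (fun t => M * b * d t) (fun t => nm (f t - q t)).
  move=> /(_ _ mN N0 _ _ _ _ _ _) h.
  apply: le_trans (h _ _ _ _ _ _ _) _ => {h}.
  - exact: measurable_itv.
  - by apply: measurable_funTS; have [] := pw_bm_nm pgq.
  - apply: measurable_funTS; apply: measurable_funM => //; exact: measurable_cst.
  - by move=> t _; exact: nm_ge0.
  - by move=> t _; rewrite mulr_ge0.
  - by move=> t _; exact: nm_ge0.
  - move=> t; rewrite /= in_itv/= => tT Nt.
    apply: le_trans (@nm_trans _ _ (f t) _ _) _; rewrite lerD2r.
    have -> : g t - f t = real_sg S (T - t) (BR (p t - u t : UH)).
      rewrite (blinB hb) (sgB hSR) /g /f /real_sg (max_idPl _)//.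
      by rewrite subr_ge0 ltW//; case/andP: tT.
    have Tt : T - t <= T by rewrite lerBlDr lerDl ltW//; case/andP: tT.
    apply: le_trans (blin_nm (hM _ Tt) _) _.
    rewrite -mulrA ler_wpM2l//; first by lra.
    apply: le_trans (blin_nm hb _) _; rewrite ler_wpM2l//; exact: pd.
  rewrite (_ : 2 * (e / 3) = e / 3 + e / 3); last by ring.
  rewrite EFinD; apply: leeD; last first.
    by under eq_integral do rewrite nm_rnorm.
  under eq_integral do rewrite EFinM.
  rewrite ge0_integralZl_EFin//; last 2 first.
  - by move=> t _; rewrite lee_fin.
  - by apply/measurable_EFinP; exact: measurable_funTS.
  apply: le_trans (lee_wpmul2l _ id) _; first by rewrite lee_fin.
  rewrite -EFinM lee_fin.
  rewrite (_ : M * b * (e / (3 * (M * b + 1))) = e / 3 * (M * b / (M * b + 1))).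
    by rewrite ler_piMr ?(ltW e3)// ler_pdivrMr; lra.
  by field; lra.
(* The final state is zero, so [S T x] equals [- v]. *)
have tE : traj (real_sg S) BR T x p = (pint 0 T g - pint 0 T q) + (pint 0 T q - (v : XH)).
  rewrite addrA subrK trajE convE -/g addrC; congr (_ + _).
  rewrite /real_sg (max_idPl (ltW T0)).
  by apply/eqP; rewrite -addr_eq0; apply/eqP/esym.
rewrite tE; apply: le_trans (nmD _ _) _.
have : nm (pint 0 T q - (v : XH)) <= e / 3.
  by rewrite -(simple_integral_pint hX T (ssg n)) nm_rnorm.
move: key; nm_lra.
Unshelve. all: by end_near.
Qed.

End Transfer.

(** * Generators, growth bounds and the shift by the rate *)

Section Conclusion.
Variables (R : realType) (c : scalar_kind).
Variables (X U : completeNormedModType (scalar_field R c)).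
Hypotheses (hX : hilbert X) (hU : hilbert U).
Notation XH := (real_hilb hX).
Notation UH := (real_hilb hU).
Notation r2s := (@scalar_of_real R c).

Lemma opnorm_le (f : X -> X) C : 0 <= C ->
  (forall x, rnorm (f x) <= C * rnorm x) -> opnorm f <= C.
Proof.
move=> C0 hf; apply: ge_sup.
  by exists (rnorm (f 0)), 0 => //=; rewrite /rnorm normr0 -(r2s0 R c) r2sK ler01.
by move=> _ [x /= x1 <-]; apply: le_trans (hf x) _; rewrite ler_piMr.
Qed.

Lemma growth_bound_le (S : R -> {linear X -> X}) M w : 1 <= M ->
  (forall t x, 0 <= t -> rnorm (S t x) <= M * expR (w * t) * rnorm x) ->
  (growth_bound S <= w%:E)%E.
Proof.
move=> M1 hS; apply: ereal_inf_lbound; exists w => //=; exists M => // t t0.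
apply: opnorm_le => [|x]; last exact: hS.
by rewrite mulr_ge0 ?expR_ge0//; lra.
Qed.

Lemma semigroup_c0 (SK : R -> {linear X -> X}) :
  semigroup (fun t (x : XH) => SK t x : XH) -> c0_semigroup SK.
Proof.
move=> hS; split.
- by move=> t _; have [C] := sg_blin hS t; exact: continuous_blin.
- by move=> x; exact: (sg_neg hS).
- by move=> s t s0 t0 x; exact: (sg_add hS).
- move=> x; apply/cvg_rnormP => e e0; apply/at_right0P.
  have [d d0 hd] := sg_cont hS x e0; exists d => // h /andP[h0 hh].
  by have := hd h; rewrite nm_rnorm; apply; rewrite ltW.
Qed.

(** The two difference quotients differ by a term converging to [P x] for every [x], in the domain
    or not; hence they converge for the same [x], which gives the equality of domains. *)
Lemma generates_perturbation (S SK : R -> {linear X -> X}) (D : set X)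
    (A P : X -> X) : generates D A S -> c0_semigroup SK ->
  (forall x e, 0 < e -> exists2 d, 0 < d & forall h, 0 < h <= d ->
     rnorm (SK h x - S h x - r2s h *: P x) <= e * h) ->
  generates D (fun x => A x + P x) SK.
Proof.
move=> [cS DE hD] cSK hP.
have lim x : difference_quotient SK x h - difference_quotient S x h @[h --> 0^'+]
    --> P x.
  apply/cvg_rnormP => e e0; apply/at_right0P; have [d d0 hd] := hP x e e0.
  exists d => // h hh; have h0 : 0 < h by case/andP: hh.
  have rh0 : r2s h != 0 by rewrite -(r2s0 R c) (inj_eq (@r2s_inj R c)) gt_eqF.
  rewrite /difference_quotient -scalerBr.
  have -> : (r2s h)^-1 *: (SK h x - x - (S h x - x)) - P x =
      (r2s h)^-1 *: (SK h x - S h x - r2s h *: P x).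
    rewrite [RHS]scalerBr scalerA mulVf// scale1r.
    by rewrite opprB addrA subrK.
  rewrite /rnorm normrZ -r2sV normr_r2s scalar_re_r2sM gtr0_norm ?invr_gt0//.
  by rewrite mulrC ler_pdivrMr//; exact: hd.
have to_sum x y : difference_quotient S x h @[h --> 0^'+] --> y ->
    difference_quotient SK x h @[h --> 0^'+] --> y + P x.
  move=> hy; apply: cvg_trans (cvgD hy (lim x)).
  by apply: near_eq_cvg; apply: nearW => h /=; rewrite addrC subrK.
have of_sum x y : difference_quotient SK x h @[h --> 0^'+] --> y ->
    difference_quotient S x h @[h --> 0^'+] --> y - P x.
  move=> hy; apply: cvg_trans (cvgB hy (lim x)).
  by apply: near_eq_cvg; apply: nearW => h /=; rewrite subKr.
split=> //; last by move=> x /hD /to_sum.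
rewrite DE; apply/seteqP; split=> x /= /cvg_ex[y hy]; apply/cvg_ex.
  by exists (y + P x); exact: to_sum.
by exists (y - P x); exact: of_sum.
Qed.

Lemma real_linear (V W : completeNormedModType (scalar_field R c))
    (hV : hilbert V) (hW : hilbert W) (f : V -> W) C :
  blin (f : real_hilb hV -> real_hilb hW) C ->
  (forall z x, `|z| = 1 -> f (z *: x) = z *: f x) -> linear f.
Proof.
move=> hf; apply: unit_linear => [x y|a x]; first exact: (blinD hf).
exact: (blinZ hf).
Qed.

Lemma closed_loop_generator (D : set X) (A : X -> X) (S : R -> {linear X -> X})
    (B : {linear U -> X}) T w : generates D A S -> continuous B ->
  0 < T -> exactly_null_controllable S B T -> 0 <= w ->
  exists (K : {linear X -> U}) (SK : R -> {linear X -> X}),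
    [/\ continuous K, generates D (fun x => A x + B (K x)) SK
      & (growth_bound SK <= (- w)%:E)%E].
Proof.
move=> hA cB T0 hN w0; have [hS _ _] := hA.
have hSR := real_sg_semigroup hX hS.
have [b hb] := blin_continuous hU hX cB.
have hnull := approx_null_controllable_rescale hSR hb T0 w0
  (null_controllable_simple (hX := hX) hU hS cB T0 hN).
have [K [SK [[k hK] [hSK [M hM]] hexp hsym]]] :=
  bounded_closed_loop (semigroup_rescale w hSR) hb hnull.
(* The inverse symmetry required by [bounded_closed_loop] is multiplication by [z^-1], also of
   modulus one. *)
have unit_comm z : `|z| = 1 -> (forall t (x : X), SK t (z *: x) = z *: (SK t x : X)) /\
    forall x : X, K (z *: x) = z *: (K x : U).
  move=> z1; have z0 : z != 0 by rewrite -normr_eq0 z1 oner_eq0.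
  have zV : `|z^-1| = 1 by rewrite normfV z1 invr1.
  have := hsym _ _ _ _ (unit_symmetry hX hU S B w z1) (unit_symmetry hX hU S B w zV).
  apply=> x.
    by rewrite scalerA mulVf// scale1r.
  by rewrite scalerA mulfV// scale1r.
have hSK' := semigroup_rescale (- w) hSK.
have linK : linear (K : X -> U).
  by apply: (real_linear (hV := hX) (hW := hU) hK) => z x /unit_comm[].
have linSK t : linear (sg_rescale (- w) SK t : X -> X).
  have [C hC] := sg_blin hSK' t.
  apply: (real_linear (hV := hX) (hW := hX) hC) => z x /unit_comm[h _].
  rewrite /sg_rescale !realified_scaleE [SK t _]h !scalerA.
  by rewrite mulrC.
pose Kl : {linear X -> U} := HB.pack (K : X -> U) (GRing.isLinear.Build _ _ _ _ _ linK).
pose SKl t : {linear X -> X} := HB.pack (sg_rescale (- w) SK t : X -> X)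
  (GRing.isLinear.Build _ _ _ _ _ (linSK t)).
exists Kl, SKl; split.
- exact: (continuous_blin (hV := hX) (hW := hU) (f := Kl) hK).
- apply: (generates_perturbation hA (P := fun x => B (Kl x))).
    exact: (@semigroup_c0 SKl hSK').
  move=> x e e0; have [d d0 hd] := expansion_rescale w0 (hexp x) e0.
  exists d => // h /andP[h0 hh].
  have := hd h; rewrite (ltW h0) nm_rnorm /real_sg (max_idPl (ltW h0)).
  exact.
(* The uniform bound [M] need not be at least one, as the definition of the growth bound demands. *)
- apply: (@growth_bound_le _ (Num.max M 1)); first by rewrite le_max lexx orbT.
  move=> t x t0; rewrite -!(nm_rnorm (hX := hX)) /sg_rescale nmZ (max_idPl t0).
  rewrite ger0_norm ?expR_ge0// mulrAC mulrC ler_wpM2r ?expR_ge0//.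
  by apply: le_trans (hM t x) _; rewrite ler_wpM2r ?nm_ge0// le_max lexx.
Qed.

End Conclusion.

Theorem proposition1 (R : realType) (c : scalar_kind)
    (X U : completeNormedModType (scalar_field R c))
    (hX : hilbert X) (hU : hilbert U)
    (D : set X) (A : X -> X) (S : R -> {linear X -> X})
    (hA : generates D A S)
    (B : {linear U -> X}) (hB : continuous B) :
  (exists2 T : R, 0 < T & exactly_null_controllable S B T) ->
  completely_stabilizable D A B.
Proof.
move=> [T T0 hN]; apply: eq_ninfty => a.
(* The rate must be nonnegative, and [- |a| <= a]; so the rate is the absolute value of [a]. *)
have [K [SK [cK gSK hw]]] :=
  closed_loop_generator hX hU hA hB T0 hN (normr_ge0 a).
apply: (@le_trans _ _ (growth_bound SK)).
  by apply: ereal_inf_lbound; exists K, SK.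
by apply: le_trans hw _; rewrite lee_fin lerNl -normrN ler_norm.
Qed.
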